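(* Let $\Gamma$ be a $\mathbb{Z}^d$-periodic isthmus-connected graph. Fix nonzero edge weights $E$. If the potential $V$ is such that the parameters $(V,E)$ are generic in the sense of the isthmus-genericity conditions given in the context, then the only critical points of the Bloch variety occur at the corner points, and all are nondegenerate. The spectral edges conjecture holds for $\Gamma$ and for Schrödinger operators on $\Gamma$.
   Context: Let $d>0$ be an integer, $[d]=\{1,\dots,d\}$, $e_1,\dots,e_d$ the standard basis of $\mathbb{Z}^d$, $\mathbb{T}$ the unit complex numbers and $\mathbb{C}^\times$ the nonzero complex numbers. A $\mathbb{Z}^d$-periodic graph $\Gamma$ is a graph with vertex set $\mathcal{V}$ and edge set $\mathcal{E}$, equipped with a free cocompact action of $\mathbb{Z}^d$; the action of $\alpha\in\mathbb{Z}^d$ on $v$ is written $\alpha+v$. $W\subset\mathcal{V}$ is a finite set of orbit representatives. Parameters are pairs $(V,E)$ of $\mathbb{Z}^d$-periodic functions $V\colon\mathcal{V}\to\mathbb{R}$ (potential), $E\colon\mathcal{E}\to\mathbb{R}$ (edge weights, edges undirected). The Floquet matrix $H(z)$, $z=(z_1,\dots,z_d)$, is the $|W|\times|W|$ matrix with $(v,u)$-entry $V(v)\delta_{v,u}+\sum_{(v,\alpha+u)\in\mathcal{E}}E(v,\alpha+u)z^\alpha$, where $z^\alpha=z_1^{\alpha_1}\cdots z_d^{\alpha_d}$. The dispersion polynomial is $D(z,\lambda)=\det(H(z)-\lambda)$; the Bloch variety is $\{(z,\lambda)\in(\mathbb{C}^\times)^d\times\mathbb{C}\mid D(z,\lambda)=0\}$.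 A critical point is a point $(z,\lambda)\in(\mathbb{C}^\times)^d\times\mathbb{C}$ with $D=\partial D/\partial z_1=\dots=\partial D/\partial z_d=0$; it is nondegenerate if the Jacobian matrix of this system is invertible there. Corner points are those with $z_i=\pm1$ for all $i$. For $z\in\mathbb{T}^d$, $H(z)$ is Hermitian; its ordered eigenvalues $\lambda_1(z)\le\dots\le\lambda_{|W|}(z)$ are the spectral band functions $\mathbb{T}^d\to\mathbb{R}$, and the union of their graphs is the dispersion relation. An extremum of the dispersion relation is a point $(x,\lambda_0)$ with $\lambda_0=\lambda_j(x)$ where $\lambda_j$ has a local maximum or minimum at $x$; it is nondegenerate if the Hessian of the band function is invertible there. The spectral edges conjecture for $\Gamma$: for $(V,E)$ in the complement of a proper algebraic subset of the space of all parameters, the extrema of the dispersion relation are isolated, nondegenerate, and each occurs on (the graph of) a single spectral band function. The spectral edges conjecture for Schrödinger operators on $\Gamma$: the same statement with $E\equiv1$ fixed and $V$ in the complement of a proper algebraic subset of the space of potentials. Isthmus graphs: let $A$ be a connected graph with $a$ vertices $v_{1-a},v_{2-a},\dots,v_0$, $I$ a path with vertices (in order) $v_1,\dots,v_m$ ($m\ge1$), and $B$ a connected graph with $b$ vertices $v_{m+1},\dots,v_{m+b}$. The isthmus graph $G$ is obtained from the disjoint union $A\sqcup I\sqcup B$ by adding the edges $(v_0,v_1)$ and $(v_m,v_{m+1})$. Either $A$ or $B$ may be empty ($a=0$ or $b=0$), in which case the corresponding edge is not added. Given a function $f\colon[d]\to\{v_1,\dots,v_m\}$, the $\mathbb{Z}^d$-periodic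 isthmus-connected graph $\Gamma$ is obtained from $\mathbb{Z}^d\times G$ by adding, for each $\alpha\in\mathbb{Z}^d$ and $j\in[d]$, an edge between $(\alpha,f(j))$ and $(\alpha+e_j,f(j))$. Isthmus-genericity: index rows and columns of $H(z)$ by $1-a,\dots,m+b$ according to $v_{1-a},\dots,v_{m+b}$. For an index $s$, let $P_s(z,\lambda)$ be the determinant of the submatrix of $H(z)-\lambda$ formed by rows and columns with indices less than $s$, and $Q_s(z,\lambda)$ the determinant of the submatrix formed by rows and columns with indices greater than $s$, with the convention that the determinant of the empty matrix is $1$ (so $P_{1-a}=Q_{m+b}=1$). Parameters $(V,E)$ are generic if: (1) no edge weight vanishes; and (2) for every corner point $x\in\mathbb{T}^d$ and every pair of indices $1\le r\le s\le m$, the polynomials $P_r(x,\lambda)$ and $Q_s(x,\lambda)$ in $\lambda$ have no common roots, and moreover neither of them has a root in common with $D(x,\lambda)$. *)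

(* Defs.v *)
From HB Require Import structures.
From mathcomp Require Import all_boot all_order all_algebra.
From mathcomp Require Import complex.
From mathcomp Require Import all_classical all_reals all_analysis.
From mathcomp Require mpoly.

Set Implicit Arguments.
Unset Strict Implicit.
Unset Printing Implicit Defensive.

Import Order.TTheory GRing.Theory Num.Theory numFieldNormedType.Exports.
Local Open Scope classical_set_scope.
Local Open Scope ring_scope.
Local Open Scope complex_scope.

(* The library attaches the norm topology to (the sort of) a numFieldType, so
   R[i] has to be presented as such for topological inference to succeed. *)
Definition Cplx (R : realType) : numClosedFieldType := R[i].

(* Graphs are simple. The action on edges is the one induced by the action on
   vertices; [rep] enumerates the set W of orbit representatives. Finitely many
   vertex orbits and local finiteness together amount to cocompactness. *)
Record periodic_graph (d : nat) := PeriodicGraph {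
  vertex : Type;
  edge : rel vertex;
  act : 'rV[int]_d -> vertex -> vertex;
  nrep : nat;
  rep : 'I_nrep -> vertex;
  edge_sym : symmetric edge;
  edge_irr : irreflexive edge;
  act0 : forall v, act 0 v = v;
  actD : forall al be v, act (al + be) v = act al (act be v);
  act_edge : forall al u v, edge (act al u) (act al v) = edge u v;
  act_free : forall al v, act al v = v -> al = 0;
  rep_surj : forall v, exists al i, v = act al (rep i);
  rep_inj : forall al i j, act al (rep i) = rep j -> i = j;
  edge_fin : forall v, finite_set [set u | edge v u]
}.

Record potential (R : realType) d (Gam : periodic_graph d) := Potential {
  pot :> vertex Gam -> R;
  pot_per : forall al v, pot (act al v) = pot v
}.

(* Every periodic function on undirected edges extends (by 0) to such a
   function on pairs of vertices; the values off the edge set are never used. *)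
Record edge_weight (R : realType) d (Gam : periodic_graph d) := EdgeWeight {
  wt :> vertex Gam -> vertex Gam -> R;
  wt_sym : forall u v, wt u v = wt v u;
  wt_per : forall al u v, wt (act al u) (act al v) = wt u v
}.

Definition unit_weight (R : realType) d (Gam : periodic_graph d) :
    edge_weight R Gam :=
  @EdgeWeight R d Gam (fun _ _ => 1) (fun _ _ => erefl) (fun _ _ _ => erefl).

Definition nonvanishing (R : realType) d (Gam : periodic_graph d)
    (E : edge_weight R Gam) : Prop :=
  forall u v, edge u v -> E u v != 0.

Definition monomial (R : realType) d (z : 'rV[Cplx R]_d) (al : 'rV[int]_d) :
    Cplx R :=
  \prod_(k < d) z 0 k ^ al 0 k.

Section Bloch.
Context {R : realType} {d : nat} {Gam : periodic_graph d}.
Variables (V : potential R Gam) (E : edge_weight R Gam).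
Local Notation C := (Cplx R).

Definition floquet (z : 'rV[C]_d) : 'M[C]_(nrep Gam) :=
  \matrix_(i, j) (((V (rep i))%:C : C) *+ (i == j) +
    \sum_(al \in [set al | edge (rep i) (act al (rep j))])
      ((E (rep i) (act al (rep j)))%:C : C) * monomial z al).

Definition dispersion (p : 'rV[C]_d * C) : C :=
  \det (floquet p.1 - p.2%:M).

Definition direction (k : 'I_(d + 1)) : 'rV[C]_d * C :=
  match fintype.split k with
  | inl i => (delta_mx 0 i, 0)
  | inr _ => (0, 1)
  end.

(* Equations ordered as dD/dz_1, ..., dD/dz_d, D, coordinates as z_1, ..., z_d,
   lambda. The scalars of the normed space C^d x C being complex, these are
   complex derivatives. *)
Definition critical_system (k : 'I_(d + 1)) : 'rV[C]_d * C -> C :=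
  match fintype.split k with
  | inl i => 'D_(direction (lshift 1 i)) dispersion
  | inr _ => dispersion
  end.

Definition critical_point (p : 'rV[C]_d * C) : Prop :=
  (forall i, p.1 0 i != 0) /\ (forall k, critical_system k p = 0).

Definition critical_jacobian (p : 'rV[C]_d * C) : 'M[C]_(d + 1) :=
  \matrix_(k, l) 'D_(direction l) (critical_system k) p.

Definition nondegenerate_critical (p : 'rV[C]_d * C) : Prop :=
  critical_jacobian p \in unitmx.

End Bloch.

Definition corner (R : realType) d (x : 'rV[Cplx R]_d) : Prop :=
  forall k, x 0 k = 1 \/ x 0 k = -1.

Definition torus (R : realType) d (x : 'rV[Cplx R]_d) : Prop :=
  forall k, `|x 0 k| = 1.

Definition torus_point (R : realType) d (t : 'rV[R]_d) : 'rV[Cplx R]_d :=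
  \row_k (cos (t 0 k) +i* sin (t 0 k)).

Section Dispersion.
Context {R : realType} {d : nat} {Gam : periodic_graph d}.
Variables (V : potential R Gam) (E : edge_weight R Gam).
Local Notation C := (Cplx R).

(* [spectral_diag] lists the eigenvalues, with multiplicity, of a normal
   matrix; bands are only considered on the torus, where H(x) is Hermitian. *)
Definition band (j : 'I_(nrep Gam)) (x : 'rV[C]_d) : R :=
  nth 0 (sort (fun s t : R => s <= t)
           [seq complex.Re (spectral_diag (floquet V E x) 0 i)
              | i <- enum 'I_(nrep Gam)]) j.

Definition local_extremum (j : 'I_(nrep Gam)) (x : 'rV[C]_d) : Prop :=
  (\forall y \near x, torus y -> band j y <= band j x) \/
  (\forall y \near x, torus y -> band j x <= band j y).

Definition extremum (p : 'rV[C]_d * R) : Prop :=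
  torus p.1 /\ exists j, p.2 = band j p.1 /\ local_extremum j p.1.

(* The Hessian is taken in the angular coordinates of the torus, and is
   required to exist: the band function is twice differentiable at x. *)
Definition angular_band (j : 'I_(nrep Gam)) (t : 'rV[R]_d) : R :=
  band j (torus_point t).

Definition nondegenerate_band (j : 'I_(nrep Gam)) (x : 'rV[C]_d) : Prop :=
  forall t : 'rV[R]_d, torus_point t = x ->
  let g := angular_band j in
  let dg (k : 'I_d) : 'rV[R]_d -> R := 'D_(delta_mx 0 k) g in
  [/\ \forall s \near t, differentiable g s,
      forall k, differentiable (dg k) t &
      (\matrix_(k, l) 'D_(delta_mx 0 l) (dg k) t : 'M[R]_d) \in unitmx].

Definition spectral_edges_regular : Prop :=
  forall p, extremum p ->
  [/\ \forall q \near p, extremum q -> q = p,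
      forall j, p.2 = band j p.1 -> local_extremum j p.1 ->
        nondegenerate_band j p.1 &
      exists! j, p.2 = band j p.1].

End Dispersion.

(* Algebraic subsets of a set X of functions, for a family [coord] of evaluation
   functionals on X: common zeros of finitely many real polynomials in finitely
   many evaluations. Periodic functions are determined by finitely many of their
   values, and the other values repeat these, so that for the spaces below this
   is the notion of algebraic subset of a finite-dimensional vector space. *)
Definition algebraic_subset (R : realType) (X I : Type) (coord : I -> X -> R)
    (S : set X) : Prop :=
  exists (n N : nat) (c : 'I_n -> I) (F : 'I_N -> mpoly.mpoly n R),
    S = [set x | forall l, mpoly.meval (fun k => coord (c k) x) (F l) = 0].

Definition proper_algebraic (R : realType) (X I : Type) (coord : I -> X -> R)
    (S : set X) : Prop :=
  algebraic_subset coord S /\ S <> setT.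

Definition potential_coord (R : realType) d (Gam : periodic_graph d)
    (v : vertex Gam) (V : potential R Gam) : R := V v.

Definition parameter_coord (R : realType) d (Gam : periodic_graph d)
    (i : vertex Gam + {e : vertex Gam * vertex Gam | edge e.1 e.2})
    (VE : potential R Gam * edge_weight R Gam) : R :=
  match i with
  | inl v => VE.1 v
  | inr e => VE.2 (sval e).1 (sval e).2
  end.

Definition spectral_edges_conjecture (R : realType) d
    (Gam : periodic_graph d) : Prop :=
  exists S : set (potential R Gam * edge_weight R Gam),
    proper_algebraic (@parameter_coord R d Gam) S /\
    forall V E, ~ S (V, E) -> spectral_edges_regular V E.

Definition schrodinger_spectral_edges_conjecture (R : realType) d
    (Gam : periodic_graph d) : Prop :=
  exists S : set (potential R Gam),
    proper_algebraic (@potential_coord R d Gam) S /\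
    forall V, ~ S V -> spectral_edges_regular V (unit_weight R Gam).

Record sgraph (n : nat) := SGraph {
  adj :> rel 'I_n;
  adj_sym : symmetric adj;
  adj_irr : irreflexive adj
}.

(* The empty graph counts as connected. *)
Definition connected_sgraph n (G : sgraph n) : Prop :=
  forall u v, connect G u v.

Section Isthmus.
Context {a m b : nat}.
Variables (A : sgraph a) (B : sgraph b).

(* The vertex v_s is the index a + s - 1. Two vertices that are neither both in
   A nor both in B are adjacent iff they are consecutive; for 0 < m this gives
   the path I, the edge (v_0, v_1) if 0 < a, and (v_m, v_{m+1}) if 0 < b. *)
Definition isthmus_adj : rel 'I_(a + m + b) := fun i j =>
  let consecutive := (i.+1 == j :> nat) || (j.+1 == i :> nat) in
  match fintype.split i, fintype.split j with
  | inr x, inr y => B x y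
  | inl i', inl j' =>
      match fintype.split i', fintype.split j' with
      | inl x, inl y => A x y
      | _, _ => consecutive
      end
  | _, _ => consecutive
  end.

Lemma isthmus_adj_sym : symmetric isthmus_adj.
Proof.
move=> i j; rewrite /isthmus_adj orbC.
case: (fintype.split i) => [i'|x]; case: (fintype.split j) => [j'|y] //; last exact: adj_sym.
by case: (fintype.split i') => [x|x]; case: (fintype.split j') => [y|y] //; exact: adj_sym.
Qed.

Lemma isthmus_adj_irr : irreflexive isthmus_adj.
Proof.
move=> i; rewrite /isthmus_adj orbb gtn_eqF //.
case: (fintype.split i) => [i'|x]; last exact: adj_irr.
by case: (fintype.split i') => [x|x] //; exact: adj_irr.
Qed.

Definition isthmus_graph : sgraph (a + m + b) :=
  SGraph isthmus_adj_sym isthmus_adj_irr.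

(* r : 'I_m stands for v_{r+1}. *)
Definition isthmus_vertex (r : 'I_m) : 'I_(a + m + b) := lshift b (rshift a r).

End Isthmus.

Section Connected.
Context {d n : nat}.
Variables (G : sgraph n) (f : 'I_d -> 'I_n).
Local Notation vtx := ('rV[int]_d * 'I_n)%type.

Definition basis_vector (k : 'I_d) : 'rV[int]_d := delta_mx 0 k.

Definition connected_edge : rel vtx := fun u v =>
  (u.1 == v.1) && G u.2 v.2 ||
  [exists k, [&& u.2 == f k, v.2 == f k &
    (v.1 == u.1 + basis_vector k) || (u.1 == v.1 + basis_vector k)]].

Definition translate (al : 'rV[int]_d) (v : vtx) : vtx := (al + v.1, v.2).

Lemma basis_vector_neq0 k : basis_vector k != 0.
Proof.
by apply/eqP => /matrixP/(_ 0 k); rewrite !mxE !eqxx.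
Qed.

Lemma connected_edge_sym : symmetric connected_edge.
Proof.
move=> u v; rewrite /connected_edge eq_sym adj_sym; congr (_ || _).
by apply: eq_existsb => k; rewrite andbCA orbC.
Qed.

Lemma connected_edge_irr : irreflexive connected_edge.
Proof.
move=> u; rewrite /connected_edge adj_irr andbF /=.
apply/existsP => -[k /and3P[_ _]]; rewrite orbb -{1}(addr0 u.1).
by rewrite (inj_eq (addrI _)) eq_sym (negPf (basis_vector_neq0 k)).
Qed.

Lemma translate0 v : translate 0 v = v.
Proof. by rewrite /translate add0r -surjective_pairing. Qed.

Lemma translateD al be v : translate (al + be) v = translate al (translate be v).
Proof. by rewrite /translate /= addrA. Qed.

Lemma translate_edge al u v :
  connected_edge (translate al u) (translate al v) = connected_edge u v.
Proof.
rewrite /connected_edge /= (inj_eq (addrI _)); congr (_ || _).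
by apply: eq_existsb => k; rewrite -!addrA !(inj_eq (addrI al)).
Qed.

Lemma translate_free al v : translate al v = v -> al = 0.
Proof.
by case: v => x i [] /eqP; rewrite -{2}[x]add0r (inj_eq (addIr _)) => /eqP.
Qed.

Definition base_vertex (i : 'I_n) : vtx := (0, i).

Lemma base_vertex_surj v : exists al i, v = translate al (base_vertex i).
Proof. by case: v => x i; exists x, i; rewrite /translate /= addr0. Qed.

Lemma base_vertex_inj al i j :
  translate al (base_vertex i) = base_vertex j -> i = j.
Proof. by case. Qed.

Lemma connected_edge_fin v : finite_set [set u | connected_edge v u].
Proof.
case: v => x i.
pose nb : seq vtx := [seq (x, j) | j <- enum 'I_n] ++
  ([seq (x + basis_vector k, f k) | k <- enum 'I_d] ++
   [seq (x - basis_vector k, f k) | k <- enum 'I_d]).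
apply: (@sub_finite_set _ _ [set` nb]); last exact: finite_seq.
move=> [y j]; rewrite /= /connected_edge /= /nb !mem_cat.
case/orP => [/andP[/eqP <- _]|/existsP[k /and3P[_ /eqP -> /orP[]/eqP ->]]].
- by rewrite map_f ?mem_enum.
- by rewrite [X in _ || (X || _)]map_f ?mem_enum ?orbT.
- apply/orP; right; apply/orP; right.
  by apply/mapP; exists k; rewrite ?mem_enum // addrK.
Qed.

Definition connected_periodic_graph : periodic_graph d :=
  PeriodicGraph connected_edge_sym connected_edge_irr translate0 translateD
    translate_edge translate_free base_vertex_surj base_vertex_inj
    connected_edge_fin.

End Connected.

Definition isthmus_connected d a m b (A : sgraph a) (B : sgraph b)
    (f : 'I_d -> 'I_m) : periodic_graph d :=
  connected_periodic_graph (isthmus_graph A B)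
    (fun k => isthmus_vertex (f k)).

(* The determinant of the empty matrix is 1. *)
Definition principal_minor (F : comNzRingType) n (M : 'M[F]_n)
    (S : {set 'I_n}) : F :=
  \det (mxsub (fun i : 'I_#|S| => enum_val i) (fun i : 'I_#|S| => enum_val i) M).

Section Generic.
Context {R : realType} {d a m b : nat}.
Context {A : sgraph a} {B : sgraph b} {f : 'I_d -> 'I_m}.
Variables (V : potential R (isthmus_connected A B f)).
Variables (E : edge_weight R (isthmus_connected A B f)).
Local Notation C := (Cplx R).

Definition minor_below (r : 'I_m) (p : 'rV[C]_d * C) : C :=
  principal_minor (floquet V E p.1 - p.2%:M)
    [set i : 'I_(a + m + b) | (i < @isthmus_vertex a m b r)%N]%SET.

Definition minor_above (s : 'I_m) (p : 'rV[C]_d * C) : C :=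
  principal_minor (floquet V E p.1 - p.2%:M)
    [set i : 'I_(a + m + b) | (@isthmus_vertex a m b s < i)%N]%SET.

Definition no_common_root (g h : C -> C) : Prop :=
  forall lam, ~ (g lam = 0 /\ h lam = 0).

Definition isthmus_generic : Prop :=
  nonvanishing E /\
  forall x : 'rV[C]_d, corner x -> forall r s : 'I_m, (r <= s)%N ->
    let P lam := minor_below r (x, lam) in
    let Q lam := minor_above s (x, lam) in
    let D lam := dispersion V E (x, lam) in
    [/\ no_common_root P Q, no_common_root P D & no_common_root Q D].

End Generic.

(* Main.v *)
(* Changing the coordinate z_k alters the single diagonal entry of H(z) at f(k), so
   D moves by the change of E_k (z_k + 1/z_k) times P Q, with P and Q the minors below
   and above f(k). Hence z_k = 1, z_k = -1 or P Q = 0 for every k at a critical point.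
   Let r <= s be the extreme loop vertices of the coordinates other than 1 and -1.
   Either P_r = Q_s = 0, or a kernel vector of H(z) - lambda vanishes from r to s;
   both survive moving these coordinates to 1, against genericity at corner points.
   At a corner point P Q <> 0, and the Jacobian is triangular, with diagonal entries
   2 E_k z_k P Q and dD/dlambda. The latter is nonzero, lambda being a simple eigenvalue:
   two independent eigenvectors would combine to one vanishing at f(k).

   An extremum of a band is a critical point: by Weyl's inequality a band moves
   monotonically with a diagonal entry, strictly so when P Q <> 0. By the implicit
   function theorem the k-th partial derivative of the band is sin(t_k) times a
   nonvanishing function, whence an invertible diagonal Hessian at corner points.

   Genericity follows from the nonvanishing of the edge weights and of resultants of
   characteristic polynomials of submatrices at the corner points. For unit weights a
   potential with this property is built by adding the vertices of A and of B one at a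
   time, then separating the potentials of A, the path and B by Gershgorin's theorem. *)

Require Import Defs.
From HB Require Import structures.
From mathcomp Require Import all_boot all_order all_algebra.
From mathcomp Require Import complex.
From mathcomp Require Import all_classical all_reals all_analysis.
From mathcomp Require Import ring lra.
From mathcomp Require Import zify.
From mathcomp Require Import -(notations) mpoly.

Set Implicit Arguments.
Unset Strict Implicit.
Unset Printing Implicit Defensive.

Import Order.TTheory GRing.Theory Num.Theory numFieldNormedType.Exports.
Local Open Scope classical_set_scope.
Local Open Scope ring_scope.

(** * Principal minors *)

(** Genericity constrains only the [2^d] corner points, whereas a critical point may have any
    nonzero coordinates. Off the torus [H(z) - lambda] is symmetric but not Hermitian, so that
    spectral theory does not apply. Its substitute is the symmetric pairing of a kernel vector of
    the whole matrix with one of the block beyond a path vertex: it yields a kernel vector that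
    vanishes up to that vertex, and the equations along the path spread these zeros. On the torus
    [z_k + 1/z_k = 2 Re z_k], so bands are ranked eigenvalues of real symmetric matrices in which
    only the diagonal depends on the angles. Weyl's inequality then gives the continuity of bands
    besides their monotonicity, and the implicit function theorem only has to differentiate a given
    continuous solution. For unit weights one potential must serve all corner points at once. This
    is possible because loops sit on the path only: the blocks of [A] and [B] are the same at every
    corner point, and the separation of the three potentials is uniform. *)

Section PrincipalMinors.

(** Sylvester's determinant identity: one block matrix is factored into triangular ones in two
    ways. *)
Lemma det_1DmulC (F : comNzRingType) m n (X : 'M[F]_(m, n)) (Y : 'M[F]_(n, m)) :
  \det (1%:M + X *m Y) = \det (1%:M + Y *m X).
Proof.
have <- : \det (block_mx (1%:M : 'M[F]_m) (- X) Y (1%:M : 'M[F]_n)) = \det (1%:M + Y *m X).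
  have -> : block_mx 1%:M (- X) Y 1%:M
    = block_mx 1%:M 0 Y 1%:M *m block_mx 1%:M (- X) 0 (1%:M + Y *m X).
    rewrite mulmx_block ?(mul1mx, mul0mx, mulmx1, mulmx0, addr0) mulmxN.
    by rewrite addrCA addNr addr0.
  by rewrite det_mulmx det_lblock det_ublock !det1 !mul1r.
have -> : block_mx 1%:M (- X) Y 1%:M
    = block_mx (1%:M + X *m Y) (- X) 0 1%:M *m block_mx 1%:M 0 Y 1%:M.
  by rewrite mulmx_block ?(mul1mx, mul0mx, mulmx1, mulmx0, addr0, add0r) mulNmx addrK.
by rewrite det_mulmx det_lblock det_ublock !det1 !mulr1.
Qed.

(** Keeping the size [n], instead of the dependent size [#|S|] of [principal_minor], lets minors on
    different sets be compared and multiplied as matrices of one type. *)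
Definition mask (F : comNzRingType) n (M : 'M[F]_n) (S : {set 'I_n}) : 'M[F]_n :=
  \matrix_(i, j) if (i \in S) && (j \in S) then M i j else (i == j)%:R.

(** With [P] the matrix selecting the coordinates in [S], the mask is [1 + P^T (N - 1) P] and
    [P P^T = 1], so Sylvester's identity reduces its determinant to that of [N]. *)
Lemma det_mask (F : comNzRingType) n (M : 'M[F]_n) (S : {set 'I_n}) :
  \det (mask M S) = principal_minor M S.
Proof.
rewrite /principal_minor; set N := mxsub _ _ M.
pose P : 'M[F]_(#|S|, n) := \matrix_(i, j) (enum_val i == j)%:R.
have PPT : P *m P^T = 1%:M.
  apply/matrixP=> i j; rewrite !mxE (bigD1 (enum_val i)) //= !mxE eqxx mul1r.
  rewrite big1 ?addr0 => [|k /negPf nk]; last by rewrite !mxE eq_sym nk mul0r.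
  by rewrite (inj_eq enum_val_inj) eq_sym.
have PME (A : 'M[F]_(#|S|)) i j : (P^T *m A *m P) i j =
    \sum_k \sum_l (enum_val l == i)%:R * A l k * (enum_val k == j)%:R.
  rewrite !mxE; apply: eq_bigr => k _; rewrite !mxE mulr_suml.
  by apply: eq_bigr => l _; rewrite !mxE.
have -> : mask M S = 1%:M + P^T *m ((N - 1%:M) *m P).
  apply/matrixP=> i j; rewrite mulmxA [in LHS]mxE [in RHS]mxE PME [1%:M _ _]mxE.
  have [jS|jS] /= := boolP (j \in S); last first.
    rewrite andbF big1 ?addr0 // => k _; rewrite big1 // => l _.
    case: (enum_val k =P j) => [ekj|]; last by rewrite mulr0.
    by move: jS; rewrite -ekj enum_valP.
  have [iS|iS] /= := boolP (i \in S); last first.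
    rewrite big1 ?addr0 // => k _; rewrite big1 // => l _.
    case: (enum_val l =P i) => [ekj|]; last by rewrite !mul0r.
    by move: iS; rewrite -ekj enum_valP.
  rewrite (bigD1 (enum_rank_in jS j)) //= [X in _ + (_ + X)]big1 ?addr0; last first.
    move=> k; rewrite -(inj_eq enum_val_inj) (enum_rankK_in jS) // => /negPf nk.
    by rewrite big1 // => l _; rewrite nk mulr0.
  rewrite (bigD1 (enum_rank_in iS i)) //= [X in _ + (_ + X)]big1 ?addr0; last first.
    move=> k; rewrite -(inj_eq enum_val_inj) (enum_rankK_in iS) // => /negPf nk.
    by rewrite nk !mul0r.
  rewrite !mxE !enum_rankK_in // !eqxx mul1r mulr1.
  rewrite -(inj_eq enum_val_inj) !enum_rankK_in //.
  by rewrite addrC subrK.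
by rewrite det_1DmulC -mulmxA PPT mulmx1 addrC subrK.
Qed.

(** Outside [S] the columns of the mask are those of the identity, so a vector that it kills has to
    vanish there. *)
Lemma principal_minor_eq0P (F : fieldType) n (M : 'M[F]_n) (S : {set 'I_n}) :
  reflect (exists v : 'rV[F]_n, [/\ v != 0, forall i, i \notin S -> v 0 i = 0
             & forall j, j \in S -> (v *m M) 0 j = 0])
    (principal_minor M S == 0).
Proof.
rewrite -det_mask.
have colE (v : 'rV[F]_n) j : j \notin S -> (v *m mask M S) 0 j = v 0 j.
  move=> jS; rewrite mxE (bigD1 j) //= big1 => [|i ij]; rewrite mxE (negPf jS) andbF.
    by rewrite eqxx mulr1 addr0.
  by rewrite (negPf ij) mulr0.
have colS (v : 'rV[F]_n) j : (forall i, i \notin S -> v 0 i = 0) -> j \in S ->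
    (v *m mask M S) 0 j = (v *m M) 0 j.
  move=> vS jS; rewrite !mxE; apply: eq_bigr => i _; rewrite mxE jS andbT.
  by case: ifPn => // /vS->; rewrite !mul0r.
apply: (iffP det0P) => [[v v0 vM]|[v [v0 vS vM]]].
  have vS i : i \notin S -> v 0 i = 0 by move=> iS; rewrite -(colE v) // vM mxE.
  by exists v; split=> // j jS; rewrite -colS // vM mxE.
exists v => //; apply/rowP=> j; rewrite [RHS]mxE.
by have [jS|jS] := boolP (j \in S); [rewrite colS // vM|rewrite colE // vS].
Qed.

(** Linearity of the determinant in row [s]; [C] is [M] with that row replaced by a basis vector. A
    change of a single coordinate [z_k] acts on the Floquet matrix by such a rank-one update. *)
Lemma det_add_diag (F : comNzRingType) n (M : 'M[F]_n) (s : 'I_n) (e : F) :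
  \det (M + e *: delta_mx s s) = \det M + e * principal_minor M (~: [set s])%SET.
Proof.
pose C : 'M[F]_n := \matrix_(i, j) if i == s then (j == s)%:R else M i j.
rewrite (@determinant_multilinear _ _ _ M C s 1 e) ?mul1r.
- congr (_ + _ * _); rewrite -det_mask.
  rewrite (expand_det_row C s) (bigD1 s) //= big1 => [|j /negPf js]; last first.
    by rewrite mxE eqxx js mul0r.
  rewrite (expand_det_row _ s) (bigD1 s) //= big1 => [|j /negPf js]; last first.
    by rewrite !mxE !inE eqxx [s == j]eq_sym js mul0r.
  rewrite !mxE !inE !eqxx !mul1r !addr0; congr (_ * \det _).
  apply/matrixP=> i j; rewrite !mxE !inE.
  by rewrite ![lift s _ == s]eq_sym !(negPf (neq_lift _ _)).
- by apply/rowP=> j; rewrite !mxE eqxx /= mul1r.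
- apply/matrixP=> i j; rewrite !mxE.
  by rewrite [lift s _ == s]eq_sym (negPf (neq_lift _ _)) mulr0 addr0.
- apply/matrixP=> i j; rewrite !mxE.
  by rewrite [lift s _ == s]eq_sym (negPf (neq_lift _ _)) mulr0 addr0.
Qed.

Lemma mask_mask (F : comNzRingType) n (M : 'M[F]_n) (S T : {set 'I_n}) :
  mask (mask M S) T = mask M (S :&: T)%SET.
Proof.
apply/matrixP=> i j; rewrite !mxE !inE.
by case: (i \in S); case: (j \in S); case: (i \in T); case: (j \in T).
Qed.

Lemma eq_principal_minor (F : comNzRingType) n (M N : 'M[F]_n) (S : {set 'I_n}) :
  (forall i j, i \in S -> j \in S -> M i j = N i j) ->
  principal_minor M S = principal_minor N S.
Proof.
move=> MN; rewrite -!det_mask; congr (\det _); apply/matrixP=> i j; rewrite !mxE.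
by case: ifP => // /andP[/MN MNi /MNi].
Qed.

Lemma principal_minor_add_diag (F : comNzRingType) n (M : 'M[F]_n) (s : 'I_n)
    (T : {set 'I_n}) (e : F) : s \notin T ->
  principal_minor (M + e *: delta_mx s s) (s |: T)%SET =
  principal_minor M (s |: T)%SET + e * principal_minor M T.
Proof.
move=> sT; rewrite -!det_mask.
have -> : mask (M + e *: delta_mx s s) (s |: T)%SET =
    mask M (s |: T)%SET + e *: delta_mx s s.
  apply/matrixP=> i j; rewrite !mxE !inE.
  case: (eqVneq i s) => [->|/= nis]; last by case: ifP; rewrite mulr0 addr0.
  case: (eqVneq j s) => [->//|/= njs].
  by case: ifP; rewrite mulr0 addr0.
rewrite det_add_diag -det_mask mask_mask; congr (_ + _ * \det (mask _ _)).
by apply/setP=> i; rewrite !inE; case: eqVneq => [->|]; rewrite ?(negPf sT) ?andbT.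
Qed.

(** The masks on [S] and on [T] multiply to the mask on the union, each being the identity on the
    block of the other. *)
Lemma principal_minorU (F : comNzRingType) n (M : 'M[F]_n) (S T : {set 'I_n}) :
  (forall i, i \in S -> i \notin T) ->
  (forall i j, i \in S -> j \in T -> M i j = 0 /\ M j i = 0) ->
  principal_minor M (S :|: T)%SET = principal_minor M S * principal_minor M T.
Proof.
move=> dST MST; rewrite -!det_mask -det_mulmx; congr (\det _).
apply/matrixP=> i j; rewrite !mxE !inE.
have dS k : k \in S -> k \in T = false by move=> /dST/negPf.
have [iS|iS] := boolP (i \in S).
  rewrite dS //=; under eq_bigr => k _.
    rewrite mxE iS /= mxE; over.
  rewrite /=; case: (boolP (j \in S)) => jS /=.
    rewrite (bigD1 j) //= jS (dS j jS) andbF eqxx mulr1 big1 ?addr0 // => k kj.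
    by rewrite andbF (negPf kj) mulr0.
  have [jT|jT] /= := boolP (j \in T).
    rewrite (MST i j iS jT).1 big1 // => k _; rewrite andbT.
    case: (boolP (k \in S)) => kS; last first.
      case: eqP => [ik|_]; last by rewrite mul0r.
      by move: iS; rewrite ik (negPf kS).
    rewrite (dS k kS); case: eqP => [kj|_]; last by rewrite mulr0.
    by move: jS; rewrite -kj kS.
  rewrite (bigD1 j) //= (negPf jS) (negPf jT) andbF eqxx mulr1 big1 ?addr0 // => k kj.
  by rewrite andbF (negPf kj) mulr0.
rewrite /= (bigD1 i) //= big1 ?addr0 => [|k ki]; last first.
  by rewrite mxE (negPf iS) eq_sym (negPf ki) mul0r.
rewrite mxE (negPf iS) /= eqxx mul1r mxE.
case: (boolP (i \in T)) => //= iT.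
case: (boolP (j \in T)) => jT; rewrite ?orbT ?orbF //.
have [jS|//] := boolP (j \in S); rewrite (MST j i jS iT).2.
by case: eqP => // ij; move: iS; rewrite ij jS.
Qed.

Lemma map_principal_minor (F K : comNzRingType) (h : {rmorphism F -> K}) n
    (M : 'M[F]_n) (S : {set 'I_n}) :
  principal_minor (map_mx h M) S = h (principal_minor M S).
Proof. by rewrite /principal_minor -det_map_mx; congr (\det _); apply/matrixP=> i j; rewrite !mxE. Qed.

Lemma principal_minor_char_poly (F : comNzRingType) n (M : 'M[F]_n) (S : {set 'I_n}) :
  principal_minor (char_poly_mx M) S =
  char_poly (mxsub (fun i : 'I_#|S| => enum_val i) (fun i : 'I_#|S| => enum_val i) M).
Proof.
by rewrite /char_poly; congr (\det _); apply/matrixP=> i j; rewrite !mxE (inj_eq enum_val_inj).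
Qed.

End PrincipalMinors.

(** * Kernel vectors of a symmetric matrix along a path of cut vertices *)

Section KernelOfChain.
Context {F : fieldType} {n : nat} {M : 'M[F]_n}.
Variables (pos : 'I_n -> int) (path : pred 'I_n).
Hypothesis M_sym : forall i j, M i j = M j i.
Hypothesis pos_inj : injective pos.
Hypothesis M_cut : forall r i j, path r -> pos i < pos r -> pos r < pos j -> M i j = 0.
Hypothesis M_far : forall r j, path r -> pos r + 1 < pos j -> M r j = 0.
Hypothesis M_next : forall r j, path r -> pos j = pos r + 1 -> M r j != 0.

Let below r := [set i | pos i < pos r]%SET.
Let above r := [set i | pos r < pos i]%SET.

(** Let [v] span part of the kernel of [M] and [w] that of the block above [r]. Since [w M] is
    supported at [r], symmetry gives [v_r (w M)_r = 0]. If the second factor vanishes, [w] is the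
    vector sought. If [v_r = 0], the part of [v] below [r] is a kernel vector of the block below,
    hence zero as its minor is not. *)
Lemma kernel_above r : path r -> \det M = 0 -> principal_minor M (below r) != 0 ->
  principal_minor M (above r) = 0 ->
  exists u : 'rV[F]_n, [/\ u != 0, u *m M = 0 & forall i, pos i <= pos r -> u 0 i = 0].
Proof.
move=> pr /eqP/det0P[v v0 vM] Pr /eqP/principal_minor_eq0P[w [w0 wS wM]].
have wMj j : j != r -> (w *m M) 0 j = 0.
  move=> jr; have [rj|] := ltP (pos r) (pos j); first by apply: wM; rewrite inE.
  rewrite le_eqVlt (inj_eq pos_inj) (negPf jr) /= => jr'.
  rewrite mxE big1 // => i _; have [ri|ir] := boolP (i \in above r); last by rewrite wS ?mul0r.
  by rewrite M_sym (M_cut pr jr') ?mulr0 //; rewrite inE in ri.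
have : v 0 r * (w *m M) 0 r = 0.
  have <- : \sum_j v 0 j * (w *m M) 0 j = v 0 r * (w *m M) 0 r.
    by rewrite (bigD1 r) //= big1 ?addr0 // => j /wMj->; rewrite mulr0.
  under eq_bigr do rewrite mxE mulr_sumr.
  rewrite exchange_big big1 //= => i _.
  under eq_bigr do rewrite mulrCA M_sym.
  rewrite -mulr_sumr; have /rowP/(_ i) := vM; rewrite !mxE => ->.
  by rewrite mulr0.
move/eqP; rewrite mulf_eq0 => /orP[/eqP vr|/eqP wr]; last first.
  exists w; split=> //; first by apply/rowP=> j; rewrite [RHS]mxE; case: (eqVneq j r) => [->|/wMj].
  by move=> i ir; apply: wS; rewrite inE -leNgt.
exists v; split=> //.
suff vb i : pos i < pos r -> v 0 i = 0.
  by move=> i; rewrite le_eqVlt (inj_eq pos_inj) => /orP[/eqP->|/vb].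
move=> ir; apply/eqP/negPn/negP=> vi; case/negP: Pr; apply/principal_minor_eq0P.
exists (\row_j if j \in below r then v 0 j else 0); split.
- by apply: contra vi => /eqP/rowP/(_ i); rewrite !mxE inE ir => ->.
- by move=> j /negPf jb; rewrite mxE jb.
- move=> j; rewrite inE => jr.
  transitivity ((v *m M) 0 j); last by rewrite vM mxE.
  rewrite [LHS]mxE [RHS]mxE; apply: eq_bigr => k _.
  rewrite mxE inE; case: (ltgtP (pos k) (pos r)) => [//|rk|/pos_inj->]; last by rewrite vr.
  by rewrite M_sym (M_cut pr jr rk) !mulr0.
Qed.

(** The equation at [r] involves no index beyond the next one, which enters with a nonzero
    coefficient. *)
Lemma kernel_next (u : 'rV[F]_n) r : path r -> u *m M = 0 ->
  (forall i, pos i <= pos r -> u 0 i = 0) -> forall i, pos i <= pos r + 1 -> u 0 i = 0.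
Proof.
move=> pr uM ur i; rewrite le_eqVlt => /orP[/eqP ir|]; last by rewrite ltzD1 => /ur.
have /rowP/(_ r) := uM; rewrite !mxE (bigD1 i) //= big1 ?addr0 => [|j ji].
  by move/eqP; rewrite mulf_eq0 M_sym (negPf (M_next pr ir)) orbF => /eqP.
have [jr|] := leP (pos j) (pos r + 1).
  rewrite ur ?mul0r // -ltzD1 lt_neqAle jr andbT -ir (inj_eq pos_inj) //.
by move/(M_far pr) => jr; rewrite M_sym jr mulr0.
Qed.

(** The zeros reach one step past [s]. When [s] ends the path, this is the vertex of [A] or [B]
    attached to it, which matters for genericity. *)
Lemma kernel_propagate (u : 'rV[F]_n) r s : u *m M = 0 ->
  (forall t, pos r <= t -> t <= pos s -> exists2 q, path q & pos q = t) ->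
  pos r <= pos s ->
  (forall i, pos i <= pos r -> u 0 i = 0) -> forall i, pos i <= pos s + 1 -> u 0 i = 0.
Proof.
move=> uM prs rs ur.
have [k ek] : exists k : nat, pos s = pos r + k%:Z.
  by exists `|pos s - pos r|%N; lia.
suff H (l : nat) : (l <= k)%N -> forall i, pos i <= pos r + l%:Z + 1 -> u 0 i = 0.
  by rewrite ek; exact: H.
elim: l => [|l IH] lk.
  have [q pq eq] := prs (pos r) (lexx _) rs.
  by rewrite addr0 -eq; apply: (kernel_next pq uM) => i; rewrite eq; exact: ur.
have [||q pq eq] := prs (pos r + l.+1%:Z); first by rewrite lerDl.
  by rewrite ek lerD2l.
rewrite -eq; apply: (kernel_next pq uM) => i; rewrite eq => ir.
by apply: IH; [exact: ltnW|lia].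
Qed.

Lemma kernel_chain r s : path r -> pos r <= pos s ->
  (forall t, pos r <= t -> t <= pos s -> exists2 q, path q & pos q = t) ->
  \det M = 0 -> principal_minor M (below r) != 0 -> principal_minor M (above r) = 0 ->
  exists u : 'rV[F]_n, [/\ u != 0, u *m M = 0 & forall i, pos i <= pos s + 1 -> u 0 i = 0].
Proof.
move=> pr rs prs D0 Pr Qr; have [u [u0 uM ur]] := kernel_above pr D0 Pr Qr.
by exists u; split=> //; exact: kernel_propagate uM prs rs ur.
Qed.

End KernelOfChain.

(** * The Floquet matrix in coordinates *)

Definition toC (R : realType) : {rmorphism R -> Cplx R} := real_complex R.
Arguments toC : simpl never.

Section IsthmusAdjacency.
Context {a m b : nat} (A : sgraph a) (B : sgraph b).
Local Notation n := (a + m + b)%N.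

Definition path_index (i : 'I_n) : bool := (a <= i < a + m)%N.

Lemma isthmus_adj_path (i j : 'I_n) : path_index i ->
  isthmus_adj A B i j = (i.+1 == j :> nat) || (j.+1 == i :> nat).
Proof.
move=> /andP[ai im]; rewrite /isthmus_adj.
case: (splitP i) => [i' ei|x ei]; last by lia.
case: (splitP i') => [x ex|x ex]; first by have := ltn_ord x; lia.
by case: (splitP j) => [j' ej|//]; case: (splitP j').
Qed.

Lemma isthmus_adj_cut (r i j : 'I_n) : path_index r -> (i < r)%N -> (r < j)%N ->
  isthmus_adj A B i j = false.
Proof.
move=> /andP[ar rm] ir rj; rewrite /isthmus_adj.
case: (splitP i) => [i' ei|x ei]; case: (splitP j) => [j' ej|y ej]; try lia.
by case: (splitP i') => [x ex|x ex]; case: (splitP j') => [y ey|y ey]; have := ltn_ord y; lia.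
Qed.

Lemma isthmus_adj_A (i j : 'I_n) (x y : 'I_a) : i = x :> nat -> j = y :> nat ->
  isthmus_adj A B i j = A x y.
Proof.
move=> ix jy; rewrite /isthmus_adj.
case: (splitP i) => [i' ei|z ei]; last by have := ltn_ord x; lia.
case: (splitP j) => [j' ej|z ej]; last by have := ltn_ord y; lia.
case: (splitP i') => [x' ex|z ez]; last by have := ltn_ord x; lia.
case: (splitP j') => [y' ey|z ez]; last by have := ltn_ord y; lia.
by congr (A _ _); apply/val_inj => /=; rewrite -?ex -?ey -?ei -?ej.
Qed.

Lemma isthmus_adj_B (i j : 'I_n) (x y : 'I_b) :
  i = (a + m + x)%N :> nat -> j = (a + m + y)%N :> nat -> isthmus_adj A B i j = B x y.
Proof.
move=> ix jy; rewrite /isthmus_adj.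
case: (splitP i) => [i' ei|x' ei]; first by have := ltn_ord i'; lia.
case: (splitP j) => [j' ej|y' ej]; first by have := ltn_ord j'; lia.
by congr (B _ _); apply/val_inj => /=; lia.
Qed.

Lemma path_index_isthmus (r : 'I_m) : path_index (@isthmus_vertex a m b r).
Proof. by rewrite /path_index /= leq_addr ltn_add2l ltn_ord. Qed.

End IsthmusAdjacency.

Section FloquetMatrix.
Context {R : realType} {d a m b : nat} {A : sgraph a} {B : sgraph b} {f : 'I_d -> 'I_m}.
Variables (V : potential R (isthmus_connected A B f)).
Variables (E : edge_weight R (isthmus_connected A B f)).
Local Notation C := (Cplx R).
Local Notation n := (a + m + b)%N.

Definition loop_vertex (k : 'I_d) : 'I_n := isthmus_vertex (f k).

Definition edge_coef (i j : 'I_n) : R :=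
  if isthmus_adj A B i j then E (0, i) (0, j) else 0.

Definition loop_coef (k : 'I_d) : R :=
  E (0, loop_vertex k) (basis_vector k, loop_vertex k).

Definition loops (z : 'rV[C]_d) (i : 'I_n) : C :=
  \sum_(k | loop_vertex k == i) toC R (loop_coef k) * (z 0 k + (z 0 k)^-1).

Lemma edge_coef_sym i j : edge_coef i j = edge_coef j i.
Proof. by rewrite /edge_coef isthmus_adj_sym wt_sym. Qed.

Lemma basis_vector_inj : injective (@basis_vector d).
Proof.
move=> k l /matrixP/(_ 0 k); rewrite !mxE !eqxx /=.
by case: (eqVneq k l).
Qed.

Lemma basis_vectorDN k l : basis_vector k != - basis_vector l :> 'rV[int]_d.
Proof.
apply/eqP => /matrixP/(_ 0 k); rewrite !mxE !eqxx /=.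
by case: (k == l).
Qed.

Lemma monomial_basis (z : 'rV[C]_d) k : monomial z (basis_vector k) = z 0 k.
Proof.
rewrite /monomial (bigD1 k) //= big1 => [|l lk]; rewrite mxE !eqxx /=.
  by rewrite mulr1.
by rewrite (negPf lk).
Qed.

Lemma monomial_basisN (z : 'rV[C]_d) k : monomial z (- basis_vector k) = (z 0 k)^-1.
Proof.
rewrite /monomial (bigD1 k) //= big1 => [|l lk]; rewrite !mxE !eqxx /=.
  by rewrite mulr1.
by rewrite (negPf lk) oppr0.
Qed.

Lemma monomial0 (z : 'rV[C]_d) : monomial z 0 = 1.
Proof. by rewrite /monomial big1 // => k _; rewrite mxE. Qed.

(** Off the diagonal only the translation 0 contributes. On the diagonal the translations are the
    vectors [basis_vector k] and their opposites for the loops at [i]; they are pairwise distinct,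
    and each pair contributes [z_k + 1/z_k]. *)
Lemma floquetE (z : 'rV[C]_d) (i j : 'I_n) :
  floquet V E z i j =
  toC R (edge_coef i j) + (toC R (V (0, i)) + loops z i) *+ (i == j).
Proof.
rewrite /floquet [LHS]mxE /=.
have [<-{j}|ij] := eqVneq i j; last first.
  rewrite !mulr0n addr0 add0r /edge_coef.
  have [Gij|nGij] := boolP (isthmus_adj A B i j).
    rewrite (_ : [set al | _] = [set 0]).
      by rewrite fsbig_set1 monomial0 mulr1 /translate /= add0r.
    apply/seteqP; split=> al /=.
      case/orP => [/andP[/eqP + _]|]; first by rewrite /= addr0.
      by case/existsP => k /=; case/and3P => /eqP ik /eqP jk _; rewrite ik jk eqxx in ij.
    by move=> ->; rewrite /connected_edge /= addr0 eqxx Gij.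
  rewrite (_ : [set al | _] = set0) ?fsbig_set0 ?rmorph0 //.
  apply/seteqP; split=> al //=; rewrite /connected_edge /= (negPf nGij) andbF /=.
  by case/existsP => k /=; case/and3P => /eqP ik /eqP jk _; rewrite ik jk eqxx in ij.
rewrite !mulr1n /edge_coef isthmus_adj_irr rmorph0 add0r; congr (_ + _).
pose s := [seq k <- enum 'I_d | loop_vertex k == i].
pose r := [seq basis_vector k | k <- s] ++ [seq - basis_vector k | k <- s].
have us : uniq s by rewrite filter_uniq ?enum_uniq.
have ur : uniq r.
  rewrite cat_uniq !map_inj_uniq ?us /= ?andbT; last exact: basis_vector_inj.
    apply/hasPn => _ /mapP[k _ ->]; apply/mapP => -[l _ /eqP].
    by rewrite eq_sym (negPf (basis_vectorDN _ _)).
  by move=> k l /oppr_inj/basis_vector_inj.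
rewrite (_ : [set al | _] = [set` r]); last first.
  apply/seteqP; split=> al /=; rewrite /connected_edge /= isthmus_adj_irr andbF /=.
    case/existsP => k /=; rewrite addr0 add0r; case/and3P => /eqP ik _ /orP[]/eqP al_k; rewrite mem_cat.
      by rewrite al_k map_f // mem_filter mem_enum ik eqxx.
    apply/orP; right; apply/mapP; exists k; first by rewrite mem_filter mem_enum ik eqxx.
    by apply/eqP; rewrite -addr_eq0 -al_k.
  rewrite mem_cat => /orP[]/mapP[k]; rewrite mem_filter => /andP[/eqP ik _] ->.
    by apply/existsP; exists k; rewrite -ik /= addr0 add0r !eqxx.
  by apply/existsP; exists k; rewrite -ik /= addr0 addNr !eqxx orbT.
rewrite -fsbig_seq // big_cat !big_map /= !big_filter !big_enum_cond /= -big_split.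
apply: eq_bigr => k /eqP ik; rewrite monomial_basis monomial_basisN /translate /= !addr0.
rewrite mulrDr /loop_coef ik; congr (_ + toC R _ * _).
(* The edge in direction [- basis_vector k] is a translate of the one in direction [basis_vector k]
   with its ends exchanged. *)
have := wt_per E (- basis_vector k) (0, i) (basis_vector k, i).
rewrite /= /translate /= addr0 addNr => <-.
exact: wt_sym.
Qed.

End FloquetMatrix.

(** * Floquet matrices of isthmus-connected graphs *)

Section ChainMatrices.
Context {F : fieldType} {a m b : nat}.
Local Notation n := (a + m + b)%N.
Implicit Types (M : 'M[F]_n) (r s : 'I_n).

(** What the kernel arguments retain of the isthmus structure: the entries within [A] and within
    [B], and the diagonal, stay arbitrary up to symmetry. *)
Definition chain_matrix M : Prop :=
  [/\ forall i j, M i j = M j i,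
      forall r i j : 'I_n, path_index r -> (i < r)%N -> (r < j)%N -> M i j = 0,
      forall r j : 'I_n, path_index r -> (r.+1 < j)%N || (j.+1 < r)%N -> M r j = 0 &
      forall r j : 'I_n, path_index r -> (j == r.+1 :> nat) || (r == j.+1 :> nat) -> M r j != 0].

Lemma chain_kernel_above M r s : chain_matrix M -> path_index r -> path_index s -> (r <= s)%N ->
  \det M = 0 -> principal_minor M [set i : 'I_n | (i < r)%N]%SET != 0 ->
  principal_minor M [set i : 'I_n | (r < i)%N]%SET = 0 ->
  exists u : 'rV[F]_n, [/\ u != 0, u *m M = 0 & forall i : 'I_n, (i <= s.+1)%N -> u 0 i = 0].
Proof.
move=> [Ms Mc Mf Mn] pr ps rs D0 Pr Qr.
have [||||||||||u [u0 uM us]] := @kernel_chain F n M (fun i => i%:Z) (@path_index a m b) Ms _ _ _ _ r s.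
- by move=> i j /eqP; rewrite eqz_nat => /eqP/val_inj.
- by move=> t i j pt; rewrite !ltz_nat; exact: Mc.
- by move=> t j pt tj; apply: Mf => //; apply/orP; left; lia.
- by move=> t j pt tj; apply: Mn => //; apply/orP; left; lia.
- exact: pr.
- by rewrite lez_nat.
- move=> t rt ts; have tn : (`|t| < n)%N by have := ltn_ord s; lia.
  by exists (Ordinal tn); [move: pr ps; rewrite /path_index /=; lia|rewrite /=; lia].
- exact: D0.
- by rewrite (_ : [set i | _]%SET = [set i : 'I_n | (i < r)%N]%SET) //; apply/setP=> i; rewrite !inE.
- by rewrite (_ : [set i | _]%SET = [set i : 'I_n | (r < i)%N]%SET) //; apply/setP=> i; rewrite !inE.
by exists u; split=> // i ir; apply: us; lia.
Qed.

(** The mirror image of [chain_kernel_above], obtained from the positions [-i]; this is why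
    positions are integers in [kernel_chain]. *)
Lemma chain_kernel_below M r s : chain_matrix M -> path_index r -> path_index s -> (s <= r)%N ->
  \det M = 0 -> principal_minor M [set i : 'I_n | (r < i)%N]%SET != 0 ->
  principal_minor M [set i : 'I_n | (i < r)%N]%SET = 0 ->
  exists u : 'rV[F]_n, [/\ u != 0, u *m M = 0 & forall i : 'I_n, (s <= i.+1)%N -> u 0 i = 0].
Proof.
move=> [Ms Mc Mf Mn] pr ps rs D0 Pr Qr.
have [||||||||||u [u0 uM us]] :=
  @kernel_chain F n M (fun i => - i%:Z) (@path_index a m b) Ms _ _ _ _ r s.
- by move=> i j /oppr_inj/eqP; rewrite eqz_nat => /eqP/val_inj.
- by move=> t i j pt ti tj; rewrite Ms (Mc t) //; lia.
- by move=> t j pt tj; apply: Mf => //; apply/orP; right; lia.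
- by move=> t j pt tj; apply: Mn => //; apply/orP; right; lia.
- exact: pr.
- by rewrite lerN2 lez_nat.
- move=> t rt ts; have tn : (`|t| < n)%N by have := ltn_ord r; lia.
  by exists (Ordinal tn); [move: pr ps; rewrite /path_index /=; lia|rewrite /=; lia].
- exact: D0.
- rewrite (_ : [set i | _]%SET = [set i : 'I_n | (r < i)%N]%SET) //.
  by apply/setP=> i; rewrite !inE ltrN2 ltz_nat.
- rewrite (_ : [set i | _]%SET = [set i : 'I_n | (i < r)%N]%SET) //.
  by apply/setP=> i; rewrite !inE ltrN2 ltz_nat.
by exists u; split=> // i ir; apply: us; lia.
Qed.

Lemma chain_minor_split M r : chain_matrix M -> path_index r ->
  principal_minor M (~: [set r])%SET =
  principal_minor M [set i : 'I_n | (i < r)%N]%SET * principal_minor M [set i : 'I_n | (r < i)%N]%SET.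
Proof.
move=> [Ms Mc _ _] pr; rewrite -principal_minorU.
- congr principal_minor; apply/setP=> i; rewrite !inE -val_eqE /=.
  by case: ltngtP.
- by move=> i; rewrite !inE => ir; rewrite -leqNgt ltnW.
- by move=> i j; rewrite !inE => ir rj; rewrite (Ms j) (Mc r).
Qed.

End ChainMatrices.

(* Locked: unification must not unfold Floquet matrices. *)
HB.lock Definition bloch (R : realType) (d a m b : nat) (A : sgraph a) (B : sgraph b)
    (f : 'I_d -> 'I_m) (V : potential R (isthmus_connected A B f))
    (E : edge_weight R (isthmus_connected A B f)) (p : 'rV[Cplx R]_d * Cplx R) :
    'M[Cplx R]_(a + m + b) :=
  floquet V E p.1 - p.2%:M.

Section BlochMatrix.
Context {R : realType} {d a m b : nat} {A : sgraph a} {B : sgraph b} {f : 'I_d -> 'I_m}.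
Variables (V : potential R (isthmus_connected A B f)).
Variables (E : edge_weight R (isthmus_connected A B f)).
Local Notation C := (Cplx R).
Local Notation n := (a + m + b)%N.
Local Notation loop_vertex k := (@loop_vertex d a m b f k).
Local Notation bloch := (bloch V E).

Lemma dispersionE p : dispersion V E p = \det (bloch p).
Proof. by rewrite bloch.unlock. Qed.

Lemma minor_belowE r p : minor_below V E r p =
  principal_minor (bloch p) [set i : 'I_n | (i < @isthmus_vertex a m b r)%N]%SET.
Proof. by rewrite bloch.unlock. Qed.

Lemma minor_aboveE r p : minor_above V E r p =
  principal_minor (bloch p) [set i : 'I_n | (@isthmus_vertex a m b r < i)%N]%SET.
Proof. by rewrite bloch.unlock. Qed.

Lemma blochE p i j : bloch p i j =
  toC R (edge_coef E i j) + (toC R (V (0, i)) + loops E p.1 i - p.2) *+ (i == j).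
Proof.
rewrite bloch.unlock [LHS]mxE floquetE !mxE.
by case: (i == j); rewrite ?mulr1n ?mulr0n ?subr0 ?addr0 ?addrA.
Qed.

Lemma loop_vertex_path k : path_index (loop_vertex k).
Proof. exact: path_index_isthmus. Qed.

Lemma edge_coef_next (r j : 'I_n) : nonvanishing E -> path_index r ->
  (j == r.+1 :> nat) || (r == j.+1 :> nat) -> edge_coef E r j != 0.
Proof.
move=> En pr rj; have rjG : isthmus_adj A B r j.
  by rewrite isthmus_adj_path // eq_sym orbC eq_sym orbC.
rewrite /edge_coef rjG; apply: En.
by rewrite /= /connected_edge /= eqxx rjG.
Qed.

Lemma loop_coef_neq0 k : nonvanishing E -> loop_coef E k != 0.
Proof.
move=> En; apply: En; rewrite /= /connected_edge /=; apply/orP; right.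
by apply/existsP; exists k; rewrite !eqxx add0r eqxx.
Qed.

Lemma bloch_chain p : nonvanishing E -> chain_matrix (bloch p).
Proof.
move=> En; split=> [i j|r i j pr ir rj|r j pr rj|r j pr rj].
- by rewrite !blochE edge_coef_sym eq_sym; case: eqP => // ->.
- rewrite blochE /edge_coef (isthmus_adj_cut _ _ pr ir rj) rmorph0 add0r.
  by rewrite -val_eqE /= ltn_eqF // (ltn_trans ir).
- rewrite blochE /edge_coef isthmus_adj_path //.
  have [/negPf-> /negPf-> /negPf->] :
      [/\ r.+1 != j :> nat, j.+1 != r :> nat & r != j].
    by rewrite -val_eqE /=; split; lia.
  by rewrite rmorph0 addr0.
- rewrite blochE (_ : (r == j) = false) ?addr0.
    by rewrite fmorph_eq0 edge_coef_next.
  by apply/eqP => ?; subst; lia.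
Qed.

Lemma eq_loops (x z : 'rV[C]_d) i :
  (forall k, loop_vertex k = i -> x 0 k = z 0 k) -> loops E x i = loops E z i.
Proof. by move=> xz; apply: eq_bigr => k /eqP ki; rewrite xz. Qed.

Lemma eq_bloch (x z : 'rV[C]_d) lam i j :
  (forall k, loop_vertex k = i -> x 0 k = z 0 k) -> bloch (x, lam) i j = bloch (z, lam) i j.
Proof. by move=> xz; rewrite !blochE (eq_loops xz). Qed.

Lemma bloch_move k (x z : 'rV[C]_d) lam : (forall l, l != k -> x 0 l = z 0 l) ->
  bloch (x, lam) = bloch (z, lam) +
  (toC R (loop_coef E k) * (x 0 k + (x 0 k)^-1 - (z 0 k + (z 0 k)^-1))) *:
    delta_mx (loop_vertex k) (loop_vertex k).
Proof.
move=> xz; apply/matrixP=> i j; rewrite [RHS]mxE [X in _ + X]mxE [X in _ + _ * X]mxE !blochE /=.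
case: (eqVneq i j) => [<-|ij]; last first.
  have -> : (i == loop_vertex k) && (j == loop_vertex k) = false.
    by apply/negP => /andP[/eqP ik /eqP jk]; rewrite ik jk eqxx in ij.
  by rewrite !mulr0n mulr0 !addr0.
rewrite !mulr1n andbb [loop_vertex k]lock; case: (eqVneq i); rewrite -lock => ik; last first.
  rewrite mulr0 addr0 (@eq_loops x z) // => l li.
  by apply: xz; apply: contra_neq ik => <-.
rewrite mulr1 /loops !(bigD1 k (P := fun k => _ == i)) ?ik //=.
rewrite (eq_bigr (fun l => toC R (loop_coef E l) * (z 0 l + (z 0 l)^-1))).
  by ring.
by move=> l /andP[_ /xz->].
Qed.

Definition cominor k p : C := principal_minor (bloch p) (~: [set loop_vertex k])%SET.

Lemma cominorE k p : nonvanishing E -> cominor k p = minor_below V E (f k) p * minor_above V E (f k) p.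
Proof.
move=> En; rewrite /cominor (chain_minor_split (bloch_chain p En) (loop_vertex_path k)).
by rewrite minor_belowE minor_aboveE.
Qed.

Lemma dispersion_move k (x z : 'rV[C]_d) lam : (forall l, l != k -> x 0 l = z 0 l) ->
  dispersion V E (x, lam) = dispersion V E (z, lam) +
  toC R (loop_coef E k) * (x 0 k + (x 0 k)^-1 - (z 0 k + (z 0 k)^-1)) * cominor k (z, lam).
Proof. by move=> xz; rewrite !dispersionE (bloch_move _ xz) det_add_diag. Qed.

Lemma eq_bloch_minor (S : {set 'I_n}) (x z : 'rV[C]_d) lam :
  (forall k, loop_vertex k \in S -> x 0 k = z 0 k) ->
  principal_minor (bloch (x, lam)) S = principal_minor (bloch (z, lam)) S.
Proof.
move=> xz; apply: eq_principal_minor => i j iS jS; by apply: eq_bloch => k ki; apply: xz; rewrite ki.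
Qed.

Lemma cominor_move k (x z : 'rV[C]_d) lam : (forall l, l != k -> x 0 l = z 0 l) ->
  cominor k (x, lam) = cominor k (z, lam).
Proof.
move=> xz; apply: eq_bloch_minor => l; rewrite !inE => lk; apply: xz.
by apply: contra lk => /eqP->.
Qed.

End BlochMatrix.

(** * Stationary points of the dispersion polynomial *)

Section Stationary.
Context {R : realType} {d a m b : nat} {A : sgraph a} {B : sgraph b} {f : 'I_d -> 'I_m}.
Variables (V : potential R (isthmus_connected A B f)).
Variables (E : edge_weight R (isthmus_connected A B f)).
Hypothesis VE_generic : isthmus_generic V E.
Local Notation C := (Cplx R).
Local Notation n := (a + m + b)%N.
Local Notation loop_vertex k := (@loop_vertex d a m b f k).

(* Moving the non-corner coordinates only changes the diagonal of the Floquet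
   matrix between the extreme loop vertices [r] and [s] among them; a kernel
   vector vanishing there survives the move to a corner point. *)
Lemma stationary_corner (z : 'rV[C]_d) lam : dispersion V E (z, lam) = 0 ->
  (forall k, (z 0 k = 1 \/ z 0 k = -1) \/ cominor V E k (z, lam) = 0) -> corner z.
Proof.
have [En gen] := VE_generic.
move=> D0 st k; have [//|zk] := pselect (z 0 k = 1 \/ z 0 k = -1); exfalso.
pose K := [pred l | (z 0 l != 1) && (z 0 l != -1)].
have KP l : l \in K -> minor_below V E (f l) (z, lam) * minor_above V E (f l) (z, lam) = 0.
  rewrite inE => /andP[/eqP l1 /eqP l2]; rewrite -cominorE //.
  by case: (st l) => // -[].
have Kk : K k by rewrite /K /=; apply/andP; split; apply/eqP => e; apply: zk; [left|right].
case: (@arg_minnP _ k K (fun l => f l : nat) Kk) => k0 Kk0 min0.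
case: (@arg_maxnP _ k K (fun l => f l : nat) Kk) => k1 Kk1 max1.
have rs : (f k0 <= f k1)%N by exact: max1.
pose x : 'rV[C]_d := \row_l if K l then 1 else z 0 l.
have xz l : ~~ K l -> x 0 l = z 0 l by move=> /negPf Kl; rewrite mxE Kl.
have cx : corner x.
  move=> l; rewrite mxE /K /=; case: (eqVneq (z 0 l) 1) => [->|l1] /=; first by left.
  by case: (eqVneq (z 0 l) (-1)) => [->|l2] /=; [right|left].
have [PQ PD QD] := gen x cx (f k0) (f k1) rs.
(* Loops strictly below the lowest moved vertex, and strictly above the highest, belong to unmoved
   coordinates, so these two minors do not change. *)
have Px : minor_below V E (f k0) (x, lam) = minor_below V E (f k0) (z, lam).
  rewrite !minor_belowE; apply: eq_bloch_minor => l; rewrite inE /= ltn_add2l => lk.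
  by apply: xz; apply/negP => /min0; rewrite leqNgt lk.
have Qx : minor_above V E (f k1) (x, lam) = minor_above V E (f k1) (z, lam).
  rewrite !minor_aboveE; apply: eq_bloch_minor => l; rewrite inE /= ltn_add2l => lk.
  by apply: xz; apply/negP => /max1; rewrite /= leqNgt lk.
have ker_x (u : 'rV[C]_n) : u *m bloch V E (z, lam) = 0 ->
    (forall i : 'I_n, (loop_vertex k0 <= i <= loop_vertex k1)%N -> u 0 i = 0) ->
    u *m bloch V E (x, lam) = 0.
  move=> uM u0; rewrite -[RHS]uM; apply/rowP=> j; rewrite [LHS]mxE [RHS]mxE; apply: eq_bigr => i _.
  have [iK|iK] := boolP (loop_vertex k0 <= i <= loop_vertex k1)%N; first by rewrite (u0 _ iK) !mul0r.
  congr (_ * _); apply: eq_bloch => l li.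
  apply: xz; apply: contra iK => Kl; rewrite -li /= !leq_add2l.
  by apply/andP; split; [exact: min0|exact: max1].
have := loop_vertex_path (d := d) (a := a) (b := b) (f := f) k0.
have := loop_vertex_path (d := d) (a := a) (b := b) (f := f) k1.
move=> p1 p0; have lv01 : (loop_vertex k0 <= loop_vertex k1)%N by rewrite /= leq_add2l.
rewrite dispersionE in D0; have [P0|P0] := eqVneq (minor_below V E (f k0) (z, lam)) 0; last first.
  have Q0 : minor_above V E (f k0) (z, lam) = 0.
    by have /eqP := KP k0 Kk0; rewrite mulf_eq0 (negPf P0) => /eqP.
  rewrite !minor_belowE !minor_aboveE in P0 Q0.
  have [u [u0 uM us]] := chain_kernel_above (bloch_chain V (z, lam) En) p0 p1 lv01 D0 P0 Q0.
  have uMx : u *m bloch V E (x, lam) = 0.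
    by apply: (ker_x u uM) => i /andP[_ ik]; exact: us (leqW ik).
  (* As [u] is supported above [f k1], it is a kernel vector of the block defining [Q] as well as of
     the whole matrix. *)
  apply: (QD lam); split; apply/eqP.
    rewrite minor_aboveE; apply/principal_minor_eq0P; exists u; split=> [|i|j _]; [exact: u0| |by rewrite uMx mxE].
    by rewrite inE -leqNgt => ik; exact: us (leqW ik).
  by rewrite dispersionE; apply/det0P; exists u.
have Q1 : minor_above V E (f k1) (z, lam) != 0.
  apply/eqP => Q0; apply: (PQ lam); rewrite Px Qx; split; assumption.
have P1 : minor_below V E (f k1) (z, lam) = 0.
  by have /eqP := KP k1 Kk1; rewrite mulf_eq0 (negPf Q1) orbF => /eqP.
rewrite minor_belowE in P1; rewrite minor_aboveE in Q1.
have [u [u0 uM us]] := chain_kernel_below (bloch_chain V (z, lam) En) p1 p0 lv01 D0 Q1 P1.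
have uMx : u *m bloch V E (x, lam) = 0.
  by apply: (ker_x u uM) => i /andP[ik _]; exact: us (leqW ik).
apply: (PD lam); split; apply/eqP.
  rewrite minor_belowE; apply/principal_minor_eq0P; exists u; split=> [|i|j _]; [exact: u0| |by rewrite uMx mxE].
  by rewrite inE -leqNgt => ik; exact: us (leqW ik).
by rewrite dispersionE; apply/det0P; exists u.
Qed.

Lemma corner_cominor_neq0 (x : 'rV[C]_d) lam k : corner x -> dispersion V E (x, lam) = 0 ->
  cominor V E k (x, lam) != 0.
Proof.
have [En gen] := VE_generic => cx D0; rewrite cominorE // mulf_neq0 //.
  by have [_ PD _] := gen x cx (f k) (f k) (leqnn _); apply/eqP => P0; exact: (PD lam).
by have [_ _ QD] := gen x cx (f k) (f k) (leqnn _); apply/eqP => Q0; exact: (QD lam).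
Qed.

End Stationary.

(** * Critical points are nondegenerate corner points *)

Section DerivativesAlongLines.
Context {K : numFieldType}.

(** Along coordinate lines the difference quotients of the dispersion polynomial have closed forms,
    so its derivatives are found as limits without first proving it differentiable. *)
Lemma derive_quotientE (U W : normedModType K) (g : U -> W) (x v : U) (l : W) (q : K -> W) :
  (\forall h \near 0^', h^-1 *: (g (h *: v + x) - g x) = q h) ->
  q h @[h --> 0^'] --> l -> 'D_v g x = l.
Proof.
move=> gq ql; apply: cvg_lim => //.
by apply: cvg_trans ql; apply: near_eq_cvg; apply: filterS gq => h /= ->.
Qed.

Lemma cvg_addr_dnbhs0 (z : K) : z + h @[h --> (0 : K)^'] --> z.
Proof.
apply: (@cvg_trans _ (z + h @[h --> (0 : K)])).
  exact: cvg_app (@nbhs_dnbhs _ _).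
have : z + h @[h --> (0 : K)] --> z + 0 by exact: (cvgD (cvg_cst _) cvg_id).
by rewrite addr0.
Qed.

Lemma near_dnbhs0_neq (z : K) : z != 0 -> \forall h \near (0 : K)^', (h != 0) && (z + h != 0).
Proof.
move=> z0; apply: filter_app (nbhs_dnbhs_neq _); apply: filterS (cvgr_neq0 _ (@cvg_addr_dnbhs0 z) z0).
by move=> h zh h0; rewrite h0 zh.
Qed.

Lemma cvg_addV_quotient (z : K) : z != 0 ->
  1 - (z * (z + h))^-1 @[h --> (0 : K)^'] --> 1 - z ^- 2.
Proof.
move=> z0; have zz0 : z * z != 0 by rewrite mulf_neq0.
exact: (cvgB (cvg_cst _) (cvgV zz0 (cvgM (cvg_cst _) (@cvg_addr_dnbhs0 z)))).
Qed.

(** This is the difference quotient of [1 - z^-2], whose derivative [2 z^-3] equals [2 z] where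
    [z^2 = 1]. *)
Lemma cvg_sqrV_quotient (z : K) : z ^+ 2 = 1 ->
  (2 * z + h) / (z + h) ^+ 2 @[h --> (0 : K)^'] --> 2 * z.
Proof.
move=> z2; have z0 : z != 0 by apply: contra_eq_neq z2 => ->; rewrite expr0n /= eq_sym oner_neq0.
suff : (2 * z + h) / (z + h) ^+ 2 @[h --> (0 : K)^'] --> 2 * z / z ^+ 2.
  by rewrite z2 divr1.
have zz0 : z * z != 0 by rewrite mulf_neq0.
have cz := @cvg_addr_dnbhs0 z.
exact: (cvgM (@cvg_addr_dnbhs0 (2 * z)) (cvgV zz0 (cvgM cz cz))).
Qed.

End DerivativesAlongLines.

(** * Spectral bands *)

Section HermitianForms.
Context {C : numClosedFieldType} {n : nat}.
Local Open Scope sesquilinear_scope.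
Implicit Types (H : 'M[C]_n) (v w : 'rV[C]_n).

Definition form H v : C := (v *m H *m v^t*) 0 0.

Lemma form_diag (e : 'rV[C]_n) v : form (diag_mx e) v = \sum_i e 0 i * `|v 0 i| ^+ 2.
Proof.
rewrite /form mxE; apply: eq_bigr => i _.
rewrite mul_mx_diag !mxE normCK; ring.
Qed.

Lemma form1 v : form 1%:M v = \sum_i `|v 0 i| ^+ 2.
Proof.
rewrite -diag_const_mx form_diag; apply: eq_bigr => i _.
by rewrite mxE mul1r.
Qed.

Lemma form1_gt0 v : v != 0 -> 0 < form 1%:M v.
Proof.
move=> /rV0Pn[i vi]; rewrite form1 (bigD1 i) //= ltr_pwDl //.
  by rewrite exprn_gt0 // normr_gt0.
by apply: sumr_ge0 => j _; rewrite exprn_ge0.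
Qed.

Lemma formD H H' v : form (H + H') v = form H v + form H' v.
Proof. by rewrite /form mulmxDr mulmxDl mxE. Qed.

Lemma form_unitary H (U : 'M[C]_n) w : form H (w *m U) = form (U *m H *m U^t*) w.
Proof. by rewrite /form trmx_mul map_mxM !mulmxA. Qed.

Lemma hermitian_spectralE H : H \is hermsymmx ->
  H = (spectralmx H)^t* *m diag_mx (spectral_diag H) *m spectralmx H.
Proof.
move=> hH; rewrite -invmx_unitary ?spectral_unitarymx //.
exact/orthomx_spectralP/hermitian_normalmx.
Qed.

Lemma form_spectral H w : H \is hermsymmx ->
  form H (w *m spectralmx H) = \sum_i spectral_diag H 0 i * `|w 0 i| ^+ 2.
Proof.
move=> hH; have UU : spectralmx H *m (spectralmx H)^t* = 1%:M.
  by apply/unitarymxP; exact: spectral_unitarymx.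
rewrite form_unitary {2}(hermitian_spectralE hH) !mulmxA UU mul1mx -mulmxA UU mulmx1.
exact: form_diag.
Qed.

Lemma form1_spectral H w : form 1%:M (w *m spectralmx H) = \sum_i `|w 0 i| ^+ 2.
Proof.
rewrite form_unitary mulmx1 (_ : _ *m _ = 1%:M) ?form1 //.
by apply/unitarymxP; exact: spectral_unitarymx.
Qed.

Lemma spectral_sub H (lam : C) : H \is hermsymmx ->
  H - lam%:M = invmx (spectralmx H) *m
    diag_mx (\row_i (spectral_diag H 0 i - lam)) *m spectralmx H.
Proof.
move=> hH; have uU := spectral_unit H.
have -> : diag_mx (\row_i (spectral_diag H 0 i - lam)) = diag_mx (spectral_diag H) - lam%:M.
  by apply/matrixP=> i j; rewrite !mxE -mulrnBl.
rewrite mulmxBr mulmxBl -(orthomx_spectralP (hermitian_normalmx hH)).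
by rewrite scalar_mxC -mulmxA mulVmx // mulmx1.
Qed.

Lemma det_hermitian_sub H (lam : C) : H \is hermsymmx ->
  \det (H - lam%:M) = \prod_i (spectral_diag H 0 i - lam).
Proof.
move=> hH; rewrite spectral_sub // !det_mulmx mulrAC -det_mulmx mulVmx ?spectral_unit //.
by rewrite det1 mul1r det_diag; apply: eq_bigr => i _; rewrite mxE.
Qed.

(* Two independent eigenvectors combine to one vanishing at [s]. *)
Lemma hermitian_simple H (lam : C) s i0 i1 : H \is hermsymmx ->
  principal_minor (H - lam%:M) (~: [set s])%SET != 0 ->
  spectral_diag H 0 i0 = lam -> spectral_diag H 0 i1 = lam -> i0 = i1.
Proof.
move=> hH Ps e0 e1; apply/eqP; apply: contraNT Ps => i01.
set U := spectralmx H; have uU : U \in unitmx := spectral_unit H.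
have [w [w0 wi ws]] : exists w : 'rV[C]_n, [/\ w != 0,
    forall i, i != i0 -> i != i1 -> w 0 i = 0 & (w *m U) 0 s = 0].
  have [U0|U0] := eqVneq (U i0 s) 0.
    exists (delta_mx 0 i0); split.
    - by apply/rV0Pn; exists i0; rewrite mxE !eqxx oner_neq0.
    - by move=> i /negPf ni _; rewrite mxE ni andbF.
    - by rewrite -rowE mxE.
  exists (U i0 s *: delta_mx 0 i1 - U i1 s *: delta_mx 0 i0); split.
  - apply/rV0Pn; exists i1; rewrite !mxE !eqxx [i1 == i0]eq_sym (negPf i01) /=.
    by rewrite mulr1 mulr0 subr0.
  - by move=> i /negPf ni0 /negPf ni1; rewrite !mxE ni0 ni1 !andbF !mulr0 subr0.
  - by rewrite mulmxBl -!scalemxAl -!rowE !mxE mulrC subrr.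
apply/principal_minor_eq0P; exists (w *m U); split.
- apply: contraNneq w0 => wU; rewrite -(mulmxK uU w) wU mul0mx //.
- by move=> i; rewrite !inE negbK => /eqP->.
- move=> j _; rewrite spectral_sub // !mulmxA mulmxK //.
  rewrite (_ : w *m diag_mx _ = 0) ?mul0mx ?mxE //.
  apply/rowP=> i; rewrite mul_mx_diag !mxE.
  have [->|ni0] := eqVneq i i0; first by rewrite e0 subrr mulr0.
  have [->|ni1] := eqVneq i i1; first by rewrite e1 subrr mulr0.
  by rewrite wi ?mul0r.
Qed.

(* Dimension count: the two spans have total dimension greater than n. *)
Lemma spans_intersect H H' (S S' : {set 'I_n}) : (n < #|S| + #|S'|)%N ->
  exists v w w', [/\ v != 0, v = w *m spectralmx H, v = w' *m spectralmx H',
    forall i, i \notin S -> w 0 i = 0 & forall i, i \notin S' -> w' 0 i = 0].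
Proof.
move=> nSS.
pose A := rowsub (fun k : 'I_#|S| => enum_val k) (spectralmx H).
pose A' := rowsub (fun k : 'I_#|S'| => enum_val k) (spectralmx H').
have rk (K : 'M[C]_n) (T : {set 'I_n}) :
    \rank (rowsub (fun k : 'I_#|T| => enum_val k) (spectralmx K)) = #|T|.
  rewrite rowsubE mxrankMfree ?row_free_unit ?spectral_unit //.
  apply/eqP/row_freeP.
  exists (colsub (fun k : 'I_#|T| => enum_val k) 1%:M).
  by rewrite mul_rowsub_mx mul1mx; apply/matrixP=> i j; rewrite !mxE (inj_eq enum_val_inj).
have cap0 : (A :&: A')%MS != 0.
  rewrite -mxrank_eq0 -lt0n.
  have := mxrank_sum_cap A A'; rewrite !rk => e.
  by have := rank_leq_col (A + A')%MS; lia.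
have sup (K : 'M[C]_n) (T : {set 'I_n}) (v : 'rV[C]_n) :
    (v <= rowsub (fun k : 'I_#|T| => enum_val k) (spectralmx K))%MS ->
    exists2 w, v = w *m spectralmx K & forall i, i \notin T -> w 0 i = 0.
  move=> /submxP[c ->]; exists (c *m rowsub (fun k : 'I_#|T| => enum_val k) 1%:M).
    by rewrite rowsubE mulmxA.
  move=> i iT; rewrite mxE big1 // => k _; rewrite !mxE.
  case: eqP => [ik|]; last by rewrite mulr0.
  by move: iT; rewrite -ik enum_valP.
have [|w vw wS] := sup H S (nz_row (A :&: A')%MS).
  by apply: submx_trans (nz_row_sub _) (capmxSl _ _).
have [|w' vw' wS'] := sup H' S' (nz_row (A :&: A')%MS).
  by apply: submx_trans (nz_row_sub _) (capmxSr _ _).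
by exists (nz_row (A :&: A')%MS), w, w'; rewrite nz_row_eq0.
Qed.

End HermitianForms.

(** * Ranked eigenvalues *)

Section SortedCount.
Context {R : realDomainType}.

Lemma sorted_count_le (s : seq R) j : sorted <=%R s -> (j < size s)%N ->
  (j < count (fun x : R => x <= nth 0 s j)%R s)%N.
Proof.
move=> ss js; rewrite -[X in count _ X](cat_take_drop j.+1) count_cat.
apply: (@leq_trans (count (fun x : R => x <= nth 0 s j)%R (take j.+1 s))); last exact: leq_addr.
rewrite (_ : count _ _ = j.+1) //; rewrite -[RHS](size_takel js); apply/eqP; rewrite -all_count.
apply/(all_nthP 0) => i; rewrite size_takel // => ij; rewrite nth_take //.
by apply: (sorted_leq_nth le_trans lexx _ ss); rewrite ?inE //; exact: leq_trans js.
Qed.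

Lemma sorted_count_ge (s : seq R) j : sorted <=%R s -> (j < size s)%N ->
  (size s - j <= count (fun x : R => nth 0 s j <= x)%R s)%N.
Proof.
move=> ss js; rewrite -[X in count _ X](cat_take_drop j) count_cat.
apply: (@leq_trans (count (fun x : R => nth 0 s j <= x)%R (drop j s))); last exact: leq_addl.
rewrite -size_drop (_ : count _ _ = size (drop j s)) //; apply/eqP; rewrite -all_count.
apply/(all_nthP 0) => i; rewrite size_drop => ij; rewrite nth_drop.
by apply: (sorted_leq_nth le_trans lexx _ ss); rewrite ?inE -?ltn_subRL ?leq_addr.
Qed.

End SortedCount.

Section RankedEigenvalues.
Context {R : realType} {n : nat}.
Local Notation C := (Cplx R).
Implicit Types (H : 'M[C]_n) (S : 'M[R]_n).

Definition eigs H (i : 'I_n) : R := complex.Re (spectral_diag H 0 i).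

Definition eig_seq H : seq R :=
  sort (fun s t : R => s <= t) [seq eigs H i | i <- enum 'I_n].

Definition ranked_eig H (j : nat) : R := nth 0 (eig_seq H) j.

Lemma hermitian_map S : S^T = S -> map_mx (toC R) S \is hermsymmx.
Proof.
move=> sS; apply: realsym_hermsym.
  apply/is_hermitianmxP; rewrite expr0 scale1r map_mx_id //.
  by rewrite map_trmx sS.
by apply/mxOverP => i j; rewrite mxE; apply/complex_realP; eexists.
Qed.

Lemma eigsE H i : H \is hermsymmx -> spectral_diag H 0 i = toC R (eigs H i).
Proof.
move=> /hermitian_spectral_diag_real/mxOverP/(_ 0 i) ri.
by rewrite [RHS](RRe_real ri).
Qed.

Lemma toC_le (x y : R) : (toC R x <= toC R y) = (x <= y).
Proof. exact: lecR. Qed.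

Lemma toC_lt (x y : R) : (toC R x < toC R y) = (x < y).
Proof. exact: ltcR. Qed.

Lemma toC_inj : injective (toC R).
Proof. exact: fmorph_inj. Qed.

Lemma det_sym_sub S (lam : R) : S^T = S ->
  \det (S - lam%:M) = \prod_i (eigs (map_mx (toC R) S) i - lam).
Proof.
move=> sS; apply: toC_inj; rewrite -det_map_mx rmorph_prod map_mxB map_scalar_mx.
rewrite det_hermitian_sub ?hermitian_map //; apply: eq_bigr => i _.
by rewrite eigsE ?hermitian_map // rmorphB.
Qed.

Lemma size_ranked H : size (eig_seq H) = n.
Proof. by rewrite /eig_seq size_sort size_map size_enum_ord. Qed.

Lemma ranked_sorted H : sorted <=%R (eig_seq H).
Proof. by apply: sort_sorted => x y; exact: le_total. Qed.

Lemma count_ranked H (p : pred R) :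
  count p (eig_seq H) =
  #|[set i | p (eigs H i)]%SET|.
Proof.
rewrite /eig_seq (permP (permEl (perm_sort _ _))) count_map -size_filter cardE; congr size.
rewrite enumT; apply: eq_filter => i.
by rewrite -[RHS]/(i \in [set i | p (eigs H i)]%SET) finset.in_set.
Qed.

Lemma ranked_eig_mem H (j : 'I_n) : exists i, ranked_eig H j = eigs H i.
Proof.
have : ranked_eig H j \in eig_seq H.
  by rewrite mem_nth // size_ranked.
by rewrite mem_sort => /mapP[i _ ->]; exists i.
Qed.

(** Two distinct positions with one value would make that value occur twice in the sorted list,
    against simplicity. *)
Lemma ranked_eig_inj H (j k : 'I_n) :
  (forall i0 i1, eigs H i0 = ranked_eig H j -> eigs H i1 = ranked_eig H j -> i0 = i1) ->
  ranked_eig H j = ranked_eig H k -> j = k.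
Proof.
move=> uniq_i e; apply/val_inj => /=; apply/eqP.
have c1 : (count (pred1 (ranked_eig H j)) (eig_seq H) <= 1)%N.
  rewrite count_ranked; apply/card_le1_eqP => i0 i1; rewrite !inE => /eqP e0 /eqP e1.
  exact: uniq_i.
apply: contraTT c1 => jk; rewrite -ltnNge.
set s := eig_seq H in e *; have ss : size s = n by exact: size_ranked.
wlog lt_jk : j k e jk {uniq_i} / (j < k)%N.
  move=> W; have [lt_jk|lt_kj|/eqP] := ltngtP j k; last by rewrite (negPf jk).
    exact: (W j k).
  by have := W k j; rewrite e; apply => //; rewrite eq_sym.
rewrite -[X in count _ X](cat_take_drop k) count_cat -addn1 addnC leq_add //.
  rewrite -has_count; apply/hasP; exists (nth 0 s k); last by rewrite /= /ranked_eig in e *; rewrite e.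
  by rewrite -{1}[k : nat]addn0 -nth_drop mem_nth // size_drop ss subn_gt0.
rewrite -has_count; apply/hasP; exists (nth 0 s j); last by rewrite /=.
by rewrite -(@nth_take k) // mem_nth // size_takel // ss ltnW.
Qed.

(* Weyl's inequality, by Courant-Fischer. *)
Lemma ranked_eig_add_diag S (del : 'rV[R]_n) (c : R) (j : 'I_n) : S^T = S ->
  (forall i, - c <= del 0 i) ->
  ranked_eig (map_mx (toC R) S) j - c <= ranked_eig (map_mx (toC R) (S + diag_mx del)) j.
Proof.
move=> sS delc; set H := map_mx _ S; set H' := map_mx _ (S + _).
have hH : H \is hermsymmx by exact: hermitian_map.
have hH' : H' \is hermsymmx by apply: hermitian_map; rewrite linearD /= sS tr_diag_mx.
rewrite leNgt; apply/negP => lt.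
set mu := ranked_eig H j in lt *; set mu' := ranked_eig H' j in lt *.
(* The eigenvalues of [H] from rank [j] up and those of [H'] up to rank [j] number at least
   [(n - j) + (j + 1) > n], so the spans of their eigenvectors meet. *)
have cS : (n - j <= #|[set i | (mu <= eigs H i)%R]%SET|)%N.
  rewrite -(@count_ranked H (fun x => mu <= x)) -{1}(size_ranked H).
  by apply: sorted_count_ge; rewrite ?size_ranked //; exact: ranked_sorted.
have cS' : (j < #|[set i | (eigs H' i <= mu')%R]%SET|)%N.
  rewrite -(@count_ranked H' (fun x => x <= mu')).
  by apply: sorted_count_le; rewrite ?size_ranked //; exact: ranked_sorted.
have [|v [w [w' [v0 vw vw' wS wS']]]] :=
    @spans_intersect C n H H' [set i | (mu <= eigs H i)%R]%SET [set i | (eigs H' i <= mu')%R]%SET.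
  by apply: leq_trans (leq_add cS cS'); rewrite addnS subnK // ltnW.
have low : toC R mu * form 1%:M v <= form H v.
  rewrite vw form1_spectral form_spectral // mulr_sumr; apply: ler_sum => i _.
  have [iS|iS] := boolP (i \in [set i | mu <= eigs H i]%SET); last first.
    by rewrite wS // normr0 expr0n !mulr0.
  by rewrite ler_wpM2r ?exprn_ge0 // eigsE // toC_le; rewrite inE in iS.
have high : form H' v <= toC R mu' * form 1%:M v.
  rewrite vw' form1_spectral form_spectral // mulr_sumr; apply: ler_sum => i _.
  have [iS|iS] := boolP (i \in [set i | eigs H' i <= mu']%SET); last first.
    by rewrite wS' // normr0 expr0n !mulr0.
  by rewrite ler_wpM2r ?exprn_ge0 // eigsE // toC_le; rewrite inE in iS.
have mid : form H v - toC R c * form 1%:M v <= form H' v.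
  rewrite /H' map_mxD formD lerD2l map_diag_mx form_diag form1 mulr_sumr -sumrN.
  apply: ler_sum => i _; rewrite -mulNr ler_wpM2r ?exprn_ge0 // mxE -rmorphN.
  by rewrite toC_le.
have := le_trans (le_trans (lerB low (lexx _)) mid) high.
rewrite -mulrBl ler_pM2r ?form1_gt0 // -rmorphB toC_le.
by rewrite leNgt lt.
Qed.

Lemma ranked_eig_dist S (del : 'rV[R]_n) (c : R) (j : 'I_n) : S^T = S ->
  (forall i, `|del 0 i| <= c) ->
  `|ranked_eig (map_mx (toC R) (S + diag_mx del)) j - ranked_eig (map_mx (toC R) S) j| <= c.
Proof.
move=> sS delc; rewrite ler_norml; apply/andP; split.
  rewrite lerBrDl; apply: ranked_eig_add_diag => // i.
  by have := delc i; rewrite ler_norml => /andP[].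
rewrite lerBlDr -lerBlDl.
rewrite [X in _ <= ranked_eig (map_mx _ X) j](_ : S = S + diag_mx del + diag_mx (- del)).
  apply: ranked_eig_add_diag; first by rewrite linearD /= sS tr_diag_mx.
  by move=> i; rewrite mxE lerN2; have := delc i; rewrite ler_norml => /andP[].
by rewrite -addrA -linearD /= subrr linear0 addr0.
Qed.

End RankedEigenvalues.

Section TorusFloquet.
Context {R : realType} {d a m b : nat} {A : sgraph a} {B : sgraph b} {f : 'I_d -> 'I_m}.
Variables (V : potential R (isthmus_connected A B f)).
Variables (E : edge_weight R (isthmus_connected A B f)).
Local Notation C := (Cplx R).
Local Notation n := (a + m + b)%N.
Local Notation loop_vertex k := (@loop_vertex d a m b f k).

(* On the torus z + 1/z = 2 Re z, so that the Floquet matrix is real there. *)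
Definition floquet_real (y : 'rV[R]_d) : 'M[R]_n :=
  \matrix_(i, j) (edge_coef E i j +
    (V (0, i) + \sum_(k | loop_vertex k == i) loop_coef E k * (2 * y 0 k)) *+ (i == j)).

Lemma addV_torus (z : C) : `|z| = 1 -> z + z^-1 = toC R (2 * complex.Re z).
Proof.
move=> z1; rewrite invc_norm z1 expr1n invr1 mul1r addcJ rmorphM /=.
by rewrite rmorph_nat.
Qed.

Lemma floquet_torus (z : 'rV[C]_d) : torus z ->
  floquet V E z = map_mx (toC R) (floquet_real (\row_k complex.Re (z 0 k))).
Proof.
move=> tz; apply/matrixP=> i j; rewrite floquetE !mxE rmorphD rmorphMn rmorphD rmorph_sum /=.
congr (_ + (_ + _) *+ _); apply: eq_bigr => k _.
by rewrite mxE addV_torus // -rmorphM.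
Qed.

Lemma floquet_real_sym y : (floquet_real y)^T = floquet_real y.
Proof.
apply/matrixP=> i j; rewrite !mxE edge_coef_sym eq_sym.
by case: eqP => // ->.
Qed.

Lemma floquet_hermitian z : torus z -> floquet V E z \is hermsymmx.
Proof. by move=> tz; rewrite floquet_torus //; apply: hermitian_map; exact: floquet_real_sym. Qed.

Lemma corner_sqr (x : 'rV[C]_d) k : corner x -> x 0 k ^+ 2 = 1.
Proof. by move=> cx; case: (cx k) => ->; rewrite ?sqrrN expr1n. Qed.

Lemma corner_neq0 (x : 'rV[C]_d) k : corner x -> x 0 k != 0.
Proof.
by move=> cx; case: (cx k) => ->; rewrite ?oppr_eq0 oner_neq0.
Qed.

Lemma corner_torus (x : 'rV[C]_d) : corner x -> torus x.
Proof. by move=> cx k; case: (cx k) => ->; rewrite ?normrN normr1. Qed.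

Lemma torus_simple z lam k i0 i1 : torus z -> cominor V E k (z, lam) != 0 ->
  spectral_diag (floquet V E z) 0 i0 = lam -> spectral_diag (floquet V E z) 0 i1 = lam -> i0 = i1.
Proof.
move=> tz; rewrite /cominor bloch.unlock; apply: hermitian_simple.
exact: floquet_hermitian.
Qed.

Lemma dispersion_torus z lam : torus z ->
  dispersion V E (z, lam) = \prod_i (spectral_diag (floquet V E z) 0 i - lam).
Proof. by move=> tz; rewrite /dispersion /= det_hermitian_sub //; exact: floquet_hermitian. Qed.

End TorusFloquet.

Lemma addV_quotientE (K : fieldType) (h l z c : K) : h != 0 -> z != 0 -> z + h != 0 ->
  h^-1 * (l * (z + h + (z + h)^-1 - (z + z^-1)) * c) = l * (1 - (z * (z + h))^-1) * c.
Proof. by move=> h0 z0 zh; field; rewrite h0 z0 zh. Qed.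

Lemma subV2_quotientE (K : fieldType) (h l z c : K) : h != 0 -> z + h != 0 -> z ^+ 2 = 1 ->
  h^-1 * (l * (1 - (z + h) ^- 2) * c) = l * ((2 * z + h) / (z + h) ^+ 2) * c.
Proof.
move=> h0 zh z2; have -> : 1 - (z + h) ^- 2 = ((z + h) ^+ 2 - z ^+ 2) / (z + h) ^+ 2.
  by rewrite z2; field.
by field; rewrite h0 zh.
Qed.

Lemma cvg_bigprod (K : numFieldType) (T I : Type) (F : set_system T) {FF : Filter F}
    (s : seq I) (P : pred I) (g : I -> T -> K) (l : I -> K) :
  (forall i, g i h @[h --> F] --> l i) ->
  \prod_(i <- s | P i) g i h @[h --> F] --> \prod_(i <- s | P i) l i.
Proof.
move=> gl; elim: s => [|i s IH].
  rewrite big_nil (_ : (fun h => _) = cst 1); first exact: cvg_cst.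
  by apply/funext => h; rewrite big_nil.
rewrite big_cons (_ : (fun h => _) = (fun h => if P i then g i h * \prod_(j <- s | P j) g j h
    else \prod_(j <- s | P j) g j h)); last by apply/funext => h; rewrite big_cons.
by case: (P i) => //; exact: (cvgM (gl i) IH).
Qed.

Section CriticalPoints.
Context {R : realType} {d a m b : nat} {A : sgraph a} {B : sgraph b} {f : 'I_d -> 'I_m}.
Variables (V : potential R (isthmus_connected A B f)).
Variables (E : edge_weight R (isthmus_connected A B f)).
Local Notation C := (Cplx R).
Local Notation n := (a + m + b)%N.
Local Notation D := (@dispersion R d (isthmus_connected A B f) V E).
Local Notation loop_vertex k := (@loop_vertex d a m b f k).

Lemma direction_z (k : 'I_d) : direction (lshift 1 k) = (delta_mx 0 k, 0) :> 'rV[C]_d * C.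
Proof. by rewrite /direction (unsplitK (inl k)). Qed.

Lemma direction_lam (k : 'I_1) : direction (rshift d k) = (0, 1) :> 'rV[C]_d * C.
Proof. by rewrite /direction (unsplitK (inr k)). Qed.

Lemma critical_system_z (k : 'I_d) :
  critical_system V E (lshift 1 k) = 'D_(delta_mx 0 k, 0) D.
Proof. by rewrite /critical_system (unsplitK (inl k)) direction_z. Qed.

Lemma critical_system_D (k : 'I_1) : critical_system V E (rshift d k) = D.
Proof. by rewrite /critical_system (unsplitK (inr k)). Qed.

Lemma line_z (h : C) (k : 'I_d) (z : 'rV[C]_d) (lam : C) :
  h *: (delta_mx 0 k, 0) + (z, lam) = (h *: delta_mx 0 k + z, lam) :> 'rV[C]_d * C.
Proof. by congr (_, _); rewrite /= scaler0 add0r. Qed.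

Lemma line_lam (h : C) (z : 'rV[C]_d) (lam : C) :
  h *: (0, 1) + (z, lam) = (z, h + lam) :> 'rV[C]_d * C.
Proof. by congr (_, _); rewrite /= ?scaler0 ?add0r // [_ *: _]mulr1. Qed.

Lemma line_coord (h : C) (k l : 'I_d) (z : 'rV[C]_d) :
  (h *: delta_mx 0 k + z) 0 l = z 0 l + h *+ (l == k).
Proof. by rewrite !mxE eqxx /= mulr_natr addrC. Qed.

Lemma derive_dispersion_z (z : 'rV[C]_d) (lam : C) (k : 'I_d) : z 0 k != 0 ->
  'D_(delta_mx 0 k, 0) D (z, lam) =
  toC R (loop_coef E k) * (1 - z 0 k ^- 2) * cominor V E k (z, lam).
Proof.
move=> zk; apply: (derive_quotientE (q := fun h => toC R (loop_coef E k) *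
    (1 - (z 0 k * (z 0 k + h))^-1) * cominor V E k (z, lam))).
  apply: filterS (near_dnbhs0_neq zk) => h /andP[h0 zh].
  rewrite line_z (dispersion_move V E (k := k) (x := h *: delta_mx 0 k + z) (z := z)); last first.
    by move=> l /negPf lk; rewrite line_coord lk addr0.
  rewrite line_coord eqxx mulr1n addrAC subrr add0r.
  exact: addV_quotientE.
exact: (cvgM (cvgM (cvg_cst _) (cvg_addV_quotient zk)) (cvg_cst _)).
Qed.

(** For [l != k], moving [z_l] keeps [z_k] at 1 or -1, where the factor [1 - z_k^-2] of the first
    derivative vanishes: that derivative is zero along the whole line. For [l = k] the cofactor is
    constant and only this factor varies. *)
Lemma derive2_dispersion (x : 'rV[C]_d) (lam : C) (k l : 'I_d) : corner x ->
  'D_(delta_mx 0 l, 0) ('D_(delta_mx 0 k, 0) D) (x, lam) =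
  (toC R (loop_coef E k) * (2 * x 0 k) * cominor V E k (x, lam)) *+ (k == l).
Proof.
move=> cx; have xk := corner_neq0 k cx; have xk2 := corner_sqr k cx.
have Dk0 : 'D_(delta_mx 0 k, 0) D (x, lam) = 0.
  by rewrite derive_dispersion_z // xk2 invr1 subrr mulr0 mul0r.
apply: (derive_quotientE (q := fun h => (toC R (loop_coef E k) *
    ((2 * x 0 k + h) / (x 0 k + h) ^+ 2) * cominor V E k (x, lam)) *+ (k == l))).
  apply: filterS (near_dnbhs0_neq xk) => h /andP[h0 xh].
  rewrite line_z Dk0 subr0 derive_dispersion_z line_coord; last first.
    by case: (k == l); rewrite ?mulr1n ?mulr0n ?addr0.
  case: eqVneq => [<-|kl]; last by rewrite !mulr0n addr0 xk2 invr1 subrr mulr0 mul0r scaler0.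
  rewrite !mulr1n (cominor_move V E (k := k) (x := h *: delta_mx 0 k + x) (z := x)); last first.
    by move=> i /negPf ik; rewrite line_coord ik addr0.
  exact: subV2_quotientE.
case: eqVneq => [_|_]; last by rewrite mulr0n; exact: cvg_cst.
exact: (cvgM (cvgM (cvg_cst _) (cvg_sqrV_quotient xk2)) (cvg_cst _)).
Qed.

Lemma derive_dispersion_z_lam (x : 'rV[C]_d) (lam : C) (k : 'I_d) : corner x ->
  'D_(0, 1) ('D_(delta_mx 0 k, 0) D) (x, lam) = 0.
Proof.
move=> cx; have xk := corner_neq0 k cx; have xk2 := corner_sqr k cx.
have Dk0 mu : 'D_(delta_mx 0 k, 0) D (x, mu) = 0.
  by rewrite derive_dispersion_z // xk2 invr1 subrr mulr0 mul0r.
apply: (derive_quotientE (q := fun=> 0)); last exact: cvg_cst.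
by apply: nearW => h; rewrite line_lam !Dk0 subrr scaler0.
Qed.

(** In [lam] the dispersion polynomial is the product of the differences between the eigenvalues and
    [lam]. The nonzero cofactor makes the eigenvalue simple, so the derivative is, up to sign, the
    product of the other, nonzero, factors. *)
Lemma derive_dispersion_lam_neq0 (x : 'rV[C]_d) (lam : C) (k : 'I_d) : torus x ->
  D (x, lam) = 0 -> cominor V E k (x, lam) != 0 -> 'D_(0, 1) D (x, lam) != 0.
Proof.
move=> tx D0 ck; have /eqP := D0; rewrite dispersion_torus // => /prodf_eq0[i0 _ /eqP/subr0_eq e0].
have ->: 'D_(0, 1) D (x, lam) = - \prod_(i | i != i0) (spectral_diag (floquet V E x) 0 i - lam).
  apply: (derive_quotientE (q := fun h =>
      - \prod_(i | i != i0) (spectral_diag (floquet V E x) 0 i - (h + lam)))).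
    have hn0 : \forall h \near (0 : C)^', h != 0 by exact: nbhs_dnbhs_neq.
    apply: filterS hn0 => h h0.
    rewrite line_lam D0 subr0 dispersion_torus // (bigD1 i0) //= e0 opprD addrCA subrr addr0.
    by rewrite [LHS]/GRing.scale /= mulNr mulrN mulKf.
  apply: (cvgN (@cvg_bigprod _ _ _ _ _ _ _
    (fun i h => spectral_diag (floquet V E x) 0 i - (h + lam)) _ _)) => i.
  rewrite (_ : (fun h => _) = (fun h => spectral_diag (floquet V E x) 0 i - (lam + h))).
    exact: (cvgB (cvg_cst _) (@cvg_addr_dnbhs0 _ lam)).
  by apply/funext => h; rewrite [h + lam]addrC.
rewrite oppr_eq0; apply/prodf_neq0 => i ni; rewrite subr_eq0; apply: contra ni => /eqP ei.
by apply/eqP; exact: torus_simple tx ck ei e0.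
Qed.

Theorem critical_point_corner p : (0 < d)%N -> isthmus_generic V E -> critical_point V E p ->
  corner p.1 /\ nondegenerate_critical V E p.
Proof.
case: p => x lam d0 gVE [/= x0 crit]; have [En _] := gVE.
have D0 : D (x, lam) = 0 by rewrite -(critical_system_D 0); exact: crit.
have cx : corner x.
  apply: (stationary_corner gVE D0) => k.
  have := crit (lshift 1 k); rewrite critical_system_z derive_dispersion_z //.
  move/eqP; rewrite !mulf_eq0 fmorph_eq0 (negPf (loop_coef_neq0 k En)) /=.
  case/orP => [|/eqP->]; last by right.
  rewrite subr_eq0 => /eqP /(congr1 (fun t => t^-1)); rewrite invr1 invrK => /esym/eqP.
  by rewrite sqrf_eq1 => /orP[/eqP|/eqP]; left; [left|right].
split=> //; rewrite /nondegenerate_critical; set J := critical_jacobian _ _ _.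
have cne k := corner_cominor_neq0 gVE k cx D0.
have JE k l : J k l = 'D_(direction l) (critical_system V E k) (x, lam) by rewrite /J mxE.
(* The last row is diagonal too, since every [dD/dz_k] vanishes at a corner point. *)
have -> : J = diag_mx (\row_i J i i).
  apply/matrixP=> k l; rewrite !mxE; have [-> //|kl] := eqVneq k l.
  rewrite mulr0n.
  case: (split_ordP k) kl => k' ->; case: (split_ordP l) => l' -> kl.
  - rewrite direction_z critical_system_z derive2_dispersion //.
    by rewrite (inj_eq (@lshift_inj _ _)) in kl; rewrite (negPf kl).
  - by rewrite direction_lam critical_system_z derive_dispersion_z_lam.
  - rewrite direction_z critical_system_D derive_dispersion_z //.
    by rewrite corner_sqr // invr1 subrr mulr0 mul0r.
  - by rewrite !ord1 eqxx in kl.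
rewrite unitmxE det_diag unitfE; apply/prodf_neq0 => k _; rewrite mxE JE.
case: (split_ordP k) => k' ->.
  rewrite direction_z critical_system_z derive2_dispersion // eqxx mulr1n.
  by rewrite !mulf_neq0 ?fmorph_eq0 ?loop_coef_neq0 ?corner_neq0.
rewrite direction_lam critical_system_D.
(* Simplicity of the eigenvalue comes from a loop vertex; [d > 0] supplies one. *)
exact: (derive_dispersion_lam_neq0 (k := Ordinal d0)) (corner_torus cx) D0 (cne _).
Qed.

End CriticalPoints.

(** * Extrema of bands lie over corner points *)

Section UnitCircle.
Context {R : realType}.
Local Notation C := (Cplx R).

Lemma norm1_Re_Im (w : C) : (`|w| == 1) = (complex.Re w ^+ 2 + complex.Im w ^+ 2 == 1).
Proof.
rewrite -(inj_eq (@toC_inj R)) rmorph1 [toC R _]add_Re2_Im2 sqrp_eq1 //.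
Qed.

(* Rational parametrisation of the circle: multiply by (1 + i tau) / (1 - i tau). *)
Lemma unit_circle_Re_lt (w : C) (e : R) : `|w| = 1 -> complex.Im w != 0 -> 0 < e ->
  exists w' : C, [/\ `|w'| = 1, `|w - w'| < toC R e & complex.Re w < complex.Re w'].
Proof.
case: w => u v /eqP; rewrite norm1_Re_Im /= => /eqP uv v0 e0.
(* With [tau = - v t] the real part grows by [2 v^2 t (1 - u t) / q], positive because [t <= 1/2].
   The distance moved is at most [2 t], which is less than [3 t <= e]. *)
pose t := Num.min (2^-1) (e / 3).
have t0 : 0 < t by rewrite lt_min invr_gt0 ltr0n divr_gt0.
have t1 : t <= 2^-1 by rewrite ge_min lexx.
have te : 3 * t <= e.
  by rewrite mulrC -ler_pdivlMr // /t ge_min lexx orbT.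
pose tau := - v * t; pose q := 1 + tau ^+ 2.
have q1 : 1 <= q by rewrite lerDl sqr_ge0.
have q0 : q != 0 by rewrite gt_eqF // (lt_le_trans ltr01).
pose u' := u - 2 * tau * (u * tau + v) / q; pose v' := v + 2 * tau * (u - v * tau) / q.
have v2 : v ^+ 2 <= 1 by rewrite -uv lerDr sqr_ge0.
have u2 : u ^+ 2 <= 1 by rewrite -uv lerDl sqr_ge0.
exists (u' +i* v')%C; split.
- apply/eqP; rewrite norm1_Re_Im /=; apply/eqP.
  have -> : u' ^+ 2 + v' ^+ 2 = (u ^+ 2 + v ^+ 2).
    rewrite /u' /v'; move: q0; rewrite /q => q0.
    have -> : u - 2 * tau * (u * tau + v) / (1 + tau ^+ 2) =
      (u * (1 - tau ^+ 2) - 2 * v * tau) / (1 + tau ^+ 2) by field.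
    have -> : v + 2 * tau * (u - v * tau) / (1 + tau ^+ 2) =
      (v * (1 - tau ^+ 2) + 2 * u * tau) / (1 + tau ^+ 2) by field.
    by field.
  exact: uv.
- have eC : 0 < toC R e by rewrite -(rmorph0 (toC R)) toC_lt.
  rewrite -(@ltr_pXn2r _ 2) ?nnegrE ?normr_ge0 ?ltW // -add_Re2_Im2 -rmorphXn toC_lt /=.
  have -> : (u - u') ^+ 2 + (v - v') ^+ 2 = 4 * tau ^+ 2 / q.
    rewrite /u' /v'; move: q0; rewrite /q => q0.
    transitivity (4 * tau ^+ 2 * (u ^+ 2 + v ^+ 2) / (1 + tau ^+ 2)); last by rewrite uv mulr1.
    by field.
  rewrite ltr_pdivrMr ?(lt_le_trans ltr01) //.
  have tt : tau ^+ 2 <= t ^+ 2.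
    by rewrite /tau exprMn sqrrN ler_piMl ?sqr_ge0.
  have te2 : (3 * t) ^+ 2 <= e ^+ 2.
    by rewrite ler_pXn2r ?nnegrE // ?mulr_ge0 // ltW.
  have eq2 : e ^+ 2 <= e ^+ 2 * q by rewrite ler_peMr ?sqr_ge0.
  have t20 : 0 < t ^+ 2 by rewrite exprn_gt0.
  by move: te2; rewrite exprMn => te2; nra.
- rewrite /= /u' -subr_gt0 addrC addKr.
  have -> : - (2 * tau * (u * tau + v) / q) = 2 * (v ^+ 2 * t * (1 - u * t)) / q.
    by rewrite /tau; field.
  apply: divr_gt0; last exact: lt_le_trans ltr01 q1.
  have u1 : u <= 1 by nra.
  have ut : 0 < 1 - u * t by rewrite subr_gt0; nra.
  have vv : 0 < v ^+ 2 by rewrite exprn_even_gt0.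
  exact: mulr_gt0 (ltr0n _ 2) (mulr_gt0 (mulr_gt0 vv t0) ut).
Qed.

Lemma unit_circle_Re_gt (w : C) (e : R) : `|w| = 1 -> complex.Im w != 0 -> 0 < e ->
  exists w' : C, [/\ `|w'| = 1, `|w - w'| < toC R e & complex.Re w' < complex.Re w].
Proof.
move=> w1 w0 e0; have [|||w' [w'1 we wR]] := @unit_circle_Re_lt (- w) e.
- by rewrite normrN.
- by case: w w0 {w1} => u v /=; rewrite oppr_eq0.
- by [].
exists (- w'); rewrite normrN; split=> //.
  by rewrite opprK -normrN opprD.
by move: wR; case: (w) => ? ?; case: (w') => ? ? /=; rewrite ltrNl.
Qed.

End UnitCircle.

Section Extrema.
Context {R : realType} {d a m b : nat} {A : sgraph a} {B : sgraph b} {f : 'I_d -> 'I_m}.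
Variables (V : potential R (isthmus_connected A B f)).
Variables (E : edge_weight R (isthmus_connected A B f)).
Local Notation C := (Cplx R).
Local Notation n := (a + m + b)%N.
Local Notation D := (@dispersion R d (isthmus_connected A B f) V E).
Local Notation loop_vertex k := (@loop_vertex d a m b f k).
Local Notation floquet_real := (floquet_real V E).

Lemma bandE (j : 'I_n) x : band V E j x = ranked_eig (floquet V E x) j.
Proof. by []. Qed.

Lemma floquet_real_move (y y' : 'rV[R]_d) :
  floquet_real y' = floquet_real y +
    diag_mx (\row_i \sum_(k | loop_vertex k == i) loop_coef E k * (2 * (y' 0 k - y 0 k))).
Proof.
apply/matrixP=> i j; rewrite !mxE -addrA -mulrnDl; congr (_ + _ *+ _).
rewrite -addrA -big_split /=; congr (_ + _); apply: eq_bigr => k _; ring.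
Qed.

Lemma band_eigenvalue (j : 'I_n) x : torus x -> D (x, toC R (band V E j x)) = 0.
Proof.
move=> tx; rewrite dispersion_torus // bandE.
have [i ->] := ranked_eig_mem (floquet V E x) j.
by rewrite (bigD1 i) //= eigsE ?subrr ?mul0r //; exact: floquet_hermitian.
Qed.

Lemma band_move (j : 'I_n) (x z : 'rV[C]_d) k : torus x -> torus z ->
  (forall l, l != k -> x 0 l = z 0 l) ->
  0 <= loop_coef E k * (complex.Re (x 0 k) - complex.Re (z 0 k)) ->
  band V E j z <= band V E j x.
Proof.
move=> tx tz xz xk; rewrite !bandE !floquet_torus //.
rewrite [in leRHS](floquet_real_move (\row_k complex.Re (z 0 k))) -[leLHS]subr0.
apply: ranked_eig_add_diag; first exact: floquet_real_sym.
move=> i; rewrite oppr0 mxE; apply: sumr_ge0 => l _; rewrite !mxE.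
have [->|/xz->] := eqVneq l k; last by rewrite subrr !mulr0.
by rewrite mulrCA mulr_ge0.
Qed.

(** A common value would be a zero of the dispersion polynomial at both points, but its values there
    differ by [2 E_k] times the difference of real parts times the cofactor. This makes [band_move]
    strict. *)
Lemma band_move_neq (j : 'I_n) (x z : 'rV[C]_d) k : nonvanishing E -> torus x -> torus z ->
  (forall l, l != k -> x 0 l = z 0 l) ->
  complex.Re (x 0 k) != complex.Re (z 0 k) ->
  cominor V E k (z, toC R (band V E j z)) != 0 -> band V E j z != band V E j x.
Proof.
move=> En tx tz xz xk ck; apply: contra_neq xk => e.
have := band_eigenvalue j tx; rewrite -e (dispersion_move V E _ xz) (band_eigenvalue j tz) add0r => /eqP; rewrite !mulf_eq0 (negPf ck) orbF.
rewrite fmorph_eq0 (negPf (loop_coef_neq0 k En)) orFb (addV_torus (tx k)) (addV_torus (tz k)) -rmorphB fmorph_eq0.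
by rewrite -mulrBr mulf_eq0 pnatr_eq0 subr_eq0 => /eqP.
Qed.

(** If [z_k] is not real, its real part can be raised and lowered by arbitrarily small moves on the
    circle. With a nonzero cofactor, one of these moves strictly raises the band and the other
    strictly lowers it; the sign of the loop weight decides which. *)
Lemma extremum_stationary (j : 'I_n) (z : 'rV[C]_d) k : nonvanishing E -> torus z ->
  local_extremum V E j z ->
  (z 0 k = 1 \/ z 0 k = -1) \/ cominor V E k (z, toC R (band V E j z)) = 0.
Proof.
move=> En tz lz; have [ck|ck] := eqVneq (cominor V E k (z, toC R (band V E j z))) 0; first by right.
left; have [Iz|Iz] := eqVneq (complex.Im (z 0 k)) 0.
  have /eqP := tz k; rewrite norm1_Re_Im Iz expr0n addr0 sqrf_eq1.
  by case: (z 0 k) Iz => u v /= -> /orP[]/eqP->; [left|right; rewrite /GRing.opp /= oppr0].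
exfalso; have lk := loop_coef_neq0 k En.
pose x (w : C) : 'rV[C]_d := \row_l if l == k then w else z 0 l.
have xz w l : l != k -> x w 0 l = z 0 l by rewrite mxE => /negPf->.
have xk w : x w 0 k = w by rewrite mxE eqxx.
have tx w : `|w| = 1 -> torus (x w).
  by move=> w1 l; rewrite mxE; case: eqP => // _; exact: tz.
have bx (w e : C) : 0 < e -> `|z 0 k - w| < e -> ball z e (x w).
  move=> e0 we; split=> // i l; rewrite ord1 mxE; case: eqP => [->//|_].
  exact: ballxx.
have small (P : set 'rV[C]_d) : (\forall y \near z, P y) ->
    exists2 e : R, 0 < e & forall w, `|z 0 k - w| < toC R e -> P (x w).
  move=> /nbhs_ballP[e /= e0 eP].
  (* Radii of balls are complex scalars here; being positive, they are real. *)
  have [e' ee] : exists e', e = toC R e'.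
    by exists (complex.Re e); rewrite [RHS](RRe_real (gtr0_real e0)).
  exists e'; first by rewrite -toC_lt rmorph0 -ee.
  by move=> w we; apply: eP; apply: bx => //; rewrite ee.
have up w : `|w| = 1 -> 0 < loop_coef E k * (complex.Re w - complex.Re (z 0 k)) ->
    band V E j z < band V E j (x w).
  move=> w1 wk; rewrite lt_neqAle; apply/andP; split.
    apply: (band_move_neq En (tx w w1) tz (xz w)) => //; rewrite xk.
    by apply: contraTneq wk => ->; rewrite subrr mulr0 ltxx.
  by apply: (@band_move j (x w) z k (tx w w1) tz (xz w)); rewrite xk ltW.
have down w : `|w| = 1 -> loop_coef E k * (complex.Re w - complex.Re (z 0 k)) < 0 ->
    band V E j (x w) < band V E j z.
  move=> w1 wk; rewrite lt_neqAle eq_sym; apply/andP; split.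
    apply: (band_move_neq En (tx w w1) tz (xz w)) => //; rewrite xk.
    by apply: contraTneq wk => ->; rewrite subrr mulr0 ltxx.
  apply: (@band_move j z (x w) k tz (tx w w1)) => [l /xz-> //|].
  by rewrite xk -opprB mulrN oppr_ge0 ltW.
case: lz => /small[e e0 we].
  have [w [w1 wz wk]] : exists w : C, [/\ `|w| = 1, `|z 0 k - w| < toC R e &
      0 < loop_coef E k * (complex.Re w - complex.Re (z 0 k))].
    have [l0|l0] := ltP 0 (loop_coef E k).
      have [w [w1 wz wR]] := unit_circle_Re_lt (tz k) Iz e0.
      by exists w; split=> //; rewrite mulr_gt0 // subr_gt0.
    have [w [w1 wz wR]] := unit_circle_Re_gt (tz k) Iz e0.
    exists w; split=> //; rewrite nmulr_rgt0 ?subr_lt0 //.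
    by rewrite lt_neqAle lk.
  by have := we w wz (tx w w1); rewrite leNgt up.
have [w [w1 wz wk]] : exists w : C, [/\ `|w| = 1, `|z 0 k - w| < toC R e &
    loop_coef E k * (complex.Re w - complex.Re (z 0 k)) < 0].
  have [l0|l0] := ltP 0 (loop_coef E k).
    have [w [w1 wz wR]] := unit_circle_Re_gt (tz k) Iz e0.
    by exists w; split=> //; rewrite pmulr_rlt0 // subr_lt0.
  have [w [w1 wz wR]] := unit_circle_Re_lt (tz k) Iz e0.
  exists w; split=> //; rewrite nmulr_rlt0 ?subr_gt0 //.
  by rewrite lt_neqAle lk.
by have := we w wz (tx w w1); rewrite leNgt down.
Qed.

Hypothesis VE_generic : isthmus_generic V E.

Lemma extremum_corner p : Defs.extremum V E p -> corner p.1.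
Proof.
move=> [tp [j [pj lp]]]; have [En _] := VE_generic.
apply: (stationary_corner VE_generic (band_eigenvalue j tp)) => k.
exact: extremum_stationary.
Qed.

Lemma band_corner_inj (x : 'rV[C]_d) (j k : 'I_n) : (0 < d)%N -> corner x ->
  band V E j x = band V E k x -> j = k.
Proof.
move=> d0 cx; have tx := corner_torus cx; rewrite !bandE; apply: ranked_eig_inj => i0 i1 e0 e1.
have cne := corner_cominor_neq0 VE_generic (Ordinal d0) cx (band_eigenvalue j tx).
by apply: (torus_simple tx cne); rewrite eigsE ?floquet_hermitian // ?e0 ?e1 bandE.
Qed.

Lemma corner_isolated (x : 'rV[C]_d) : corner x -> \forall y \near x, corner y -> y = x.
Proof.
move=> cx; apply/nbhs_ballP; exists 1 => //= y [_ bxy] cy; apply/rowP => k.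
have := bxy 0 k; rewrite /ball /=; case: (cx k) => ->; case: (cy k) => -> //.
  by rewrite opprK ger0_norm ?addr_ge0 // gtrDl ltr10.
by rewrite -opprD normrN ger0_norm ?addr_ge0 // gtrDl ltr10.
Qed.

Lemma band_isolated (x : 'rV[C]_d) (l : R) :
  \forall l' \near l, forall j, l' = band V E j x -> l' = l.
Proof.
apply: (@filter_forall R 'I_n (fun j l' => l' = band V E j x -> l' = l) (nbhs l)) => j.
have [->|lj] := eqVneq (band V E j x) l.
  by apply: nearW => l' ->.
have lN : nbhs l [set l' | l' != band V E j x].
  by apply: open_nbhs_nbhs; split; [exact: open_neq|rewrite /= eq_sym].
by apply: filterS lN => l' /= lj' e; rewrite e eqxx in lj'.
Qed.

Lemma extremum_isolated p : Defs.extremum V E p -> \forall q \near p, Defs.extremum V E q -> q = p.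
Proof.
case: p => x l ep; have cx := extremum_corner ep.
have N1 : \forall q \near (x, l), corner q.1 -> q.1 = x.
  by exact: (@cvg_fst _ _ (nbhs x) (nbhs l) (nbhs_filter l) _ (corner_isolated cx)).
have N2 : \forall q \near (x, l), forall j, q.2 = band V E j x -> q.2 = l.
  by exact: (@cvg_snd _ _ (nbhs x) (nbhs l) (nbhs_filter x) _ (band_isolated x l)).
apply: filterS2 N1 N2 => -[y l'] /= N1 N2 eq.
have yx := N1 (extremum_corner eq); rewrite {}yx in eq *.
by case: eq => _ [j [/= lj _]]; rewrite (N2 j lj).
Qed.

End Extrema.

(** * Hessians of band functions *)

Section Differentiability.
Context {K : realFieldType} {U W : normedModType K}.

Lemma differentiable_near (f : U -> W) (x : U) (e : K) : differentiable f x -> 0 < e ->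
  \forall h \near 0, `|f (h + x) - f x - 'd f x h| <= e * `|h|.
Proof.
move=> /diff_locally /eqaddoP fx e0; have := fx e e0.
apply: filterS => h; rewrite /= => fh; apply: le_trans fh.
by rewrite [X in `|X| <= _](_ : _ = f (h + x) - (f x + 'd f x h)) // opprD addrA.
Qed.

Lemma differentiable_of_near (f df : U -> W) (x : U) (M : K) : linear df ->
  (forall h, `|df h| <= M * `|h|) ->
  (forall e, 0 < e -> \forall h \near 0, `|f (h + x) - f x - df h| <= e * `|h|) ->
  differentiable f x /\ 'd f x = df :> (U -> W).
Proof.
move=> lin dfc fx; pose dfM := GRing.isLinear.Build _ _ _ _ _ lin.
pose dfL : {linear U -> W} := HB.pack df dfM.
have dfLc : continuous dfL.
  apply/linear_bounded_continuous/linear_boundedP; near=> r => h.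
  by apply: le_trans (dfc h) _; rewrite ler_wpM2r.
have E : f \o shift x = cst (f x) + dfL +o_ 0 id.
  apply/eqaddoP => e e0; have := fx e e0.
  apply: filterS => h fh; apply: le_trans fh.
  by rewrite [X in `|X| <= _](_ : _ = f (h + x) - (f x + df h)) // opprD addrA.
have dE := diff_unique dfLc E.
split; last exact: dE.
by apply/diff_locallyP; rewrite dE; split.
Unshelve. all: by end_near. Qed.

Lemma near_eq_differentiable (f g : U -> W) (x : U) : {near x, f =1 g} ->
  differentiable f x -> differentiable g x.
Proof.
move=> fg df; have fgx := nbhs_singleton fg.
have [M _ dM] := linear_lipschitz (diff_continuous df).
apply: (proj1 (@differentiable_of_near g ('d f x) x M _ dM _)).
- by move=> k u v; rewrite linearP.
- move=> e e0; have fg0 : \forall h \near 0, f (h + x) = g (h + x).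
    by have := fg; rewrite (near_shift 0 x); apply: filterS => h; rewrite /= subr0.
  apply: filterS2 fg0 (differentiable_near df e0) => h.
  by rewrite fgx => ->.
Qed.

End Differentiability.

(** * Differentiating a continuous solution of an implicit equation *)

Section ImplicitFunction.
Context {K : realFieldType} {U : normedModType K}.
Variables (F : U * K -> K) (g : U -> K) (s : U).
Let p : U * K := (s, g s).
Hypothesis F_diff : differentiable F p.
Hypothesis F_lam : 'D_(0, 1) F p != 0.
Hypothesis g_cont : {for s, continuous g}.
Hypothesis F_zero : forall u, F (u, g u) = 0.

Let L := 'd F p.
Let c := L (0, 1).
Let dg (h : U) := - c^-1 * L (h, 0).

Let c0 : c != 0.
Proof. by rewrite /c /L -deriveE. Qed.

Let LE h k : L (h, k) = L (h, 0) + k * c.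
Proof.
rewrite /c -[k * L (0, 1)]/(k *: L (0, 1)) -linearZ -linearD /=; congr (L (_, _)).
  by rewrite /= scaler0 addr0.
by rewrite /= add0r [k *: 1]mulr1.
Qed.

Let norm_pair (h : U) (k : K) : `|(h, k)| = Num.max `|h| `|k|.
Proof. by []. Qed.

(** With [k] the increment of [g], the expansion of [F] at [p] bounds [L (h, k)] by a small multiple
    of [|h| + |k|]. As [L (h, k) = L (h, 0) + k c] with [c != 0], this first yields [|k| <= N |h|],
    then the differential, because [k - dg h = c^-1 L (h, k)]. *)
Lemma implicit_differentiable : differentiable g s /\ 'd g s = dg :> (U -> K).
Proof.
have [M M0 LM] := linear_lipschitz (diff_continuous F_diff).
have LM0 h : `|L (h, 0)| <= M * `|h|.
  by have := LM (h, 0); rewrite norm_pair normr0 max_l.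
have nc : 0 < `|c| by rewrite normr_gt0.
apply: (@differentiable_of_near _ _ _ g dg s (`|c|^-1 * M)).
- move=> k u v; have E : L (k *: u + v, 0) = k * L (u, 0) + L (v, 0).
    rewrite -[k * _]/(k *: L (u, 0)) -linearP /=; congr (L (_, _)).
    by rewrite /= scaler0 addr0.
  by rewrite /dg E mulrDr mulrCA.
- by move=> h; rewrite /dg normrM normrN normfV -mulrA ler_wpM2l ?invr_ge0.
(* The bound [e' <= |c| / 2] absorbs the term in [|k|] into the left side, leaving
   [|k| |c| <= (2 M + |c|) |h|], that is [|k| <= N |h|]. The bound [e' (1 + N) <= e |c|] gives the
   final estimate. *)
move=> e e0; pose N := 2 * M / `|c| + 1.
have N0 : 0 < N by rewrite ltr_pwDr // !mulr_ge0 ?invr_ge0 // ltW.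
pose e' := Num.min (`|c| / 2) (e * `|c| / (1 + N)).
have N1 : 0 < 1 + N by rewrite addr_gt0.
have e'0 : 0 < e'.
  by rewrite lt_min; apply/andP; split; apply: divr_gt0 => //; apply: mulr_gt0.
have e'1 : e' <= `|c| / 2 by rewrite ge_min lexx.
have e'2 : e' * (1 + N) <= e * `|c|.
  by rewrite -ler_pdivlMr // ge_min lexx orbT.
pose k (h : U) := g (h + s) - g s.
have gs : (g \o shift s) @ (0 : U) --> g s by rewrite cvg_comp_shift add0r; exact: g_cont.
have kc0 : k h @[h --> (0 : U)] --> (0 : K).
  by rewrite -(subrr (g s)); exact: (cvgB gs (cvg_cst (g s))).
have kc : (h, k h) @[h --> (0 : U)] --> ((0, 0) : U * K).
  exact: (cvg_pair cvg_id kc0).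
have : \forall h \near (0 : U), `|L (h, k h)| <= e' * `|(h, k h)|.
  apply: (@filterS _ (nbhs (0 : U)) _ _ _ _ (kc _ (differentiable_near F_diff e'0))).
  move=> h /=; rewrite -[(h, k h) + p]/(h + s, k h + g s) subrK !F_zero subr0.
  by rewrite sub0r normrN.
apply: filterS => h Lh; rewrite -[g (h + s) - g s]/(k h).
have -> : k h - dg h = c^-1 * L (h, k h).
  by rewrite LE /dg mulNr opprK mulrDr addrC mulrCA mulVf // mulr1.
rewrite normrM normfV ler_pdivrMl //.
have {}Lh : `|L (h, k h)| <= e' * (`|h| + `|k h|).
  apply: le_trans Lh _; apply: ler_wpM2l; first exact: ltW.
  by rewrite norm_pair ge_max lerDl lerDr !normr_ge0.
have kN : `|k h| <= N * `|h|.
  have k1 : `|k h| * `|c| <= M * `|h| + e' * (`|h| + `|k h|).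
    rewrite -normrM (_ : k h * c = - L (h, 0) + L (h, k h)); last by rewrite [L (h, k h)]LE addKr.
    by apply: le_trans (ler_normD _ _) _; rewrite normrN lerD.
  have k2 : e' * (`|h| + `|k h|) <= `|c| / 2 * (`|h| + `|k h|).
    by rewrite ler_wpM2r // addr_ge0.
  have k3 : `|k h| * `|c| <= (2 * M + `|c|) * `|h|.
    have := le_trans k1 (lerD (lexx _) k2); lra.
  rewrite -(ler_pM2r nc); apply: le_trans k3 _.
  by rewrite mulrAC [N * _]mulrDl mul1r divfK ?normr_eq0.
apply: le_trans Lh _; apply: (@le_trans _ _ (e' * ((1 + N) * `|h|))).
  by apply: ler_wpM2l; [exact: ltW|rewrite mulrDl mul1r lerD2l].
by rewrite mulrA [`|c| * _]mulrA; apply: ler_wpM2r => //; rewrite [`|c| * e]mulrC.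
Qed.

Lemma implicit_derive v : 'D_v g s = - ('D_(v, 0) F p / 'D_(0, 1) F p).
Proof.
have [gd ge] := implicit_differentiable.
by rewrite !deriveE // ge /dg mulNr mulrC.
Qed.

End ImplicitFunction.

Section TwiceDifferentiable.
Context {R : realType} {U : normedModType R}.
Implicit Types f g l : U -> R.

(** Closed under sums and products, it passes from the entries of a matrix to its determinant. *)
Definition twice_differentiable f : Prop :=
  (forall x, differentiable f x) /\ (forall v x, differentiable ('D_v f) x).

Lemma twice_differentiable_cst (c : R) : twice_differentiable (fun=> c).
Proof.
split=> [x|v x]; first exact: differentiable_cst.
rewrite (_ : 'D_v _ = cst 0); first exact: differentiable_cst.
by apply/funext => y; exact: derive_cst.
Qed.

Lemma twice_differentiableD f g : twice_differentiable f -> twice_differentiable g ->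
  twice_differentiable (fun u => f u + g u).
Proof.
move=> [f1 f2] [g1 g2]; split=> [x|v x]; first exact: differentiableD.
rewrite (_ : 'D_v _ = 'D_v f + 'D_v g); first exact: differentiableD.
by apply/funext => y; apply: deriveD; exact: diff_derivable.
Qed.

Lemma twice_differentiableM f g : twice_differentiable f -> twice_differentiable g ->
  twice_differentiable (fun u => f u * g u).
Proof.
move=> [f1 f2] [g1 g2]; split=> [x|v x]; first exact: differentiableM.
rewrite (_ : 'D_v _ = f * 'D_v g + g * 'D_v f).
  by apply: differentiableD; exact: differentiableM.
by apply/funext => y; apply: deriveM; exact: diff_derivable.
Qed.

Lemma twice_differentiable_sum (I : Type) (s : seq I) (P : pred I) (f : I -> U -> R) :
  (forall i, twice_differentiable (f i)) -> twice_differentiable (fun u => \sum_(i <- s | P i) f i u).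
Proof.
move=> fi; elim: s => [|i s IH].
  rewrite (_ : (fun u => _) = fun=> 0); first exact: twice_differentiable_cst.
  by apply/funext => u; rewrite big_nil.
rewrite (_ : (fun u => _) = fun u => if P i then f i u + \sum_(j <- s | P j) f j u
  else \sum_(j <- s | P j) f j u); last by apply/funext => u; rewrite big_cons.
by case: (P i) => //; exact: twice_differentiableD.
Qed.

Lemma twice_differentiable_prod (I : Type) (s : seq I) (P : pred I) (f : I -> U -> R) :
  (forall i, twice_differentiable (f i)) -> twice_differentiable (fun u => \prod_(i <- s | P i) f i u).
Proof.
move=> fi; elim: s => [|i s IH].
  rewrite (_ : (fun u => _) = fun=> 1); first exact: twice_differentiable_cst.
  by apply/funext => u; rewrite big_nil.
rewrite (_ : (fun u => _) = fun u => if P i then f i u * \prod_(j <- s | P j) f j u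
  else \prod_(j <- s | P j) f j u); last by apply/funext => u; rewrite big_cons.
by case: (P i) => //; exact: twice_differentiableM.
Qed.

Lemma twice_differentiable_det n (M : U -> 'M[R]_n) :
  (forall i j, twice_differentiable (fun u => M u i j)) ->
  twice_differentiable (fun u => \det (M u)).
Proof.
move=> Mij; apply: twice_differentiable_sum => s.
by apply: twice_differentiableM; [exact: twice_differentiable_cst|exact: twice_differentiable_prod].
Qed.

Lemma derive_linear l (x v : U) : linear l -> 'D_v l x = l v.
Proof.
move=> lin; apply: (derive_quotientE (q := fun=> l v)); last exact: cvg_cst.
have h0 : \forall h \near (0 : R)^', h != 0 by exact: nbhs_dnbhs_neq.
by apply: filterS h0 => h h0; rewrite lin addrK scalerA mulVf // scale1r.
Qed.

Lemma twice_differentiable_linear l : linear l -> (forall x, differentiable l x) ->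
  twice_differentiable l.
Proof.
move=> lin dl; split=> // v x; rewrite (_ : 'D_v _ = cst (l v)); first exact: differentiable_cst.
by apply/funext => y; exact: derive_linear.
Qed.

Lemma derive_cos_linear l (x v : U) : linear l -> (forall x, differentiable l x) ->
  'D_v (cos \o l) x = - sin (l x) * l v.
Proof.
move=> lin dl; have dc : differentiable (@cos R) (l x).
  by apply/derivable1_diffP; exact: ex_derive.
rewrite deriveE; last exact: differentiable_comp.
rewrite diff_comp // /= diff1E // derive1E derive_val -deriveE // derive_linear //.
by rewrite mulrC.
Qed.

Lemma twice_differentiable_cos_linear l : linear l -> (forall x, differentiable l x) ->
  twice_differentiable (fun u => cos (l u)).
Proof.
move=> lin dl; split=> [x|v x].
  by apply: differentiable_comp => //; apply/derivable1_diffP; exact: ex_derive.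
rewrite (_ : 'D_v _ = (- (sin \o l)) * cst (l v)); last first.
  by apply/funext => y; rewrite (derive_cos_linear _ _ lin dl).
apply: differentiableM; last exact: differentiable_cst.
apply: differentiableN; apply: differentiable_comp => //.
by apply/derivable1_diffP; exact: ex_derive.
Qed.

End TwiceDifferentiable.

(** * The Hessian of a band at a corner point *)

Section BandHessian.
Context {R : realType} {d a m b : nat} {A : sgraph a} {B : sgraph b} {f : 'I_d -> 'I_m}.
Variables (V : potential R (isthmus_connected A B f)).
Variables (E : edge_weight R (isthmus_connected A B f)).
Local Notation C := (Cplx R).
Local Notation n := (a + m + b)%N.
Local Notation loop_vertex k := (@loop_vertex d a m b f k).
Local Notation floquet_real := (floquet_real V E).
Implicit Types (s t : 'rV[R]_d).

Definition cos_row s : 'rV[R]_d := \row_k cos (s 0 k).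

(** The dispersion polynomial in angles and over the reals, so that the band solves an implicit
    equation between real normed spaces. *)
Definition angular_dispersion (p : 'rV[R]_d * R) : R :=
  \det (floquet_real (cos_row p.1) - p.2%:M).

Definition angular_cominor k (p : 'rV[R]_d * R) : R :=
  principal_minor (floquet_real (cos_row p.1) - p.2%:M) (~: [set loop_vertex k])%SET.

Local Notation F := angular_dispersion.

Lemma torus_point_torus s : torus (torus_point s).
Proof. by move=> k; apply/eqP; rewrite norm1_Re_Im mxE /= cos2Dsin2. Qed.

Lemma floquet_torus_point s :
  floquet V E (torus_point s) = map_mx (toC R) (floquet_real (cos_row s)).
Proof.
rewrite floquet_torus; last exact: torus_point_torus.
by congr (map_mx _ (floquet_real _)); apply/rowP => k; rewrite !mxE.
Qed.

Lemma angular_bandE j s :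
  angular_band V E j s = ranked_eig (map_mx (toC R) (floquet_real (cos_row s))) j.
Proof. by rewrite /angular_band bandE floquet_torus_point. Qed.

Lemma angular_dispersion_band (j : 'I_n) s : F (s, angular_band V E j s) = 0.
Proof.
rewrite /F /= det_sym_sub ?floquet_real_sym // angular_bandE.
have [i ->] := ranked_eig_mem (map_mx (toC R) (floquet_real (cos_row s))) j.
by rewrite (bigD1 i) //= subrr mul0r.
Qed.

Lemma toC_angular_cominor k s lam :
  toC R (angular_cominor k (s, lam)) = cominor V E k (torus_point s, toC R lam).
Proof.
rewrite /angular_cominor -map_principal_minor map_mxB map_scalar_mx.
by rewrite /cominor bloch.unlock /= floquet_torus_point.
Qed.

Lemma linear_coord k : linear (fun s : 'rV[R]_d => s 0 k).
Proof. by move=> c u v; rewrite !mxE. Qed.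

Lemma linear_coord_fst k : linear (fun p : 'rV[R]_d * R => p.1 0 k).
Proof. by move=> c u v /=; rewrite !mxE. Qed.

Lemma differentiable_coord_fst k p : differentiable (fun p : 'rV[R]_d * R => p.1 0 k) p.
Proof.
apply: (@differentiable_comp _ _ _ _ fst (fun s : 'rV[R]_d => s 0 k)).
  exact: (@linear_differentiable _ _ _ fst _ (fun=> cvg_fst)).
exact: differentiable_coord.
Qed.

Lemma twice_differentiable_entry i j :
  twice_differentiable (fun p : 'rV[R]_d * R => (floquet_real (cos_row p.1) - p.2%:M) i j).
Proof.
rewrite (_ : (fun p => _) = fun p : 'rV[R]_d * R => (edge_coef E i j + (i == j)%:R *
  (V (0, i) + \sum_(k | loop_vertex k == i) loop_coef E k * (2 * cos (p.1 0 k)))) +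
  (- (i == j)%:R) * p.2); last first.
  apply/funext => p; rewrite !mxE mulNr !mulr_natl; congr (_ + (_ + _) *+ _ - _).
  by apply: eq_bigr => k _; rewrite mxE.
apply: twice_differentiableD; last first.
  apply: twice_differentiableM; first exact: twice_differentiable_cst.
  apply: twice_differentiable_linear => [c u v //|x].
  exact: (@linear_differentiable _ _ _ snd _ (fun=> cvg_snd)).
apply: twice_differentiableD; first exact: twice_differentiable_cst.
apply: twice_differentiableM; first exact: twice_differentiable_cst.
apply: twice_differentiableD; first exact: twice_differentiable_cst.
apply: twice_differentiable_sum => k.
apply: twice_differentiableM; first exact: twice_differentiable_cst.
apply: twice_differentiableM; first exact: twice_differentiable_cst.
apply: twice_differentiable_cos_linear; first exact: linear_coord_fst.
exact: differentiable_coord_fst.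
Qed.

Lemma twice_differentiable_dispersion : twice_differentiable F.
Proof. by apply: twice_differentiable_det => i j; exact: twice_differentiable_entry. Qed.

Lemma twice_differentiable_cominor k : twice_differentiable (angular_cominor k).
Proof.
apply: twice_differentiable_det => i j.
rewrite (_ : (fun u => _) = fun p : 'rV[R]_d * R =>
  (floquet_real (cos_row p.1) - p.2%:M) (enum_val i) (enum_val j)).
  exact: twice_differentiable_entry.
by apply/funext => p; rewrite [LHS]mxE.
Qed.

(** Weyl's inequality bounds the variation of a band by the largest change of a diagonal entry, and
    only the diagonal depends on the angles. *)
Lemma angular_band_continuous (j : 'I_n) : continuous (angular_band V E j).
Proof.
move=> s; apply/(@cvgrPdist_le _ _ _ (nbhs s) (nbhs_filter s)) => e e0.
pose phi i (s : 'rV[R]_d) := \sum_(k | loop_vertex k == i) loop_coef E k * (2 * cos (s 0 k)).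
have phic i : {for s, continuous (phi i)}.
  apply: differentiable_continuous.
  apply: (proj1 (@twice_differentiable_sum _ _ _ _ _ _ _)) => k.
  apply: twice_differentiableM; first exact: twice_differentiable_cst.
  apply: twice_differentiableM; first exact: twice_differentiable_cst.
  apply: twice_differentiable_cos_linear; first exact: linear_coord.
  by move=> x; exact: differentiable_coord.
have : \forall s' \near s, forall i, `|phi i s - phi i s'| <= e.
  apply: (@filter_forall _ 'I_n (fun i s' => `|phi i s - phi i s'| <= e) (nbhs s)) => i.
  by have /cvgrPdist_le := phic i; apply.
apply: filterS => s' phis; rewrite !angular_bandE distrC (floquet_real_move _ _ (cos_row s)).
apply: ranked_eig_dist; first exact: floquet_real_sym.
move=> i; have := phis i; rewrite distrC mxE -sumrB; congr (`|_| <= _).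
by apply: eq_bigr => k _; rewrite !mxE; ring.
Qed.

Lemma derive_angular_dispersion k s lam :
  'D_(delta_mx 0 k, 0) F (s, lam) =
  - (2 * loop_coef E k * sin (s 0 k)) * angular_cominor k (s, lam).
Proof.
pose q h := 2 * loop_coef E k * (h^-1 * (cos (h + s 0 k) - cos (s 0 k))) *
  angular_cominor k (s, lam).
apply: (derive_quotientE (q := q)).
  apply: nearW => h; rewrite /F.
  have -> : h *: (delta_mx 0 k, 0) + (s, lam) = (h *: delta_mx 0 k + s, lam) :> 'rV[R]_d * R.
    by congr (_, _); rewrite /= scaler0 add0r.
  have -> : floquet_real (cos_row (h *: delta_mx 0 k + s, lam).1) - (h *: delta_mx 0 k + s, lam).2%:M =
    (floquet_real (cos_row s) - lam%:M) + (loop_coef E k * (2 * (cos (h + s 0 k) - cos (s 0 k)))) *: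
      delta_mx (loop_vertex k) (loop_vertex k).
    rewrite /= [X in X - _](floquet_real_move _ _ (cos_row s)) addrAC; congr (_ + _).
    apply/matrixP => i j; rewrite !mxE; case: (eqVneq i j) => [<-|ij]; last first.
      have -> : (i == loop_vertex k) && (j == loop_vertex k) = false.
        by apply/negP => /andP[/eqP ik /eqP jk]; rewrite ik jk eqxx in ij.
      by rewrite mulr0n mulr0.
    rewrite mulr1n andbb eq_sym.
    have z l : l != k -> loop_coef E l * (2 * (cos_row (h *: delta_mx 0 k + s) 0 l - cos_row s 0 l)) = 0.
      by move=> /negPf lk; rewrite !mxE lk !andbF mulr0 add0r subrr !mulr0.
    have [ik|ik] := eqVneq (loop_vertex k) i.
      rewrite (bigD1 k) /= ?ik // big1 ?addr0; last by move=> l /andP[_ /z].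
      by rewrite !mxE !eqxx /= mulr1 mulr1.
    rewrite big1 ?mulr0 // => l /eqP li; apply: z; apply: contra_neq ik => <-.
    exact: li.
  rewrite det_add_diag [X in X - _]addrC addrK /q.
  by rewrite [LHS]/GRing.scale /= /angular_cominor /=; ring.
rewrite /q -[- (_ * sin _)]mulrN.
have dc : h^-1 * (cos (h + s 0 k) - cos (s 0 k)) @[h --> 0^'] --> - sin (s 0 k).
  have dcos : derivable (@cos R) (s 0 k) 1 by exact: ex_derive.
  have : h^-1 *: ((cos \o shift (s 0 k)) (h *: 1) - cos (s 0 k)) @[h --> 0^'] --> 'D_1 (@cos R) (s 0 k).
    exact: dcos.
  rewrite derive_val; apply: cvg_trans; apply: near_eq_cvg; apply: nearW => h /=.
  by rewrite [h *: 1]mulr1.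
exact: (cvgM (cvgM (cvg_cst _) dc) (cvg_cst _)).
Qed.

Hypothesis VE_generic : isthmus_generic V E.
Hypothesis d_gt0 : (0 < d)%N.
Variables (j : 'I_n) (t : 'rV[R]_d).
Hypothesis t_corner : corner (torus_point t).
Local Notation g := (angular_band V E j).

Lemma angular_cominor_neq0 k : angular_cominor k (t, g t) != 0.
Proof.
rewrite -(fmorph_eq0 (toC R)) toC_angular_cominor.
apply: corner_cominor_neq0 => //; exact: (band_eigenvalue V E j (torus_point_torus t)).
Qed.

Lemma sin_corner k : sin (t 0 k) = 0.
Proof.
have := t_corner k; rewrite mxE => -[] /(congr1 (@complex.Im R)) /= -> //.
exact: oppr0.
Qed.

Lemma cos_corner_neq0 k : cos (t 0 k) != 0.
Proof.
have /eqP := cos2Dsin2 (t 0 k); rewrite sin_corner expr0n addr0.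
by apply: contraTneq => ->; rewrite expr0n eq_sym oner_neq0.
Qed.

Lemma derive_angular_dispersion_lam : 'D_(0, 1) F (t, g t) != 0.
Proof.
set H := map_mx (toC R) (floquet_real (cos_row t)).
have FE lam : F (t, lam) = \prod_i (eigs H i - lam).
  by rewrite /F det_sym_sub ?floquet_real_sym.
have F0 := angular_dispersion_band j t.
have [i0 gi0] : exists i0, g t = eigs H i0 by rewrite angular_bandE; exact: ranked_eig_mem.
have Huniq i : eigs H i = g t -> i = i0.
  move=> gi; have tt := torus_point_torus t.
  have c0 : cominor V E (Ordinal d_gt0) (torus_point t, toC R (g t)) != 0.
    by rewrite -toC_angular_cominor fmorph_eq0 angular_cominor_neq0.
  have hH : H \is hermsymmx by exact: hermitian_map (floquet_real_sym _ _ _).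
  by apply: (torus_simple tt c0); rewrite floquet_torus_point eigsE // ?gi // -gi0.
have -> : 'D_(0, 1) F (t, g t) = - \prod_(i | i != i0) (eigs H i - g t).
  apply: (derive_quotientE (q := fun h => - \prod_(i | i != i0) (eigs H i - (g t + h)))).
    have hn0 : \forall h \near (0 : R)^', h != 0 by exact: nbhs_dnbhs_neq.
    apply: filterS hn0 => h h0.
    have -> : h *: (0, 1) + (t, g t) = (t, g t + h) :> 'rV[R]_d * R.
      by congr (_, _); rewrite /= ?scaler0 ?add0r // [_ *: _]mulr1 addrC.
    rewrite F0 subr0 FE (bigD1 i0) //= {1}gi0 opprD addrA subrr add0r.
    by rewrite [LHS]/GRing.scale /= mulNr mulrN mulKf.
  apply: (cvgN (@cvg_bigprod _ _ _ _ _ _ _ (fun i h => eigs H i - (g t + h)) _ _)) => i.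
  exact: (cvgB (cvg_cst _) (@cvg_addr_dnbhs0 _ (g t))).
rewrite oppr_eq0; apply/prodf_neq0 => i ni; rewrite subr_eq0; apply: contra ni => /eqP gi.
by rewrite (Huniq i gi).
Qed.

Let F_lam s := 'D_(0, 1) F (s, g s).
Let slope k s := 2 * loop_coef E k * angular_cominor k (s, g s) / F_lam s.

(** The formula has to hold on a neighbourhood, as it is differentiated once more. Continuity of the
    band spreads [F_lam != 0] from [t] to nearby points, where the implicit function theorem applies
    again. *)
Lemma near_band_derive : \forall s \near t, [/\ differentiable g s, F_lam s != 0 &
  forall k, 'D_(delta_mx 0 k) g s = sin (s 0 k) * slope k s].
Proof.
have Fl_cont : {for t, continuous F_lam}.
  have c1 : (s, g s) @[s --> t] --> (t, g t).
    exact: (cvg_pair cvg_id (@angular_band_continuous j t)).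
  have := differentiable_continuous (twice_differentiable_dispersion.2 (0, 1) (t, g t)).
  exact: (@continuous_comp _ _ _ (fun s => (s, g s)) ('D_(0, 1) F) t c1).
have Fl_near : \forall s \near t, F_lam s != 0.
  exact: (cvgr_neq0 _ Fl_cont derive_angular_dispersion_lam).
apply: filterS Fl_near => s Fs.
have Fd := twice_differentiable_dispersion.1 (s, g s).
have gc := @angular_band_continuous j s.
have gz := angular_dispersion_band j.
split=> //; first by have [] := implicit_differentiable Fd Fs gc gz.
move=> k; rewrite (implicit_derive Fd Fs gc gz) derive_angular_dispersion /slope.
rewrite -/(F_lam s) !mulNr opprK [RHS]mulrA; congr (_ / _); ring.
Qed.

Lemma differentiable_band : differentiable g t.
Proof. by case: (nbhs_singleton near_band_derive). Qed.

(** [slope] involves the band itself but none of its derivatives, so that one derivative of the band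
    already provides the second. *)
Lemma differentiable_slope k : differentiable (slope k) t.
Proof.
have dp : differentiable (fun s => (s, g s)) t.
  by apply: differentiable_pair => //; exact: differentiable_band.
apply: differentiableM.
  apply: differentiableM; first exact: differentiable_cst.
  apply: (differentiable_comp (g := angular_cominor k)) => //.
  exact: (twice_differentiable_cominor k).1.
apply: differentiableV; last exact: derive_angular_dispersion_lam.
apply: (differentiable_comp (g := 'D_(0, 1) F)) => //.
exact: twice_differentiable_dispersion.2.
Qed.

Lemma differentiable_sin_coord k s : differentiable (fun s : 'rV[R]_d => sin (s 0 k)) s.
Proof.
apply: (@differentiable_comp _ _ _ _ (fun s : 'rV[R]_d => s 0 k) (@sin R)).
  exact: differentiable_coord.
by apply/derivable1_diffP; exact: ex_derive.
Qed.

Lemma derive_sin_coord k l s : 'D_(delta_mx 0 l) (fun s : 'rV[R]_d => sin (s 0 k)) s =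
  cos (s 0 k) *+ (k == l).
Proof.
have dc := @differentiable_coord R 1 d s 0 k.
have ds : differentiable (@sin R) (s 0 k) by apply/derivable1_diffP; exact: ex_derive.
rewrite deriveE; last exact: differentiable_sin_coord.
rewrite (diff_comp dc ds) /= diff1E // derive1E derive_val -deriveE //.
rewrite derive_linear; last exact: linear_coord.
by rewrite mxE eqxx /= [_ *: _]mulrC mulr_natr.
Qed.

Lemma band_gradient k : {near t, 'D_(delta_mx 0 k) g =1 (fun s => sin (s 0 k) * slope k s)}.
Proof. by apply: filterS near_band_derive => s []. Qed.

Lemma nondegenerate_angular_band :
  [/\ \forall s \near t, differentiable g s,
      forall k, differentiable ('D_(delta_mx 0 k) g) t &
      (\matrix_(k, l) 'D_(delta_mx 0 l) ('D_(delta_mx 0 k) g) t : 'M[R]_d) \in unitmx].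
Proof.
have [En _] := VE_generic.
have ds k := @differentiable_sin_coord k t.
have prod_diff k : differentiable (fun s : 'rV[R]_d => sin (s 0 k) * slope k s) t.
  by apply: differentiableM; [exact: ds|exact: differentiable_slope].
split=> [|k|].
- by apply: filterS near_band_derive => s [].
- apply: near_eq_differentiable (prod_diff k).
  by apply: filterS (band_gradient k) => s ->.
(* Since [sin (t 0 k) = 0], the derivative of [slope] drops out of the product rule. *)
have hess k l : 'D_(delta_mx 0 l) ('D_(delta_mx 0 k) g) t = (slope k t * cos (t 0 k)) *+ (k == l).
  rewrite (near_eq_derive _ (band_gradient k)).
  transitivity (sin (t 0 k) *: 'D_(delta_mx 0 l) (slope k) t +
      slope k t *: 'D_(delta_mx 0 l) (fun s : 'rV[R]_d => sin (s 0 k)) t).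
    by apply: deriveM; apply: diff_derivable; [exact: ds|exact: differentiable_slope].
  by rewrite sin_corner scale0r add0r derive_sin_coord [_ *: _]mulrnAr.
have -> : (\matrix_(k, l) 'D_(delta_mx 0 l) ('D_(delta_mx 0 k) g) t : 'M[R]_d) =
    diag_mx (\row_k (slope k t * cos (t 0 k))).
  by apply/matrixP => k l; rewrite [LHS]mxE hess !mxE.
rewrite unitmxE det_diag unitfE; apply/prodf_neq0 => k _; rewrite mxE.
rewrite !mulf_neq0 ?invr_neq0 ?cos_corner_neq0 ?loop_coef_neq0 ?angular_cominor_neq0 //.
exact: derive_angular_dispersion_lam.
Qed.

End BandHessian.

Theorem generic_spectral_edges_regular (R : realType) (d a m b : nat) (A : sgraph a) (B : sgraph b)
    (f : 'I_d -> 'I_m) (V : potential R (isthmus_connected A B f))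
    (E : edge_weight R (isthmus_connected A B f)) :
  (0 < d)%N -> isthmus_generic V E -> spectral_edges_regular V E.
Proof.
move=> d0 gVE p ep; have cp := extremum_corner gVE ep; split.
- exact: extremum_isolated.
- move=> j _ _ t tp; apply: nondegenerate_angular_band => //.
  by rewrite tp.
- have [_ [j [pj _]]] := ep; exists j; split=> // k pk.
  by apply: (band_corner_inj gVE d0 cp); rewrite -pj.
Qed.

(** * Genericity is a nonempty Zariski open condition *)

Section PolynomialFunctions.
Context {R : idomainType} {X : Type} {J : finType} (co : J -> X -> R).
Implicit Types h : X -> R.

Definition polynomial_fun h : Prop :=
  exists G : mpoly #|J| R, forall x, h x = meval (fun k => co (enum_val k) x) G.

Lemma polynomial_fun_cst (c : R) : polynomial_fun (fun=> c).
Proof. by exists (mpolyC _ c) => x; rewrite mevalC. Qed.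

Lemma polynomial_fun_coord j : polynomial_fun (co j).
Proof.
by exists (mpolyX R (mnm1 (enum_rank j))) => x; rewrite mevalXU enum_rankK.
Qed.

Lemma polynomial_funD h1 h2 : polynomial_fun h1 -> polynomial_fun h2 ->
  polynomial_fun (fun x => h1 x + h2 x).
Proof.
by move=> [G1 e1] [G2 e2]; exists (G1 + G2) => x; rewrite mevalD e1 e2.
Qed.

Lemma polynomial_funM h1 h2 : polynomial_fun h1 -> polynomial_fun h2 ->
  polynomial_fun (fun x => h1 x * h2 x).
Proof.
by move=> [G1 e1] [G2 e2]; exists (G1 * G2) => x; rewrite mevalM e1 e2.
Qed.

Lemma eq_polynomial_fun h1 h2 : h1 =1 h2 -> polynomial_fun h1 -> polynomial_fun h2.
Proof. by move=> e [G eG]; exists G => x; rewrite -e. Qed.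

Lemma polynomial_funMn h k : polynomial_fun h -> polynomial_fun (fun x => h x *+ k).
Proof.
move=> hP; apply: (@eq_polynomial_fun (fun x => k%:R * h x)).
  by move=> x; rewrite mulr_natl.
by apply: polynomial_funM => //; exact: polynomial_fun_cst.
Qed.

Lemma polynomial_funB h1 h2 : polynomial_fun h1 -> polynomial_fun h2 ->
  polynomial_fun (fun x => h1 x - h2 x).
Proof.
move=> P1 P2; apply: (@eq_polynomial_fun (fun x => h1 x + (-1) * h2 x)).
  by move=> x; rewrite mulN1r.
by apply: polynomial_funD => //; apply: polynomial_funM => //; exact: polynomial_fun_cst.
Qed.

Lemma polynomial_fun_sum (I : Type) (s : seq I) (P : pred I) (h : I -> X -> R) :
  (forall i, polynomial_fun (h i)) -> polynomial_fun (fun x => \sum_(i <- s | P i) h i x).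
Proof.
move=> hi; elim: s => [|i s IH].
  by apply: eq_polynomial_fun (polynomial_fun_cst 0) => x; rewrite big_nil.
apply: (@eq_polynomial_fun (fun x => if P i then h i x + \sum_(j <- s | P j) h j x
  else \sum_(j <- s | P j) h j x)); first by move=> x; rewrite big_cons.
by case: (P i) => //; exact: polynomial_funD.
Qed.

Lemma polynomial_fun_prod (I : Type) (s : seq I) (P : pred I) (h : I -> X -> R) :
  (forall i, polynomial_fun (h i)) -> polynomial_fun (fun x => \prod_(i <- s | P i) h i x).
Proof.
move=> hi; elim: s => [|i s IH].
  by apply: eq_polynomial_fun (polynomial_fun_cst 1) => x; rewrite big_nil.
apply: (@eq_polynomial_fun (fun x => if P i then h i x * \prod_(j <- s | P j) h j x
  else \prod_(j <- s | P j) h j x)); first by move=> x; rewrite big_cons.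
by case: (P i) => //; exact: polynomial_funM.
Qed.

Lemma polynomial_fun_det n (M : X -> 'M[R]_n) :
  (forall i j, polynomial_fun (fun x => M x i j)) -> polynomial_fun (fun x => \det (M x)).
Proof.
move=> Mij; apply: polynomial_fun_sum => s.
by apply: polynomial_funM; [exact: polynomial_fun_cst|exact: polynomial_fun_prod].
Qed.

Definition polynomial_coefs (q : X -> {poly R}) : Prop :=
  forall k, polynomial_fun (fun x => (q x)`_k).

Lemma polynomial_coefs_cst (q : {poly R}) : polynomial_coefs (fun=> q).
Proof. by move=> k; exact: polynomial_fun_cst. Qed.

Lemma eq_polynomial_coefs q1 q2 : q1 =1 q2 -> polynomial_coefs q1 -> polynomial_coefs q2.
Proof. by move=> e P1 k; apply: eq_polynomial_fun (P1 k) => x; rewrite e. Qed.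

Lemma polynomial_coefsM q1 q2 : polynomial_coefs q1 -> polynomial_coefs q2 ->
  polynomial_coefs (fun x => q1 x * q2 x).
Proof.
move=> P1 P2 k; apply: (@eq_polynomial_fun (fun x => \sum_(i < k.+1) (q1 x)`_i * (q2 x)`_(k - i))).
  by move=> x; rewrite coefM.
by apply: polynomial_fun_sum => i; exact: polynomial_funM.
Qed.

Lemma polynomial_coefs_sum (I : Type) (s : seq I) (P : pred I) (q : I -> X -> {poly R}) :
  (forall i, polynomial_coefs (q i)) -> polynomial_coefs (fun x => \sum_(i <- s | P i) q i x).
Proof.
move=> qi k; apply: (@eq_polynomial_fun (fun x => \sum_(i <- s | P i) (q i x)`_k)).
  by move=> x; rewrite coef_sum.
by apply: polynomial_fun_sum => i; exact: qi.
Qed.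

Lemma polynomial_coefs_prod (I : Type) (s : seq I) (P : pred I) (q : I -> X -> {poly R}) :
  (forall i, polynomial_coefs (q i)) -> polynomial_coefs (fun x => \prod_(i <- s | P i) q i x).
Proof.
move=> qi; elim: s => [|i s IH].
  by apply: eq_polynomial_coefs (polynomial_coefs_cst 1) => x; rewrite big_nil.
apply: (@eq_polynomial_coefs (fun x => if P i then q i x * \prod_(j <- s | P j) q j x
  else \prod_(j <- s | P j) q j x)); first by move=> x; rewrite big_cons.
by case: (P i) => //; exact: polynomial_coefsM.
Qed.

Lemma polynomial_coefs_char_poly n (M : X -> 'M[R]_n) :
  (forall i j, polynomial_fun (fun x => M x i j)) ->
  polynomial_coefs (fun x => char_poly (M x)).
Proof.
move=> Mij; apply: polynomial_coefs_sum => s.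
apply: polynomial_coefsM; first exact: polynomial_coefs_cst.
apply: polynomial_coefs_prod => i k; move: (perm.fun_of_perm.body s i) => j.
apply: (@eq_polynomial_fun (fun x => (('X : {poly R}) *+ (i == j))`_k - (M x i j) *+ (k == 0%N))).
  by move=> x; rewrite !mxE coefB coefC; case: (k == 0%N); rewrite ?mulr1n ?mulr0n.
by apply: polynomial_funB; [exact: polynomial_fun_cst|exact: polynomial_funMn].
Qed.

(** With constant degrees the Sylvester matrix has a fixed format, and its entries are coefficients
    of the two polynomials or zero. *)
Lemma polynomial_fun_resultant (q1 q2 : X -> {poly R}) d1 d2 :
  (forall x, size (q1 x) = d1.+1) -> (forall x, size (q2 x) = d2.+1) ->
  polynomial_coefs q1 -> polynomial_coefs q2 ->
  polynomial_fun (fun x => resultant (q1 x) (q2 x)).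
Proof.
move=> s1 s2 P1 P2.
(* The dimensions are abstracted from the polynomials, since the type of [Sylvester_mx] depends on
   their sizes. *)
pose syl e1 e2 (u v : {poly R}) : 'M[R]_(e2 + e1) :=
  col_mx (lin1_mx (poly_rV \o u \o* rVpoly)) (lin1_mx (poly_rV \o v \o* rVpoly)).
apply: (@eq_polynomial_fun (fun x => \det (syl d1 d2 (q1 x) (q2 x)))).
  by move=> x; rewrite /resultant /Sylvester_mx -/(syl _ _ _ _) s1 s2.
apply: polynomial_fun_det => i j.
have E e (u : {poly R}) (k : 'I_e) : lin1_mx (poly_rV \o u \o* rVpoly) k j =
    if (j < k)%N then 0 else u`_(j - k).
  by rewrite !mxE /= rVpoly_delta coefXnM.
case: (split_ordP i) => k ->.
  apply: (@eq_polynomial_fun (fun x => if (j < k)%N then 0 else (q1 x)`_(j - k))).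
    by move=> x; rewrite /syl col_mxEu E.
  by case: (j < k)%N; [exact: polynomial_fun_cst|exact: P1].
apply: (@eq_polynomial_fun (fun x => if (j < k)%N then 0 else (q2 x)`_(j - k))).
  by move=> x; rewrite /syl col_mxEd E.
by case: (j < k)%N; [exact: polynomial_fun_cst|exact: P2].
Qed.

End PolynomialFunctions.

Section SubCharPoly.
Context {n : nat}.

Definition sub_char_poly (F : comNzRingType) (T : {set 'I_n}) (M : 'M[F]_n) : {poly F} :=
  char_poly (mxsub (fun i : 'I_#|T| => enum_val i) (fun i : 'I_#|T| => enum_val i) M).

Lemma size_sub_char_poly (F : comNzRingType) T (M : 'M[F]_n) : size (sub_char_poly T M) = #|T|.+1.
Proof. exact: size_char_poly. Qed.

Lemma map_sub_char_poly (F K : comNzRingType) (h : {rmorphism F -> K}) T (M : 'M[F]_n) :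
  map_poly h (sub_char_poly T M) = sub_char_poly T (map_mx h M).
Proof.
by rewrite /sub_char_poly map_char_poly; congr char_poly; apply/matrixP=> i j; rewrite !mxE.
Qed.

Lemma root_char_poly (F : fieldType) k (N : 'M[F]_k) lam :
  root (char_poly N) lam = (\det (N - lam%:M) == 0).
Proof.
rewrite -eigenvalue_root_char; apply/eigenvalueP/det0P => [[v vN v0]|[v v0 vN]].
  by exists v => //; rewrite mulmxBr vN mul_mx_scalar subrr.
by exists v => //; apply/eqP; rewrite -subr_eq0 -mul_mx_scalar -mulmxBr vN.
Qed.

Lemma root_sub_char_poly (F : fieldType) T (M : 'M[F]_n) lam :
  root (sub_char_poly T M) lam = (principal_minor (M - lam%:M) T == 0).
Proof.
rewrite root_char_poly /principal_minor; congr (\det _ == 0).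
by apply/matrixP=> i j; rewrite !mxE (inj_eq enum_val_inj).
Qed.

(** Coprimality is insensitive to field extension; hence a resultant with real coefficients controls
    complex common roots. *)
Lemma resultant_no_common_root (F : fieldType) (C : closedFieldType) (h : {rmorphism F -> C})
    (p q : {poly F}) : p != 0 ->
  reflect (forall lam, ~ (root (map_poly h p) lam /\ root (map_poly h q) lam))
    (resultant p q != 0).
Proof.
move=> p0; rewrite resultant_eq0 -leqNgt -[gcdp _ _]/(gcdp p q).
have g0 : gcdp p q != 0 by rewrite gcdp_eq0 negb_and p0.
have -> : (size (gcdp p q) <= 1)%N = coprimep (map_poly h p) (map_poly h q).
  rewrite coprimep_map /coprimep; apply/idP/eqP => [s1|->//].
  by apply/eqP; rewrite eqn_leq s1 lt0n size_poly_eq0.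
apply: (iffP idP) => [cpq lam [rp rq]|nr].
  by have := coprimep_root cpq rp; rewrite -[_.[_] == 0]/(root _ _) rq.
rewrite /coprimep; apply/negPn/negP => /closed_rootP[lam].
by rewrite root_gcd => /andP[rp rq]; exact: (nr lam).
Qed.

End SubCharPoly.

Section GenericPolynomial.
Context {R : realType} {d a m b : nat} {A : sgraph a} {B : sgraph b} {f : 'I_d -> 'I_m}.
Local Notation Gam := (isthmus_connected A B f).
Local Notation C := (Cplx R).
Local Notation n := (a + m + b)%N.
Local Notation loop_vertex k := (@loop_vertex d a m b f k).
Local Notation path_vertex r := (@isthmus_vertex a m b r).
Implicit Types (V : potential R Gam) (E : edge_weight R Gam) (T : {set 'I_n}).

Definition indices_below p : {set 'I_n} := [set i : 'I_n | (i < p)%N]%SET.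
Definition indices_from p : {set 'I_n} := [set i : 'I_n | (p <= i)%N]%SET.

Definition corner_row (sg : {ffun 'I_d -> bool}) : 'rV[R]_d := \row_k (-1) ^+ sg k.

Definition sub_resultant T1 T2 (S : 'M[R]_n) : R :=
  resultant (sub_char_poly T1 S) (sub_char_poly T2 S).

(* An eigenvector vanishing from a path vertex on vanishes on the whole path by
   propagation along it, so it lives on A and is zero at v_0; likewise for B.
   The first two factors exclude this. *)
Definition generic_resultants (S : 'M[R]_n) : R :=
  sub_resultant (indices_below a) (indices_below a.-1) S *
  sub_resultant (indices_from (a + m)) (indices_from (a + m).+1) S *
  \prod_(r : 'I_m) \prod_(s : 'I_m | (r <= s)%N)
    sub_resultant (indices_below (path_vertex r)) (indices_from (path_vertex s).+1) S.

(** One representative for each translation class of edges, and one sign vector for each of the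
    [2^d] corner points, make this a finite product. *)
Definition generic_poly V E : R :=
  (\prod_i \prod_j (if isthmus_adj A B i j then E (0, i) (0, j) else 1)) *
  (\prod_k loop_coef E k) *
  \prod_sg generic_resultants (floquet_real V E (corner_row sg)).

Lemma nonvanishing_base E : (forall i j, isthmus_adj A B i j -> E (0, i) (0, j) != 0) ->
  (forall k, loop_coef E k != 0) -> nonvanishing E.
Proof.
move=> Eadj Eloop [x i] [y j] /orP[/andP[/eqP /= <- ij]|/existsP[k /= /and3P[/eqP -> /eqP -> xy]]].
  have := wt_per E x (0, i) (0, j).
  by rewrite /= /translate /= !addr0 => ->; exact: Eadj.
case/orP: xy => /eqP ->.
  have := wt_per E x (0, loop_vertex k) (basis_vector k, loop_vertex k).
  by rewrite /= /translate /= addr0 => ->; exact: Eloop.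
rewrite wt_sym; have := wt_per E y (0, loop_vertex k) (basis_vector k, loop_vertex k).
by rewrite /= /translate /= addr0 => ->; exact: Eloop.
Qed.

Lemma floquet_corner V E (x : 'rV[C]_d) : corner x ->
  exists sg, floquet V E x = map_mx (toC R) (floquet_real V E (corner_row sg)).
Proof.
move=> cx; exists [ffun k => x 0 k == -1]; rewrite floquet_torus; last exact: corner_torus.
congr (map_mx _ (floquet_real _ _ _)); apply/rowP => k; rewrite !mxE ffunE.
have n11 : (1 : C) == -1 = false.
  by apply/negbTE; rewrite -addr_eq0 (_ : 1 + 1 = 2%:R) ?pnatr_eq0.
by case: (cx k) => ->; rewrite ?eqxx ?n11 // expr1.
Qed.

Lemma root_bloch_minor V E (x : 'rV[C]_d) lam S T : floquet V E x = map_mx (toC R) S ->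
  root (map_poly (toC R) (sub_char_poly T S)) lam =
  (principal_minor (bloch V E (x, lam)) T == 0).
Proof. by move=> xS; rewrite map_sub_char_poly root_sub_char_poly bloch.unlock -xS. Qed.

Lemma sub_resultant_neq0 T1 T2 (S : 'M[R]_n) :
  reflect (forall lam : C, ~ (root (map_poly (toC R) (sub_char_poly T1 S)) lam /\
     root (map_poly (toC R) (sub_char_poly T2 S)) lam)) (sub_resultant T1 T2 S != 0).
Proof.
apply: resultant_no_common_root.
by rewrite -size_poly_eq0 size_sub_char_poly.
Qed.

Lemma generic_poly_isthmus V E : generic_poly V E != 0 -> isthmus_generic V E.
Proof.
rewrite !mulf_eq0 !negb_or => /andP[/andP[/prodf_neq0 Eadj /prodf_neq0 Eloop] /prodf_neq0 Eres].
have En : nonvanishing E.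
  apply: nonvanishing_base => [i j ij|k]; last exact: Eloop.
  by have /prodf_neq0/(_ j isT) := Eadj i isT; rewrite ij.
split=> // x cx r s rs; have [sg xS] := floquet_corner V E cx.
have := Eres sg isT; set S := floquet_real V E _ in xS *.
rewrite !mulf_eq0 !negb_or.
move=> /andP[/andP[/sub_resultant_neq0 resA /sub_resultant_neq0 resB] resPQ].
have PQ (p q : 'I_m) lam : (p <= q)%N ->
    ~ (minor_below V E p (x, lam) = 0 /\ minor_above V E q (x, lam) = 0).
  move=> pq; rewrite minor_belowE minor_aboveE => -[/eqP P0 /eqP Q0].
  have /prodf_neq0/(_ p isT)/prodf_neq0/(_ q pq)/sub_resultant_neq0/(_ lam) := resPQ.
  by rewrite !(root_bloch_minor _ _ xS); case.
have m0 : (0 < m)%N by apply: leq_ltn_trans (ltn_ord r).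
have n0 : (a < n)%N by rewrite -addnA -{1}[a]addn0 ltn_add2l ltn_addr.
have n1 : ((a + m).-1 < n)%N by lia.
have pr q : path_index (path_vertex q) by exact: path_index_isthmus.
have chain lam := bloch_chain V (x, lam) En.
split=> [lam|lam [P0]|lam [Q0]]; first exact: PQ.
- rewrite dispersionE => D0.
  have Q0 : principal_minor (bloch V E (x, lam)) [set i : 'I_n | (path_vertex r < i)%N]%SET != 0.
    by rewrite -minor_aboveE; apply/eqP => Q0; exact: (PQ r r lam (leqnn _)).
  rewrite minor_belowE in P0.
  (* Propagation stops at [v_1], of index [a], and so gives zeros from index [a - 1] on: the vector
     lies in the kernels of both nested blocks of [A]. *)
  have pa : path_index (Ordinal n0) by rewrite /path_index /= leqnn -{1}[a]addn0 ltn_add2l.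
  have ar : (Ordinal n0 <= path_vertex r)%N by rewrite /= leq_addr.
  have [u [u0 uM us]] := chain_kernel_below (chain lam) (pr r) pa ar D0 Q0 P0.
  apply: (resA lam); rewrite !(root_bloch_minor _ _ xS).
  split; apply/principal_minor_eq0P; exists u; split=> [|i|i _]; first 1 [exact: u0];
    rewrite ?uM ?mxE // inE -leqNgt => ai; apply: us => /=.
    exact: leqW.
  by move: ai; rewrite -subn1 leq_subLR add1n.
- rewrite dispersionE => D0.
  have P0 : principal_minor (bloch V E (x, lam)) [set i : 'I_n | (i < path_vertex s)%N]%SET != 0.
    by rewrite -minor_belowE; apply/eqP => P0; exact: (PQ s s lam (leqnn _)).
  rewrite minor_aboveE in Q0.
  have pa : path_index (Ordinal n1) by rewrite /path_index /=; lia.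
  have ar : (path_vertex s <= Ordinal n1)%N by rewrite /=; have := ltn_ord s; lia.
  have [u [u0 uM us]] := chain_kernel_above (chain lam) (pr s) pa ar D0 P0 Q0.
  apply: (resB lam); rewrite !(root_bloch_minor _ _ xS).
  split; apply/principal_minor_eq0P; exists u; split=> [|i|i _]; first 1 [exact: u0];
    rewrite ?uM ?mxE // inE -ltnNge => ai; apply: us => /=; lia.
Qed.

Section Polynomiality.
Context {X : Type} {J : finType} (co : J -> X -> R).
Variables (VX : X -> potential R Gam) (EX : X -> edge_weight R Gam).
Hypothesis VX_poly : forall i, polynomial_fun co (fun x => VX x (0, i)).
Hypothesis EX_adj_poly : forall i j, isthmus_adj A B i j ->
  polynomial_fun co (fun x => EX x (0, i) (0, j)).
Hypothesis EX_loop_poly : forall k, polynomial_fun co (fun x => loop_coef (EX x) k).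

Lemma polynomial_fun_floquet_real y i j :
  polynomial_fun co (fun x => floquet_real (VX x) (EX x) y i j).
Proof.
apply: (@eq_polynomial_fun _ _ _ _ (fun x => edge_coef (EX x) i j + (VX x (0, i) +
  \sum_(k | loop_vertex k == i) loop_coef (EX x) k * (2 * y 0 k)) *+ (i == j))).
  by move=> x; rewrite [RHS]mxE.
apply: polynomial_funD.
  rewrite /edge_coef; case: (boolP (isthmus_adj A B i j)) => [ij|_]; first exact: EX_adj_poly.
  exact: polynomial_fun_cst.
apply: polynomial_funMn; apply: polynomial_funD; first exact: VX_poly.
apply: polynomial_fun_sum => k.
by apply: polynomial_funM; [exact: EX_loop_poly|exact: polynomial_fun_cst].
Qed.

Lemma polynomial_fun_sub_resultant T1 T2 y :
  polynomial_fun co (fun x => sub_resultant T1 T2 (floquet_real (VX x) (EX x) y)).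
Proof.
have P T : polynomial_coefs co (fun x => sub_char_poly T (floquet_real (VX x) (EX x) y)).
  apply: polynomial_coefs_char_poly => i j.
  apply: eq_polynomial_fun (polynomial_fun_floquet_real y (enum_val i) (enum_val j)) => x.
  by rewrite [RHS]mxE.
apply: (@polynomial_fun_resultant _ _ _ _ _ _ #|T1| #|T2|) => // x; exact: size_sub_char_poly.
Qed.

Lemma polynomial_fun_generic : polynomial_fun co (fun x => generic_poly (VX x) (EX x)).
Proof.
apply: polynomial_funM; first apply: polynomial_funM.
- apply: polynomial_fun_prod => i; apply: polynomial_fun_prod => j.
  by case: (boolP (isthmus_adj A B i j)) => [/EX_adj_poly//|_]; exact: polynomial_fun_cst.
- exact: polynomial_fun_prod.
- apply: polynomial_fun_prod => sg.
  apply: polynomial_funM; first by apply: polynomial_funM; exact: polynomial_fun_sub_resultant.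
  apply: polynomial_fun_prod => r; apply: polynomial_fun_prod => s.
  exact: polynomial_fun_sub_resultant.
Qed.

End Polynomiality.

(** Stated for any polynomial family of parameters, so as to cover the space of all parameters and
    that of potentials with unit weights. *)
Lemma proper_algebraic_generic (X I : Type) (coord : I -> X -> R) (J : finType) (c : J -> I)
    (VX : X -> potential R Gam) (EX : X -> edge_weight R Gam) :
  (forall i, polynomial_fun (fun j => coord (c j)) (fun x => VX x (0, i))) ->
  (forall i j, isthmus_adj A B i j ->
    polynomial_fun (fun j => coord (c j)) (fun x => EX x (0, i) (0, j))) ->
  (forall k, polynomial_fun (fun j => coord (c j)) (fun x => loop_coef (EX x) k)) ->
  (exists x, generic_poly (VX x) (EX x) != 0) ->
  proper_algebraic coord [set x | generic_poly (VX x) (EX x) = 0].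
Proof.
move=> VP EP LP [x0 x0P]; have [G GE] := polynomial_fun_generic VP EP LP.
split; last first.
  move=> S; have : [set x | generic_poly (VX x) (EX x) = 0] x0 by rewrite S.
  by move=> /= e; rewrite e eqxx in x0P.
exists #|J|, 1%N, (fun k => c (enum_val k)), (fun=> G).
apply/seteqP; split=> x /=; first by move=> e _; rewrite -GE.
by move=> /(_ ord0); rewrite GE.
Qed.

End GenericPolynomial.

Section Gershgorin.
Context {R : realType} {n : nat}.
Local Notation C := (Cplx R).

(** Take the equation at the largest coordinate of a kernel vector, which lies in [T]. The sum runs
    over all indices, so one bound serves every [T]. *)
Lemma gershgorin (M : 'M[C]_n) (T : {set 'I_n}) : principal_minor M T = 0 ->
  exists2 j, j \in T & `|M j j| <= \sum_(i | i != j) `|M i j|.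
Proof.
move=> /eqP/principal_minor_eq0P[v [v0 vT vM]].
have [i0 vi0] := rV0Pn _ v0.
have ReE i : toC R (complex.Re `|v 0 i|) = `|v 0 i| by exact: RRe_real (normr_real _).
case: (@arg_maxP _ R 'I_n i0 predT (fun i => complex.Re `|v 0 i|) isT) => j _ jmax.
have vmax i : `|v 0 i| <= `|v 0 j| by rewrite -(ReE i) -(ReE j) toC_le; exact: jmax.
have vj : 0 < `|v 0 j| by apply: lt_le_trans (vmax i0); rewrite normr_gt0.
have jT : j \in T by apply: contraTT vj => /vT->; rewrite normr0 ltxx.
exists j => //; have := vM j jT; rewrite mxE (bigD1 j) //= => /eqP.
rewrite addr_eq0 => /eqP/(congr1 Num.norm); rewrite normrN normrM => e.
rewrite -(ler_pM2l vj) e; apply: le_trans (ler_norm_sum _ _ _) _.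
by rewrite mulr_sumr; apply: ler_sum => i _; rewrite normrM ler_wpM2r.
Qed.

End Gershgorin.

(** * Adding vertices without creating common eigenvalues *)

Section AddVertex.
Context {R : realType} {n : nat}.
Local Notation C := (Cplx R).
Implicit Types (M : 'M[R]_n) (T : {set 'I_n}).

Definition no_common_eigenvalue M T1 T2 : Prop :=
  coprimep (sub_char_poly T1 M) (sub_char_poly T2 M).

Lemma sub_char_polyE (F : comNzRingType) (M : 'M[F]_n) T :
  sub_char_poly T M = principal_minor (char_poly_mx M) T.
Proof. by rewrite principal_minor_char_poly. Qed.

Lemma sub_char_poly_add_diag M T (l : 'I_n) (x : R) : l \notin T ->
  sub_char_poly (l |: T)%SET (M + x *: delta_mx l l) =
  sub_char_poly (l |: T)%SET M - x *: sub_char_poly T M.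
Proof.
move=> lT; rewrite !sub_char_polyE.
have -> : char_poly_mx (M + x *: delta_mx l l) = char_poly_mx M + (- x%:P) *: delta_mx l l.
  apply/matrixP=> i j; rewrite !mxE rmorphD rmorphM /= opprD addrA; congr (_ + _).
  by rewrite mulNr; case: (_ && _); rewrite ?mulr1 ?mulr0 // ?rmorph1 ?rmorph0 ?mulr1 ?mulr0.
by rewrite principal_minor_add_diag // mulNr mul_polyC.
Qed.

Lemma monic_sub_char_poly M T : sub_char_poly T M \is monic.
Proof. exact: char_poly_monic. Qed.

Lemma form_real (M : 'M[R]_n) (w : 'rV[C]_n) : M^T = M -> form (map_mx (toC R) M) w \is Num.real.
Proof.
move=> sM; have hM := hermitian_map sM.
have -> : w = (w *m invmx (spectralmx (map_mx (toC R) M))) *m spectralmx (map_mx (toC R) M).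
  by rewrite mulmxKV // spectral_unit.
rewrite form_spectral //; apply: rpred_sum => i _.
by rewrite eigsE // rpredM ?rpredX ?normr_real //; apply/complex_realP; eexists.
Qed.

(* If the quotient were X - c, then c would be real; evaluating at X = i gives a
   singular matrix whose imaginary part is the projection on T. *)
Lemma sub_char_poly_ndvd M T (l t : 'I_n) : M^T = M -> l \notin T -> t \in T -> M l t != 0 ->
  ~~ (sub_char_poly T M %| sub_char_poly (l |: T)%SET M).
Proof.
move=> sM lT tT Mlt; apply/negP => /dvdpP[r qr].
have mp := monic_sub_char_poly M T.
have r0 : r != 0.
  by apply: contra_eq_neq qr => ->; rewrite mul0r monic_neq0 // monic_sub_char_poly.
have sr : size r = 2%N.
  have := congr1 (fun q : {poly R} => size q) qr; rewrite size_Mmonic // !size_sub_char_poly.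
  by rewrite cardsU1 lT addnS /= => e; apply/eqP; rewrite -(eqn_add2r #|T|) -e.
have lr : lead_coef r = 1.
  have := monic_sub_char_poly M (l |: T)%SET; rewrite qr monicE lead_coef_Mmonic //.
  by move/eqP.
have rE : r = 'X + (r`_0)%:P.
  apply/polyP => -[|[|k]]; rewrite coefD coefX coefC /=.
  - by rewrite add0r.
  - by rewrite addr0 -lr lead_coefE sr.
  - by rewrite addr0 nth_default // sr.
set c := r`_0 in rE.
pose N := M + c *: delta_mx l l.
have sN : N^T = N by rewrite linearD linearZ /= trmx_delta sM.
pose D : 'M[C]_n := diag_mx (\row_i ('i *+ (i \in T))).
have : principal_minor (D - map_mx (toC R) N) (l |: T)%SET = 0.
  pose K : 'M[C]_n := 'i%:M - map_mx (toC R) M.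
  have KE S : principal_minor K S = (map_poly (toC R) (sub_char_poly S M)).['i].
    rewrite map_sub_char_poly sub_char_polyE -[RHS]horner_evalE -map_principal_minor.
    apply: eq_principal_minor => i j _ _.
    by rewrite !mxE /= horner_evalE hornerD hornerN hornerMn hornerX hornerC.
  (* Expanding in the diagonal entry at [l] gives [q(i) - (i + c) p(i)] for the two characteristic
     polynomials, zero because [q = (X + c) p]. *)
  have qK : principal_minor (K + (- ('i + toC R c)) *: delta_mx l l) (l |: T)%SET = 0.
    rewrite principal_minor_add_diag // !KE qr rmorphM rE rmorphD /= map_polyX map_polyC.
    by rewrite hornerM hornerD hornerX hornerC mulNr; exact: subrr.
  rewrite -qK; apply: eq_principal_minor => i j; rewrite !inE => iS jS.
  rewrite !mxE rmorphD rmorphM rmorph_nat.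
  have [eij|nij] := eqVneq i j; last first.
    rewrite !mulr0n !sub0r; case: eqVneq => [il|] /=; last by rewrite !mulr0 !addr0.
    by rewrite -il eq_sym (negPf nij) !mulr0 !addr0.
  rewrite -eij !mulr1n andbb; case: (eqVneq i l) iS => [->|il] /= iS.
    by rewrite (negPf lT) mulr0n !mulr1; ring.
  by rewrite iS mulr1n !mulr0 !addr0.
move=> /eqP/principal_minor_eq0P[w [w0 wS wM]].
have f0 : form (D - map_mx (toC R) N) w = 0.
  rewrite /form mxE big1 // => j _; rewrite [_^T%sesqui]lock.
  have [jS|jS] := boolP (j \in (l |: T)%SET); first by rewrite wM ?mul0r.
  by rewrite -lock !mxE wS // rmorph0 mulr0.
have fN := form_real w sN.
have fD : form D w = 'i * \sum_(j in T) `|w 0 j| ^+ 2.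
  rewrite form_diag mulr_sumr [RHS]big_mkcond /=; apply: eq_bigr => j _.
  by rewrite mxE; case: (j \in T); rewrite ?mulr0n ?mul0r // mulr1n.
set sig := \sum_(j in T) _ in fD.
have sig0 : 0 <= sig by apply: sumr_ge0 => j _; rewrite exprn_ge0.
have isig : 'i * sig \is Num.real.
  have <- : form (map_mx (toC R) N) w = 'i * sig.
    have := formD (D - map_mx (toC R) N) (map_mx (toC R) N) w.
    by rewrite subrK f0 add0r fD.
  exact: fN.
(* The square of the real number ['i * sig] is both nonnegative and equal to [- sig ^+ 2]. Thus [w]
   vanishes on [T] and is supported at [l], and the equation at [t] contradicts [M l t != 0]. *)
have /eqP : sig = 0.
  have := real_exprn_even_ge0 isig (isT : ~~ odd 2); rewrite exprMn sqrCi mulN1r oppr_ge0 => s2.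
  by apply/eqP; rewrite -sqrf_eq0 eq_le s2 exprn_ge0.
rewrite psumr_eq0 => [/allP wT0|j _]; last by rewrite exprn_ge0.
have wT j : j \in T -> w 0 j = 0.
  move=> jT; have := wT0 j (mem_index_enum _); rewrite jT expf_eq0 normr_eq0 /=.
  by move/eqP.
have wl i : i != l -> w 0 i = 0.
  move=> il; have [/wT//|iT] := boolP (i \in T).
  by apply: wS; rewrite !inE negb_or il.
have wl0 : w 0 l != 0.
  by apply: contraNneq w0 => e; apply/eqP/rowP => i; rewrite mxE; case: (eqVneq i l) => [->|/wl].
have := wM t; rewrite !inE tT orbT => /(_ isT); rewrite mxE (bigD1 l) //= big1 ?addr0; last first.
  by move=> i /wl->; rewrite mul0r.
have tl : t != l by apply: contraTneq tT => ->.
have lt : l == t = false by rewrite eq_sym (negPf tl).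
move/eqP; rewrite mulf_eq0 (negPf wl0) orFb !mxE lt (negPf tl) andbF mulr0 addr0 mulr0n.
by rewrite sub0r oppr_eq0 fmorph_eq0 (negPf Mlt).
Qed.

Lemma natr_avoid (s : seq C) (k0 : nat) : exists2 k, (k0 <= k)%N & (k%:R : C) \notin s.
Proof.
pose t := [seq (k%:R : C) | k <- iota k0 (size s).+1].
have ut : uniq t by rewrite map_inj_uniq ?iota_uniq // => i j /eqP; rewrite eqr_nat => /eqP.
have : ~~ all (mem s) t.
  apply/negP => /allP ts; have := uniq_leq_size ut ts.
  by rewrite size_map size_iota ltnn.
case/allPn => _ /mapP[k ki ->] ks; exists k => //.
by move: ki; rewrite mem_iota => /andP[].
Qed.

(* A common root for the diagonal entry x is a root of the resolvent polynomial
   [q p1 - q1 p], which determines x; so only finitely many x are excluded. *)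
Lemma add_vertex M T (u l t : 'I_n) (be : R) : M^T = M -> l \notin T -> u \in T -> t \in T ->
  M l t != 0 -> no_common_eigenvalue M T (T :\ u)%SET ->
  exists2 x : R, be <= x & no_common_eigenvalue (M + x *: delta_mx l l)
    (l |: T)%SET ((l |: T) :\ u)%SET.
Proof.
move=> sM lT uT tT Mlt; set T1 := (T :\ u)%SET => cop.
have lT1 : l \notin T1 by rewrite !inE negb_and lT orbT.
have ul : u != l by apply: contraTneq uT => ->.
have -> : ((l |: T) :\ u)%SET = (l |: T1)%SET.
  by apply/setP => i; rewrite !inE; case: (eqVneq i l) => [->|] //=; rewrite eq_sym ul.
set p := sub_char_poly T M in cop; set p1 := sub_char_poly T1 M in cop.
set q := sub_char_poly (l |: T)%SET M; set q1 := sub_char_poly (l |: T1)%SET M.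
have r0 : q * p1 - q1 * p != 0.
  rewrite subr_eq0; apply: contraTneq (sub_char_poly_ndvd sM lT tT Mlt) => e.
  by rewrite negbK -(Gauss_dvdpl _ cop) e dvdp_mull.
have [rs rE] := closed_field_poly_normal (map_poly (toC R) (q * p1 - q1 * p)).
pose pC (h : {poly R}) (y : C) := (map_poly (toC R) h).[y].
pose bad := [seq pC q y / pC p y | y <- rs] ++ [seq pC q1 y / pC p1 y | y <- rs].
have [N0 N0b] : exists N0, be <= N0%:R.
  exists (Num.bound `|be|); apply: le_trans (ler_norm be) (ltW (archi_boundP (normr_ge0 be))).
have [k k0 kbad] := natr_avoid bad N0.
exists k%:R; first by apply: le_trans N0b _; rewrite ler_nat.
rewrite /no_common_eigenvalue !sub_char_poly_add_diag // -/p -/p1 -/q -/q1.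
rewrite -(coprimep_map (toC R)) /coprimep; apply/negPn/negP => /closed_rootP[y].
rewrite root_gcd => /andP[].
have evalE (h g : {poly R}) : root (map_poly (toC R) (h - k%:R *: g)) y -> pC h y = k%:R * pC g y.
  rewrite /root rmorphB hornerD hornerN subr_eq0 => /eqP; rewrite /pC => ->.
  by rewrite [X in X.[y]](map_polyZ (toC R) k%:R g) hornerZ rmorph_nat.
move=> /evalE qy /evalE q1y.
have yrs : y \in rs.
  have : root (map_poly (toC R) (q * p1 - q1 * p)) y.
    rewrite /root rmorphB !rmorphM hornerD hornerN !hornerM -!/(pC _ y) qy q1y.
    by apply/eqP; ring.
  by rewrite rE rootZ ?lead_coef_eq0 ?map_poly_eq0 // root_prod_XsubC.
(* By coprimality [p] and [p1] do not both vanish at [y], so at least one of the quotients in [bad]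
   recovers the entry. *)
have [py|py] := eqVneq (pC p y) 0; last first.
  case/negP: kbad; rewrite mem_cat; apply/orP; left; apply/mapP; exists y => //.
  by rewrite qy mulfK.
have [p1y|p1y] := eqVneq (pC p1 y) 0; last first.
  case/negP: kbad; rewrite mem_cat; apply/orP; right; apply/mapP; exists y => //.
  by rewrite q1y mulfK.
have copC : coprimep (map_poly (toC R) p) (map_poly (toC R) p1) by rewrite coprimep_map.
have := coprimep_root copC (introT eqP py).
by rewrite -/(pC p1 y) p1y eqxx.
Qed.

End AddVertex.

Section ConnectedGraph.
Context {R : realType} {n : nat}.

Lemma connect_crossing (F : finType) (e : rel F) (T : {set F}) u v :
  connect e u v -> u \in T -> v \notin T -> exists x y, [/\ x \in T, y \notin T & e x y].
Proof.
move=> /connectP[p ep ->]; elim: p u ep => [|w p IH] u /=; first by move=> _ ->.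
move=> /andP[euw ep] uT vT; have [wT|wT] := boolP (w \in T); first exact: (IH w).
by exists u, w.
Qed.

Lemma no_common_eigenvalue_set0 (M : 'M[R]_n) T : no_common_eigenvalue M T finset.set0.
Proof.
have /size_poly1P[c _ cE] : size (sub_char_poly finset.set0 M) == 1%N.
  by rewrite size_sub_char_poly cards0.
have := monic_sub_char_poly M finset.set0; rewrite /no_common_eigenvalue cE.
by rewrite monicE lead_coefC => /eqP ->; exact: coprimep1.
Qed.

(** Growth starts from [h u] alone, where removing [h u] leaves the empty block. Connectedness
    always offers a new vertex adjacent to the current set, the nonzero coupling that [add_vertex]
    requires. *)
Lemma connected_no_common_eigenvalue k (G : sgraph k) (h : 'I_k -> 'I_n) (W : 'M[R]_n)
    (u : 'I_k) (be : R) : W^T = W -> connected_sgraph G ->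
  (forall x y, G x y -> W (h x) (h y) != 0) ->
  exists2 v : 'rV[R]_n, (forall i, be <= v 0 i) &
    no_common_eigenvalue (W + diag_mx v) (h @: 'I_k)%SET ((h @: 'I_k) :\ h u)%SET.
Proof.
move=> sW Gc GW; set T0 := (h @: _)%SET.
suff grow : forall N (T : {set 'I_n}) (v : 'rV[R]_n), (#|T0 :\: T| <= N)%N -> T \subset T0 ->
    h u \in T -> (forall i, be <= v 0 i) ->
    no_common_eigenvalue (W + diag_mx v) T (T :\ h u)%SET ->
  exists2 v : 'rV[R]_n, (forall i, be <= v 0 i) &
    no_common_eigenvalue (W + diag_mx v) T0 (T0 :\ h u)%SET.
  apply: (grow _ (finset.set1 (h u)) (const_mx be) (leqnn _)).
  - by rewrite finset.sub1set imset_f.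
  - exact: finset.set11.
  - by move=> i; rewrite mxE.
  - by rewrite finset.setDv; exact: no_common_eigenvalue_set0.
elim=> [|N IH] T v TN TT uT vbe cop.
  suff <- : T = T0 by exists v.
  by apply/eqP; rewrite finset.eqEsubset TT -finset.setD_eq0 -cards_eq0 -leqn0.
have [/eqP TE|] := boolP (T0 :\: T == finset.set0)%SET.
  by apply: IH cop => //; rewrite TE cards0.
case/finset.set0Pn => z; rewrite finset.in_setD => /andP[zT /imsetP[z' _ zE]].
rewrite {}zE in zT.
have [x [y [xT yT xy]]] : exists x y, [/\ x \in (h @^-1: T)%SET, y \notin (h @^-1: T)%SET & G x y].
  by apply: connect_crossing (Gc u z') _ _; rewrite finset.in_set.
rewrite !finset.in_set in xT yT.
have Wyx : (W + diag_mx v) (h y) (h x) != 0.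
  rewrite !mxE (_ : (h y == h x) = false); first by rewrite mulr0n addr0 GW // adj_sym.
  by apply: contraNF yT => /eqP ->.
have sM : (W + diag_mx v)^T = W + diag_mx v by rewrite linearD /= sW tr_diag_mx.
(* This lower bound on the shift keeps the new diagonal entry at least [be]. *)
have [c bc] := add_vertex (be - v 0 (h y)) sM yT uT xT Wyx cop.
have -> : W + diag_mx v + c *: delta_mx (h y) (h y) = W + diag_mx (v + c *: delta_mx 0 (h y)).
  rewrite linearD linearZ /= addrA; congr (_ + _ *: _).
  apply/matrixP=> i j; rewrite !mxE eqxx /=; have [->|ij] := eqVneq i j.
    by rewrite andbb mulr1n.
  by rewrite mulr0n; case: eqVneq => //= <-; rewrite eq_sym (negPf ij).
apply: IH.
- rewrite -ltnS; apply: leq_trans TN; apply: proper_card; apply/properP; split.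
    by rewrite finset.setDS // finset.subsetUr.
  exists (h y); first by rewrite finset.in_setD yT imset_f.
  by rewrite finset.in_setD finset.setU11.
- by rewrite finset.subUset TT andbT finset.sub1set imset_f.
- by rewrite finset.in_setU uT orbT.
- move=> i; rewrite !mxE eqxx /=; have [->|_] := eqVneq i (h y).
    by rewrite mulr1 -lerBlDl.
  by rewrite mulr0 addr0.
Qed.

End ConnectedGraph.

(** * A generic potential for unit weights *)

Section UnitWeight.
Context {R : realType} {d a m b : nat} {A : sgraph a} {B : sgraph b} {f : 'I_d -> 'I_m}.
Local Notation Gam := (isthmus_connected A B f).
Local Notation C := (Cplx R).
Local Notation n := (a + m + b)%N.
Local Notation loop_vertex k := (@loop_vertex d a m b f k).
Local Notation path_vertex r := (@isthmus_vertex a m b r).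
Implicit Types (T : {set 'I_n}) (v w : 'rV[R]_n).

Definition row_potential v : potential R Gam :=
  @Potential R d Gam (fun p : 'rV[int]_d * 'I_n => v 0 p.2) (fun _ _ => erefl).

Definition adjacency_mx : 'M[R]_n := \matrix_(i, j) (isthmus_adj A B i j)%:R.

Local Notation S v y := (floquet_real (row_potential v) (unit_weight R Gam) y).

Lemma floquet_realU v y i j : S v y i j =
  adjacency_mx i j + (v 0 i + \sum_(k | loop_vertex k == i) 2 * y 0 k) *+ (i == j).
Proof.
rewrite !mxE /edge_coef; case: (isthmus_adj A B i j); congr (_ + (_ + _) *+ _);
  by apply: eq_bigr => k _; rewrite mul1r.
Qed.

Lemma adjacency_mx_sym : adjacency_mx^T = adjacency_mx.
Proof. by apply/matrixP=> i j; rewrite !mxE isthmus_adj_sym. Qed.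

(** Off the path there are no loops, so the block does not depend on [y]: a potential found for the
    bare adjacency matrix works at every corner point. *)
Lemma sub_resultant_row_potential v w T T' y : (forall i, i \in T -> ~~ path_index i) ->
  (forall i, i \in T -> v 0 i = w 0 i) -> T' \subset T ->
  no_common_eigenvalue (adjacency_mx + diag_mx w) T T' ->
  sub_resultant T T' (S v y) != 0.
Proof.
move=> Tp vw sT'T; have E T0 : T0 \subset T ->
    sub_char_poly T0 (S v y) = sub_char_poly T0 (adjacency_mx + diag_mx w).
  move=> /fintype.subsetP sT; congr char_poly; apply/matrixP=> i j; rewrite [LHS]mxE [RHS]mxE.
  have /sT iT := enum_valP i; rewrite floquet_realU [RHS]mxE; congr (_ + _).
  rewrite mxE vw // big1 ?addr0 // => k /eqP ki.
  by have := Tp _ iT; rewrite -ki path_index_isthmus.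
move=> /eqP cop; rewrite /sub_resultant !E ?fintype.subxx // resultant_eq0 -leqNgt.
exact: eq_leq.
Qed.

(** By Gershgorin, the adjacency entries, each 0 or 1, contribute at most [n], and the [d] loops at
    most 2 each at a corner point. *)
Lemma root_row_potential v sg T (lam : C) :
  root (map_poly (toC R) (sub_char_poly T (S v (corner_row sg)))) lam ->
  exists2 j, j \in T & `|toC R (v 0 j) - lam| <= (n + 2 * d)%:R.
Proof.
rewrite map_sub_char_poly root_sub_char_poly => /eqP/gershgorin[j jT].
have ME (M : 'M[R]_n) i k : (map_mx (toC R) M - lam%:M) i k = toC R (M i k) - lam *+ (i == k).
  by rewrite !mxE.
set y := corner_row sg; rewrite ME eqxx mulr1n floquet_realU eqxx mulr1n.
rewrite [adjacency_mx j j]mxE isthmus_adj_irr add0r rmorphD.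
set c := toC R (\sum_(k | _) _) => jM; exists j => //.
have cd : `|c| <= (2 * d)%:R.
  rewrite /c rmorph_sum; apply: le_trans (ler_norm_sum _ _ _) _.
  have -> : (2 * d)%:R = \sum_(k < d) (2 : C) by rewrite sumr_const card_ord mulrnA.
  rewrite big_mkcond; apply: ler_sum => k _; case: ifP => _; last exact: ler0n.
  by rewrite mxE mulrC rmorphM rmorph_nat rmorphXn rmorphN1 normrMsign normr_nat.
have offdiag : \sum_(i | i != j) `|(map_mx (toC R) (S v y) - lam%:M) i j| <= n%:R.
  have -> : n%:R = \sum_(i < n) (1 : C) by rewrite sumr_const card_ord.
  rewrite big_mkcond; apply: ler_sum => i _; case: ifP => [ij|_]; last exact: ler01.
  rewrite ME floquet_realU (negPf ij) !mulr0n addr0 subr0 [adjacency_mx i j]mxE.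
  by rewrite rmorph_nat normr_nat; case: isthmus_adj; [exact: lexx|exact: ler01].
have -> : toC R (v 0 j) - lam = (toC R (v 0 j) + c - lam) - c by rewrite addrAC addrK.
apply: le_trans (ler_normB _ _) _; rewrite natrD.
exact: lerD (le_trans jM offdiag) cd.
Qed.

Lemma sub_resultant_separated v sg T1 T2 :
  (forall i j, i \in T1 -> j \in T2 -> v 0 i + (n + 2 * d)%:R *+ 2 < v 0 j) ->
  sub_resultant T1 T2 (S v (corner_row sg)) != 0.
Proof.
move=> sep; apply/sub_resultant_neq0 => lam [/root_row_potential[i iT il]].
move=> /root_row_potential[j jT jl]; have := sep i j iT jT; apply/negP; rewrite -leNgt.
rewrite -toC_le rmorphD rmorphMn rmorph_nat -lerBlDl.
have -> : toC R (v 0 j) - toC R (v 0 i) = (toC R (v 0 j) - lam) - (toC R (v 0 i) - lam).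
  by rewrite opprB addrA subrK.
set x := _ - _ in jl *; set z := _ - _ in il *.
have xzR : x - z \is Num.real.
  rewrite /x /z opprB addrA subrK -rmorphB.
  by apply/complex_realP; eexists.
apply: le_trans (real_ler_norm xzR) _; apply: le_trans (ler_normB _ _) _.
by rewrite mulr2n; exact: lerD.
Qed.

Lemma below_no_common_eigenvalue : connected_sgraph A ->
  exists v, no_common_eigenvalue (adjacency_mx + diag_mx v) (indices_below a) (indices_below a.-1).
Proof.
move=> Ac; have [a0|a0] := posnP a.
  exists 0; suff -> : indices_below a.-1 = finset.set0 :> {set 'I_n}.
    exact: no_common_eigenvalue_set0.
  by apply/finset.setP => i; rewrite !finset.in_set; lia.
have a1 : (a.-1 < a)%N by rewrite prednK.
pose h (x : 'I_a) : 'I_n := lshift b (lshift m x).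
have hadj x y : A x y -> adjacency_mx (h x) (h y) != 0.
  by move=> xy; rewrite mxE (isthmus_adj_A A B (x := x) (y := y)) // xy oner_neq0.
have [v _] := connected_no_common_eigenvalue (Ordinal a1) 0 adjacency_mx_sym Ac hadj.
have -> : (h @: 'I_a)%SET = indices_below a.
  apply/finset.setP => i; rewrite finset.in_set; apply/imsetP/idP => [[x _ ->]|ia].
    exact: (ltn_ord x).
  by exists (Ordinal ia) => //; apply/val_inj.
have -> : (indices_below a :\ h (Ordinal a1))%SET = indices_below a.-1.
  by apply/finset.setP => i; rewrite finset.in_setD1 !finset.in_set -val_eqE /=; lia.
by exists v.
Qed.

Lemma from_no_common_eigenvalue (be : R) : connected_sgraph B ->
  exists2 v : 'rV[R]_n, (forall i, be <= v 0 i) & no_common_eigenvalue (adjacency_mx + diag_mx v)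
    (indices_from (a + m)) (indices_from (a + m).+1).
Proof.
move=> Bc; have [b0|b0] := posnP b.
  exists (const_mx be) => [i|]; first by rewrite mxE.
  suff -> : indices_from (a + m).+1 = finset.set0 :> {set 'I_n}.
    exact: no_common_eigenvalue_set0.
  apply/finset.setP => i; rewrite !finset.in_set; have := ltn_ord i; lia.
pose h (x : 'I_b) : 'I_n := rshift (a + m) x.
have hadj x y : B x y -> adjacency_mx (h x) (h y) != 0.
  by move=> xy; rewrite mxE (isthmus_adj_B A B (x := x) (y := y)) // xy oner_neq0.
have [v vbe] := connected_no_common_eigenvalue (Ordinal b0) be adjacency_mx_sym Bc hadj.
have -> : (h @: 'I_b)%SET = indices_from (a + m).
  apply/finset.setP => i; rewrite finset.in_set; apply/imsetP/idP => [[x _ ->]|ia].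
    exact: (leq_addr x (a + m)).
  have ib : (i - (a + m) < b)%N by have := ltn_ord i; lia.
  by exists (Ordinal ib) => //; apply/val_inj; rewrite /= subnKC.
have -> : (indices_from (a + m) :\ h (Ordinal b0))%SET = indices_from (a + m).+1.
  by apply/finset.setP => i; rewrite finset.in_setD1 !finset.in_set -val_eqE /=; lia.
by exists v.
Qed.

(* The three pieces of the potential are so far apart that eigenvalues below a path
   vertex and above it cannot meet. *)
Lemma exists_generic_potential : connected_sgraph A -> connected_sgraph B ->
  exists V : potential R Gam, generic_poly V (unit_weight R Gam) != 0.
Proof.
move=> Ac Bc; have [vA copA] := below_no_common_eigenvalue Ac.
(* [mu] bounds the potential on [A], and [K] exceeds twice the Gershgorin radius. On the path the
   potential climbs by [K] at each vertex, starting at least [K] above [mu]; the bound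
   [mu + K * n.+1%:R] on [B] lies at least [K] above all of it. *)
pose mu := \sum_i `|vA 0 i|; pose K : R := (n + 2 * d)%:R *+ 2 + 1.
have K0 : 0 < K by rewrite ltr_wpDl // mulrn_wge0.
have [vB vBbe copB] := from_no_common_eigenvalue (mu + K * n.+1%:R) Bc.
pose v : 'rV[R]_n := \row_i (if (i < a)%N then vA 0 i else
  if (i < a + m)%N then mu + K * i.+1%:R else vB 0 i).
have vA_mu i : vA 0 i <= mu.
  by rewrite /mu (bigD1 i) //=; apply: ler_wpDr (ler_norm _); apply: sumr_ge0.
have sep (p i j : 'I_n) : path_index p -> (i <= p)%N -> (p <= j)%N -> (i < j)%N ->
    v 0 i + (n + 2 * d)%:R *+ 2 < v 0 j.
  have KE : (n + 2 * d)%:R *+ 2 = K - 1 by rewrite addrK.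
  move=> /andP[ap pm] ip pj ij; rewrite KE !mxE.
  have ja : (j < a)%N = false by lia.
  have iam : (i < a + m)%N by lia.
  rewrite ja iam.
  have Kle k l : (k <= l)%N -> K * k%:R <= K * l%:R by move=> kl; rewrite ler_pM2l // ler_nat.
  have Kn : K * n.+1%:R = K * n%:R + K by rewrite -natr1 mulrDr mulr1.
  have Kj : K * j.+1%:R = K * j%:R + K by rewrite -natr1 mulrDr mulr1.
  have Kj0 : 0 <= K * j%:R by rewrite mulr_ge0 ?ler0n // ltW.
  have Kn0 : 0 <= K * n%:R by rewrite mulr_ge0 ?ler0n // ltW.
  have := vA_mu i; have := vBbe j; have := Kle _ _ ij; have := Kle i.+1 n (ltn_ord i).
  by case: ifP => _; case: ifP => _; lra.
exists (row_potential v); rewrite /generic_poly !mulf_neq0 //.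
- apply/prodf_neq0 => i _; apply/prodf_neq0 => j _.
  by case: ifP => _; rewrite oner_neq0.
- by apply/prodf_neq0 => k _; rewrite oner_neq0.
apply/prodf_neq0 => sg _; rewrite /generic_resultants !mulf_neq0 //.
- apply: (sub_resultant_row_potential _ _ _ _ copA) => [i|i|].
  + by rewrite finset.in_set /path_index; lia.
  + by rewrite finset.in_set mxE => ->.
  + by apply/fintype.subsetP => i; rewrite !finset.in_set; lia.
- apply: (sub_resultant_row_potential _ _ _ _ copB) => [i|i|].
  + by rewrite finset.in_set /path_index; lia.
  + rewrite finset.in_set mxE => ami; rewrite (_ : (i < a)%N = false); last by lia.
    by rewrite (_ : (i < a + m)%N = false) //; lia.
  + by apply/fintype.subsetP => i; rewrite !finset.in_set; lia.
- apply/prodf_neq0 => r _; apply/prodf_neq0 => s rs.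
  apply: sub_resultant_separated => i j; rewrite !finset.in_set => ir sj.
  apply: (sep (path_vertex r)); rewrite ?path_index_isthmus //=.
  + exact: ltnW.
  + by move: sj; rewrite /=; lia.
  + by move: ir sj; rewrite /=; lia.
Qed.

End UnitWeight.

(** * Proper algebraic exceptional sets *)

Section SpectralEdges.
Context {R : realType} {d a m b : nat} {A : sgraph a} {B : sgraph b} {f : 'I_d -> 'I_m}.
Local Notation Gam := (isthmus_connected A B f).
Local Notation n := (a + m + b)%N.
Local Notation loop_vertex k := (@loop_vertex d a m b f k).

Lemma isthmus_edge (i j : 'I_n) : isthmus_adj A B i j ->
  edge (p := Gam) (0, i) (0, j).
Proof. by move=> ij; rewrite /= /connected_edge /= eqxx ij. Qed.

Lemma loop_edge k : edge (p := Gam) (0, loop_vertex k) (basis_vector k, loop_vertex k).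
Proof. by apply/orP; right; apply/existsP; exists k; rewrite /= !eqxx add0r eqxx. Qed.

Lemma isthmus_spectral_edges : (0 < d)%N -> connected_sgraph A -> connected_sgraph B ->
  spectral_edges_conjecture R Gam.
Proof.
move=> d0 Ac Bc; exists [set VE | generic_poly VE.1 VE.2 = 0]; split; last first.
  move=> V E /= /eqP VE; apply: generic_spectral_edges_regular => //.
  exact: generic_poly_isthmus.
(* Edge coordinates exist only for pairs carrying a proof of adjacency; a pair that is not an edge
   receives a vertex coordinate as a dummy value. *)
pose c (j : 'I_n + ('I_n * 'I_n + 'I_d)) :
    vertex Gam + {e : vertex Gam * vertex Gam | edge e.1 e.2} :=
  match j with
  | inl i => inl (0, i)
  | inr (inl (i, j)) =>
      if insub ((0, i), (0, j)) is Some e then inr e else inl (0, i)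
  | inr (inr k) => inr (exist _ ((0, loop_vertex k), (basis_vector k, loop_vertex k)) (loop_edge k))
  end.
apply: (@proper_algebraic_generic _ _ _ _ _ _ _ _ _ _ _ _ c).
- move=> i; exact: (polynomial_fun_coord _ (inl i)).
- move=> i j ij; apply: eq_polynomial_fun (polynomial_fun_coord _ (inr (inl (i, j)))) => x /=.
  by rewrite insubT //=; exact: isthmus_edge.
- move=> k; exact: (polynomial_fun_coord _ (inr (inr k))).
(* The generic potential for unit weights is at the same time a point of the full parameter space
   outside the exceptional set. *)
- by have [V VU] := exists_generic_potential (R := R) (f := f) Ac Bc; exists (V, unit_weight R Gam).
Qed.

Lemma isthmus_schrodinger_spectral_edges : (0 < d)%N -> connected_sgraph A -> connected_sgraph B ->
  schrodinger_spectral_edges_conjecture R Gam.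
Proof.
move=> d0 Ac Bc; exists [set V | generic_poly V (unit_weight R Gam) = 0]; split; last first.
  move=> V /= /eqP VE; apply: generic_spectral_edges_regular => //.
  exact: generic_poly_isthmus.
apply: (@proper_algebraic_generic _ _ _ _ _ _ _ _ _ _ _ _ (fun i : 'I_n => (0, i))
  id (fun=> unit_weight R Gam)).
- move=> i; exact: (polynomial_fun_coord _ i).
- by move=> i j _; exact: polynomial_fun_cst.
- by move=> k; exact: polynomial_fun_cst.
- exact: exists_generic_potential.
Qed.

End SpectralEdges.

Theorem theorem3p2 (R : realType) (d a m b : nat) (A : sgraph a) (B : sgraph b)
    (f : 'I_d -> 'I_m) :
  (0 < d)%N -> (0 < m)%N -> connected_sgraph A -> connected_sgraph B ->
  (forall E : edge_weight R (isthmus_connected A B f), nonvanishing E ->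
   forall V : potential R (isthmus_connected A B f), isthmus_generic V E ->
   forall p, critical_point V E p ->
     corner p.1 /\ nondegenerate_critical V E p) /\
  spectral_edges_conjecture R (isthmus_connected A B f) /\
  schrodinger_spectral_edges_conjecture R (isthmus_connected A B f).
Proof.
move=> d0 _ Ac Bc; split; [|split].
- by move=> E _ V VE p; exact: critical_point_corner.
- exact: isthmus_spectral_edges.
- exact: isthmus_schrodinger_spectral_edges.
Qed.
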